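(* Let $P,\Lambda,\sigma^2,\sigma_S^2>0$. For the Dirty Paper AVC with encoder power constraint $P$, adversary power constraint $\Lambda$, noise variance $\sigma^2$ and state variance $\sigma_S^2$, the randomized coding capacity is the same under the maximum probability of error criterion and the average probability of error criterion; both equal $\frac12\log\left(1+\frac{P}{\Lambda+\sigma^2}\right)$.
   Context: All logarithms are base 2; $\|\cdot\|$ is the Euclidean norm on $\mathbb R^n$. Dirty Paper AVC (DP-AVC). Over $n$ channel uses the decoder receives $\mathbf Y=\mathbf X+\mathbf S+\mathbf J+\mathbf Z\in\mathbb R^n$, where $\mathbf X$ is the encoder's input, the state $\mathbf S$ has i.i.d. $\mathcal N(0,\sigma_S^2)$ components, $\mathbf J$ is the adversary's input, and the noise $\mathbf Z$ has i.i.d. $\mathcal N(0,\sigma^2)$ components and is independent of everything else. $\mathbf S$ is independent of the message $M$ and of the shared randomness. The decoder does not know $\mathbf S$. An $(n,R,P)$ deterministic code ($2^{nR}$ an integer) is a pair $(\psi,\phi)$ of (measurable) maps $\psi:\{1,\dots,2^{nR}\}\times\mathbb R^n\to\mathbb R^n$ with $\|\psi(m,\mathbf s)\|^2\le nP$ for all $m,\mathbf s$, and $\phi:\mathbb R^n\to\{0,1,\dots,2^{nR}\}$ (output $0$ means an error is declared). An $(n,R,P)$ randomized code is a random variable $\Theta=(\Psi,\Phi)$ taking values in the set of $(n,R,P)$ deterministic codes; it is shared by encoder and decoder. The transmitted vector is $\mathbf X=\Psi(M,\mathbf S)$. The adversary knows $M$, $\mathbf S$ (non-causally) and the distribution of $\Theta$,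 but not its realization: it chooses $\mathbf J$ by an arbitrary conditional distribution $Q_{\mathbf J|M,\mathbf S}$ supported on $\mathcal J(\Lambda)=\{\mathbf j\in\mathbb R^n:\|\mathbf j\|^2\le n\Lambda\}$, with $\mathbf J$ conditionally independent of $\Theta$ given $(M,\mathbf S)$. Put $P^{(n)}_{e,m}=\max_{Q_{\mathbf J|M=m,\mathbf S}:\,\mathbf J\in\mathcal J(\Lambda)}\mathbb P(\Phi(\mathbf Y)\ne m\mid M=m)$ (max understood as supremum), the probability being over $\mathbf S$, $\mathbf J$, $\mathbf Z$ and $\Theta$. The maximum probability of error is $\max_mP^{(n)}_{e,m}$; the average probability of error is $2^{-nR}\sum_{m=1}^{2^{nR}}P^{(n)}_{e,m}$. Under a given criterion, $R$ is achievable if for every $\epsilon>0$ there is an $(n,R,P)$ randomized code for some $n$ with error probability less than $\epsilon$; the capacity is the supremum of all achievable rates. *)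

(* Defs.v *)
From HB Require Import structures.
From mathcomp Require Import all_boot all_order all_algebra.
From mathcomp Require Import all_classical all_reals all_analysis.

Set Implicit Arguments.
Unset Strict Implicit.
Unset Printing Implicit Defensive.

Import Order.TTheory GRing.Theory Num.Theory.
Import numFieldNormedType.Exports.

Local Open Scope classical_set_scope.
Local Open Scope ring_scope.

(* R^n is 'rV[R]_n with the sigma-algebra generated by the coordinates, which
   is the Borel sigma-algebra. *)
Section measurable_rV.
Context (R : realType) (n : nat).

Definition rV_coord (i : 'I_n) (x : 'rV[R]_n) : R := x ord0 i.

Let rV_set0 : g_sigma_preimage rV_coord set0.
Proof. exact: sigma_algebra0. Qed.

Let rV_setC A : g_sigma_preimage rV_coord A ->
  g_sigma_preimage rV_coord (~` A).
Proof. exact: sigma_algebraC. Qed.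

Let rV_bigcup (F : (set 'rV[R]_n)^nat) :
  (forall i, g_sigma_preimage rV_coord (F i)) ->
  g_sigma_preimage rV_coord (\bigcup_i (F i)).
Proof. exact: sigma_algebra_bigcup. Qed.

HB.instance Definition _ := @isMeasurable.Build default_measure_display
  ('rV[R]_n) (g_sigma_preimage rV_coord) rV_set0 rV_setC rV_bigcup.

End measurable_rV.

Section measurable_rV_theory.
Context (R : realType).

Lemma measurable_rV_coord n (i : 'I_n) :
  measurable_fun [set: 'rV[R]_n] (rV_coord i).
Proof.
move=> _ Y mY; rewrite setTI; apply: sub_sigma_algebra => /=.
rewrite -bigcup_seq/=; exists i => /=; first by rewrite mem_index_enum.
by exists Y => //; rewrite setTI.
Qed.

Lemma measurable_fun_rVP d (T : measurableType d) n (f : T -> 'rV[R]_n) :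
  (forall i, measurable_fun [set: T] (fun t => f t ord0 i)) ->
  measurable_fun [set: T] f.
Proof.
move=> mf; have sub : g_sigma_preimage (fun i => @rV_coord R n i \o f)
    `<=` measurable.
  apply: smallest_sub; first exact: sigma_algebra_measurable.
  rewrite -bigcup_seq; apply: bigcup_sub => i _ _ [B mB <-].
  exact: mf.
rewrite g_sigma_preimage_comp in sub.
by move=> _ A mA; apply: sub; exists A.
Qed.

Definition rV_cons n (x : measurableTypeR R * 'rV[R]_n) : 'rV[R]_n.+1 :=
  row_mx ((x.1 : R)%:M : 'rV[R]_1) x.2.

Lemma rV_cons0 n (x : measurableTypeR R * 'rV[R]_n) : rV_cons x ord0 ord0 = x.1.
Proof.
have := @row_mxEl R 1 1 n (x.1 : R)%:M x.2 ord0 ord0.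
rewrite [RHS]mxE eqxx mulr1n => <-.
by congr (row_mx _ _ _ _); exact/val_inj.
Qed.

Lemma rV_consS n (x : measurableTypeR R * 'rV[R]_n) i :
  rV_cons x ord0 (lift ord0 i) = x.2 ord0 i.
Proof.
have := @row_mxEr R 1 1 n (x.1 : R)%:M x.2 ord0 i => <-.
by congr (row_mx _ _ _ _); exact/val_inj.
Qed.

Lemma measurable_rV_cons n : measurable_fun setT (@rV_cons n).
Proof.
apply: measurable_fun_rVP => i; case: (unliftP ord0 i) => [j|] ->.
- under eq_fun do rewrite rV_consS.
  apply: (measurableT_comp (measurable_rV_coord j)).
  exact: measurable_snd.
- under eq_fun do rewrite rV_cons0.
  exact: measurable_fst.
Qed.

HB.instance Definition _ n :=
  isMeasurableFun.Build _ _ _ _ (@rV_cons n) (@measurable_rV_cons n).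

End measurable_rV_theory.

(* The law on R^n of a vector with i.i.d. components of law mu. *)
Fixpoint iid_law (R : realType) (mu : probability (measurableTypeR R) R)
    (n : nat) : probability 'rV[R]_n R :=
  if n is n'.+1 then distribution (mu \x iid_law mu n')%E (@rV_cons R n')
  else dirac (0 : 'rV[R]_0).

Lemma iid_law_box (R : realType) (mu : probability (measurableTypeR R) R) n
    (A : 'I_n -> set R) :
  (forall i, measurable (A i)) ->
  iid_law mu n [set x | forall i, A i (x ord0 i)] = (\prod_(i < n) mu (A i))%E.
Proof.
elim: n A => [|m IH] A mA.
  by rewrite big_ord0 /= diracE mem_set//= => -[].
have mB : measurable [set x : 'rV[R]_m | forall i, A (lift ord0 i) (x ord0 i)].
  rewrite (_ : [set _ | _] =
      \bigcap_(i in [set: 'I_m]) (rV_coord i @^-1` A (lift ord0 i))).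
    apply: fin_bigcap_measurable => // i _; rewrite -[X in measurable X]setTI.
    exact: measurable_rV_coord.
  by apply/seteqP; split => x h i; [move=> _; exact: h|exact: h].
rewrite big_ord_recl -IH; last by move=> i; exact: mA.
rewrite -product_measure1E//=; last exact: mA.
rewrite /distribution /pushforward; apply: congr1.
apply/seteqP; split => x /=.
  move=> h; split; first by rewrite -rV_cons0.
  by move=> i; rewrite -rV_consS.
by move=> [h0 h] i; case: (unliftP ord0 i) => [j|] ->;
  rewrite ?rV_cons0 ?rV_consS.
Qed.

Definition sqnorm (R : realType) n (x : 'rV[R]_n) : R :=
  \sum_(i < n) x ord0 i ^+ 2.

(* An (n, log2 K / n, P) deterministic code; None is the error output 0. *)
Record det_code (R : realType) (n K : nat) (P : R) := DetCode {
  enc : 'I_K -> 'rV[R]_n -> 'rV[R]_n ;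
  dec : 'rV[R]_n -> option 'I_K ;
  measurable_enc : forall m, measurable_fun setT (enc m) ;
  measurable_dec : forall o, measurable (dec @^-1` [set o]) ;
  enc_power : forall m s, sqnorm (enc m s) <= n%:R * P }.

(* The shared randomness is an arbitrary probability space. The measurability of
   theta |-> realization theta as a code-valued map is joint measurability of the
   encoder and of the decoder in (theta, input). *)
Record rand_code (R : realType) (n K : nat) (P : R) := RandCode {
  rand_disp : measure_display ;
  rand_space : measurableType rand_disp ;
  rand_law : probability rand_space R ;
  realization : rand_space -> det_code n K P ;
  measurable_rand_enc : forall m, measurable_fun setT
    (fun p : rand_space * 'rV[R]_n => enc (realization p.1) m p.2) ;
  measurable_rand_dec : forall o, measurable
    [set p : rand_space * 'rV[R]_n | dec (realization p.1) p.2 = o] }.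

Definition power_ball (R : realType) n (L : R) : set 'rV[R]_n :=
  [set j | sqnorm j <= n%:R * L].

Section DPAVC.
Context (R : realType).
Local Open Scope ereal_scope.

(* sigma is the standard deviation: the components are N(0, sigma ^+ 2). *)
Definition gauss_vec (sigma : R) n : probability 'rV[R]_n R :=
  iid_law (normal_prob 0 sigma) n.

(* The probability that Phi(Y) != m given M = m, when the adversary uses Q as
   the conditional law of J given (M = m, S). Given M = m, the joint law of
   (S, J, Z, Theta) is P_S(ds) Q(s, dj) P_Z(dz) P_Theta(dtheta). *)
Definition error_prob n K (P sigma sigmaS : R) (C : rand_code n K P)
    (m : 'I_K) (Q : R.-pker 'rV[R]_n ~> 'rV[R]_n) : \bar R :=
  \int[gauss_vec sigmaS n]_s \int[Q s]_j \int[gauss_vec sigma n]_z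
    rand_law C [set theta |
      dec (realization theta) (enc (realization theta) m s + s + j + z)%R
        <> Some m].

Definition worst_error_prob n K (P L sigma sigmaS : R) (C : rand_code n K P)
    (m : 'I_K) : \bar R :=
  ereal_sup [set error_prob sigma sigmaS C m Q | Q in
    [set Q : R.-pker 'rV[R]_n ~> 'rV[R]_n |
      forall s, Q s (power_ball L) = 1]].

Variant criterion := MaxError | AvgError.

Definition code_error (c : criterion) n K (P L sigma sigmaS : R)
    (C : rand_code n K P) : \bar R :=
  match c with
  | MaxError => \big[maxe/0]_(m < K) worst_error_prob L sigma sigmaS C m
  | AvgError =>
      (K%:R^-1)%:E * \sum_(m < K) worst_error_prob L sigma sigmaS C m
  end.

(* The blocklength is required to be positive: with n = 0 nothing is sent. *)
Definition achievable (c : criterion) (P L sigma sigmaS r : R) : Prop :=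
  forall eps : R, (0 < eps)%R ->
  exists (n K : nat) (C : rand_code n K P),
    [/\ (0 < n)%N, (K%:R = 2 `^ (n%:R * r))%R
      & code_error c L sigma sigmaS C < eps%:E].

Definition capacity (c : criterion) (P L sigma sigmaS : R) : \bar R :=
  ereal_sup [set r%:E | r in achievable c P L sigma sigmaS].

End DPAVC.

Definition log2 (R : realType) (x : R) : R := ln x / ln 2.

(* Main.v *)
(* Achievability. The shared randomness is a codebook of independent words,
   uniform on the cube [-1/2, 1/2]^n and read modulo 1, which are grouped in one
   bin per message. Given the state s, the encoder looks in the bin of m for a
   word V such that x = V - be s mod 1 is short, and sends T x. The decoder
   computes V' - be Y mod 1 for all words V': for the true one this is
   (1 - be T) x - be w mod 1, with w = J + Z, so that s is cancelled whatever its
   law, and with the MMSE scaling be T = P / (P + N) the squared norm is about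
   N / (P + N) times that of x. Pairwise independence suffices: given s and w,
   - by Chebyshev's inequality some word of the bin is short, as soon as the mean
     number of short words is a large constant;
   - x is uniform on a ball, hence nearly orthogonal to w, which depends on s but
     not on the codebook;
   - a wrong word falls in the decoding ball with the volume ratio
     (N / (P + N))^(n/2), which beats the 2^(nr) messages when
     r < 1/2 log (1 + P / N).
   Here N exceeds L + sigma^2 slightly, and |J + Z|^2 <= n N with high
   probability for all admissible J.

   Converse. The jammer draws J, independently of the message and of the state,
   from a Gaussian law of variance slightly below L, truncated to the power ball.
   Given the shared randomness and the state, the codewords are fixed points of
   the ball of squared radius n P, so that the laws of the outputs have densities
   of at most about (1 + P / N)^(n/2) with respect to one Gaussian law of variance
   P + N. The decoding sets being disjoint, 2^(nr) messages with
   r > 1/2 log (1 + P / N) cannot be decoded for large n. For each small n the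
   error is bounded below because, even without jamming, the output laws have a
   common part. *)

From HB Require Import structures.
From mathcomp Require Import all_boot all_order all_algebra.
From mathcomp Require Import all_classical all_reals all_analysis.
From mathcomp Require Import perm measurable_realfun ring lra.
Require Import Defs.

Set Implicit Arguments.
Unset Strict Implicit.
Unset Printing Implicit Defensive.

Import Order.TTheory GRing.Theory Num.Theory.
Import numFieldNormedType.Exports.

Local Open Scope classical_set_scope.
Local Open Scope ring_scope.

(** * Integrals, vectors and i.i.d. laws *)

Section integral_tools.
Local Open Scope ereal_scope.
Context (R : realType).

(** Change of variables with the image measure characterised on measurable sets, so that
    translations and reindexings apply to a measure already known by another name. *)
Lemma ge0_integral_map d d' (T : measurableType d) (T' : measurableType d')
    (m : {measure set T -> \bar R}) (m' : {measure set T' -> \bar R})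
    (phi : T -> T') (f : T' -> \bar R) :
  measurable_fun setT phi ->
  (forall A, measurable A -> m (phi @^-1` A) = m' A) ->
  measurable_fun setT f -> (forall y, 0 <= f y) ->
  \int[m]_x f (phi x) = \int[m']_y f y.
Proof.
move=> mphi E mf f0.
have := @ge0_integral_pushforward _ _ _ _ _ phi mphi m setT f measurableT mf
  (fun y _ => f0 y).
rewrite preimage_setT /comp => <-.
by apply: eq_measure_integral => A mA _; exact: E.
Qed.

Lemma ge0_le_integralT d (T : measurableType d) (m : {measure set T -> \bar R})
    (f g : T -> \bar R) :
  measurable_fun setT f -> measurable_fun setT g ->
  (forall x, 0 <= f x) -> (forall x, f x <= g x) ->
  \int[m]_x f x <= \int[m]_x g x.
Proof. by move=> mf mg f0 fg; apply: ge0_le_integral. Qed.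

Lemma ge0_integralZlT d (T : measurableType d) (m : {measure set T -> \bar R})
    (k : \bar R) (f : T -> \bar R) :
  measurable_fun setT f -> (forall x, 0 <= f x) -> 0 <= k ->
  \int[m]_x (k * f x) = k * \int[m]_x f x.
Proof. by move=> mf f0 k0; rewrite ge0_integralZl. Qed.

Lemma ge0_integralZrT d (T : measurableType d) (m : {measure set T -> \bar R})
    (k : \bar R) (f : T -> \bar R) :
  measurable_fun setT f -> (forall x, 0 <= f x) -> 0 <= k ->
  \int[m]_x (f x * k) = (\int[m]_x f x) * k.
Proof. by move=> mf f0 k0; rewrite ge0_integralZr. Qed.

Lemma integral_probability_cst d (T : measurableType d) (m : probability T R)
    (c : \bar R) : \int[m]_x c = c.
Proof. by rewrite integral_cst//= probability_setT mule1. Qed.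

Lemma integral_le_cst d (T : measurableType d) (m : probability T R)
    (f : T -> \bar R) (c : R) :
  measurable_fun setT f -> (forall x, 0 <= f x) -> (forall x, f x <= c%:E) ->
  \int[m]_x f x <= c%:E.
Proof.
move=> mf f0 fc; apply: (@le_trans _ _ (\int[m]_x c%:E)).
  exact: ge0_le_integralT.
by rewrite integral_probability_cst.
Qed.

(** Common source of the Chebyshev, Chernoff and finite union bounds below: [f] dominates the
    indicator of [A]. *)
Lemma markov_le d (T : measurableType d) (m : {measure set T -> \bar R})
    (f : T -> \bar R) (A : set T) :
  measurable A -> measurable_fun setT f -> (forall x, 0 <= f x) ->
  (forall x, A x -> 1 <= f x) -> m A <= \int[m]_x f x.
Proof.
move=> mA mf f0 fA; rewrite -(setIT A) -integral_indic//.
apply: ge0_le_integralT => //.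
- exact/measurable_EFinP/measurable_indic.
- move=> x; rewrite indicE; have [/set_mem xA|_] := boolP (x \in A) => //.
  exact: fA.
Qed.

Lemma measurable_setle d (T : measurableType d) (f g : T -> R) :
  measurable_fun setT f -> measurable_fun setT g ->
  measurable [set t | (f t <= g t)%R].
Proof.
move=> mf mg; rewrite -(setTI [set t | _]).
by have := measurable_fun_ler mf mg => /(_ measurableT [set true]); apply.
Qed.

End integral_tools.

(** * Row vectors: measurability, inner products and boxes *)

Section rV_measurability.
Context (R : realType).

Lemma measurable_coord_comp d (T : measurableType d) n (f : T -> 'rV[R]_n) i :
  measurable_fun setT f -> measurable_fun setT (fun t => f t ord0 i).
Proof. by move=> mf; apply: (measurableT_comp (measurable_rV_coord i)). Qed.

Lemma measurable_rVD d (T : measurableType d) n (f g : T -> 'rV[R]_n) :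
  measurable_fun setT f -> measurable_fun setT g ->
  measurable_fun setT (fun t => f t + g t).
Proof.
move=> mf mg; apply: measurable_fun_rVP => i.
under eq_fun do rewrite mxE.
by apply: measurable_funD; exact: measurable_coord_comp.
Qed.

Lemma measurable_rVZ d (T : measurableType d) n (c : R) (f : T -> 'rV[R]_n) :
  measurable_fun setT f -> measurable_fun setT (fun t => c *: f t).
Proof.
move=> mf; apply: measurable_fun_rVP => i.
under eq_fun do rewrite mxE.
by apply: measurable_funM => //; exact: measurable_coord_comp.
Qed.

Lemma measurable_rVB d (T : measurableType d) n (f g : T -> 'rV[R]_n) :
  measurable_fun setT f -> measurable_fun setT g ->
  measurable_fun setT (fun t => f t - g t).
Proof.
move=> mf mg; apply: measurable_fun_rVP => i.
under eq_fun do rewrite !mxE.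
by apply: measurable_funB; exact: measurable_coord_comp.
Qed.

Definition dotr n (x y : 'rV[R]_n) : R := \sum_(i < n) x ord0 i * y ord0 i.

Lemma measurable_dotr d (T : measurableType d) n (f g : T -> 'rV[R]_n) :
  measurable_fun setT f -> measurable_fun setT g ->
  measurable_fun setT (fun t => dotr (f t) (g t)).
Proof.
move=> mf mg; apply: measurable_sum => i.
by apply: measurable_funM; exact: measurable_coord_comp.
Qed.

Lemma sqnormE n (x : 'rV[R]_n) : sqnorm x = dotr x x.
Proof. by apply: eq_bigr => i _; rewrite expr2. Qed.

Lemma sqnorm0 n : sqnorm (0 : 'rV[R]_n) = 0.
Proof. by rewrite /sqnorm big1// => i _; rewrite mxE expr0n. Qed.

Lemma sqnorm_ge0 n (x : 'rV[R]_n) : 0 <= sqnorm x.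
Proof. by apply: sumr_ge0 => i _; exact: sqr_ge0. Qed.

Lemma measurable_sqnorm d (T : measurableType d) n (f : T -> 'rV[R]_n) :
  measurable_fun setT f -> measurable_fun setT (fun t => sqnorm (f t)).
Proof.
move=> mf; under eq_fun do rewrite sqnormE.
exact: measurable_dotr.
Qed.

Lemma dotrC n (x y : 'rV[R]_n) : dotr x y = dotr y x.
Proof. by apply: eq_bigr => i _; rewrite mulrC. Qed.

Lemma dotrDl n (x y z : 'rV[R]_n) : dotr (x + y) z = dotr x z + dotr y z.
Proof.
by rewrite /dotr -big_split; apply: eq_bigr => i _; rewrite mxE mulrDl.
Qed.

Lemma dotrZl n c (x y : 'rV[R]_n) : dotr (c *: x) y = c * dotr x y.
Proof.
by rewrite /dotr mulr_sumr; apply: eq_bigr => i _; rewrite mxE mulrA.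
Qed.

Lemma sqnormD n (x y : 'rV[R]_n) :
  sqnorm (x + y) = sqnorm x + 2 * dotr x y + sqnorm y.
Proof.
by rewrite !sqnormE dotrDl !(dotrC _ (x + y)) !dotrDl (dotrC y x); ring.
Qed.

Lemma sqnormZ n c (x : 'rV[R]_n) : sqnorm (c *: x) = c ^+ 2 * sqnorm x.
Proof. by rewrite !sqnormE dotrZl dotrC dotrZl; ring. Qed.

Lemma sqnormB n (x y : 'rV[R]_n) :
  sqnorm (x - y) = sqnorm x - 2 * dotr x y + sqnorm y.
Proof.
by rewrite -(scaleN1r y) sqnormD sqnormZ (dotrC x) dotrZl (dotrC y); ring.
Qed.

Lemma rV0_eq (x y : 'rV[R]_0) : x = y.
Proof. by apply/rowP => -[]. Qed.

Lemma rV_consP n (x : 'rV[R]_n.+1) :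
  exists a v, x = rV_cons (a, v).
Proof.
exists (x ord0 ord0), (\row_i x ord0 (lift ord0 i)).
apply/rowP => i; case: (unliftP ord0 i) => [j|] ->.
  by rewrite (rV_consS (_, _)) mxE.
by rewrite (rV_cons0 (_, _)).
Qed.

Lemma rV_consD n (a b : R) (u v : 'rV[R]_n) :
  rV_cons (a, u) + rV_cons (b, v) = rV_cons (a + b, u + v).
Proof.
apply/rowP => i; case: (unliftP ord0 i) => [j|] ->; rewrite mxE.
  by rewrite !(rV_consS (_, _)) mxE.
by rewrite !(rV_cons0 (_, _)).
Qed.

Lemma rV_consB n (a b : R) (u v : 'rV[R]_n) :
  rV_cons (a, u) - rV_cons (b, v) = rV_cons (a - b, u - v).
Proof. by apply/(canLR (addrK _)); rewrite rV_consD !subrK. Qed.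

Lemma rV_consZ n c (a : R) (u : 'rV[R]_n) :
  c *: rV_cons (a, u) = rV_cons (c * a, c *: u).
Proof.
apply/rowP => i; case: (unliftP ord0 i) => [j|] ->; rewrite mxE.
  by rewrite !(rV_consS (_, _)) mxE.
by rewrite !(rV_cons0 (_, _)).
Qed.

Lemma dotr_cons n (a b : R) (u v : 'rV[R]_n) :
  dotr (rV_cons (a, u)) (rV_cons (b, v)) = a * b + dotr u v.
Proof.
rewrite /dotr big_ord_recl !rV_cons0; congr (_ + _).
by apply: eq_bigr => i _; rewrite !rV_consS.
Qed.

Lemma sqnorm_cons n (a : R) (u : 'rV[R]_n) :
  sqnorm (rV_cons (a, u)) = a ^+ 2 + sqnorm u.
Proof. by rewrite !sqnormE dotr_cons expr2. Qed.

Definition rV_box n (A : 'I_n -> set R) : set 'rV[R]_n :=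
  [set x | forall i, A i (x ord0 i)].

Lemma measurable_rV_box n (A : 'I_n -> set R) :
  (forall i, measurable (A i)) -> measurable (rV_box A).
Proof.
move=> mA; rewrite (_ : rV_box A =
    \bigcap_(i in [set: 'I_n]) (rV_coord i @^-1` A i)).
  apply: fin_bigcap_measurable => // i _; rewrite -[X in measurable X]setTI.
  exact: measurable_rV_coord.
by apply/seteqP; split => x h i; [move=> _; exact: h|exact: h].
Qed.

(** Boxes are stable under intersection and generate the sigma-algebra, so the uniqueness theorem
    for measures applies. *)
Lemma rV_measure_unique n (m1 m2 : probability 'rV[R]_n R) :
  (forall A : 'I_n -> set R, (forall i, measurable (A i)) ->
    m1 (rV_box A) = m2 (rV_box A)) ->
  forall B, measurable B -> m1 B = m2 B.
Proof.
move=> E; pose G := [set X | exists2 A : 'I_n -> set R,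
  (forall i, measurable (A i)) & X = rV_box A].
have GT : G setT by exists (fun=> setT) => //; apply/seteqP; split.
have mG : @measurable _ 'rV[R]_n = <<s G >>.
  apply/seteqP; split.
    apply: smallest_sub; first exact: smallest_sigma_algebra.
    rewrite -bigcup_seq; apply: bigcup_sub => i _ _ [B mB <-].
    (* The preimage of [B] under coordinate [i] is a box whose other sides are full. *)
    apply: sub_sigma_algebra; exists (fun j => if j == i then B else setT).
      by move=> j; case: ifP.
    rewrite setTI; apply/seteqP; split => [x /= Bx j|x /(_ i)].
      by case: eqP => // ->.
    by rewrite eqxx.
  apply: smallest_sub; first exact: sigma_algebra_measurable.
  by move=> _ [A mA ->]; exact: measurable_rV_box.
apply: (measure_unique G (fun=> setT)) => //.
- move=> _ _ [A mA ->] [A' mA' ->]; exists (fun i => A i `&` A' i).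
    by move=> i; exact: measurableI.
  apply/seteqP; split => x /=; first by move=> [a b] i; split; [apply: a|apply: b].
  by move=> h; split => i; case: (h i).
- by rewrite bigcup_const.
- by move=> _ [A mA ->]; exact: E.
- by move=> _; rewrite -ge0_fin_numE// fin_num_measure.
Qed.

End rV_measurability.

(** * Laws with independent coordinates *)

Section iid.
Local Open Scope ereal_scope.
Context (R : realType) (mu : probability (measurableTypeR R) R).

Lemma integral_iid0 (f : 'rV[R]_0 -> \bar R) : measurable_fun setT f ->
  \int[iid_law mu 0]_x f x = f 0%R.
Proof. by move=> mf; rewrite integral_dirac// diracT mul1e. Qed.

Lemma integral_iidS n (f : 'rV[R]_n.+1 -> \bar R) :
  measurable_fun setT f -> (forall x, 0 <= f x) ->
  \int[iid_law mu n.+1]_x f x =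
  \int[mu]_a \int[iid_law mu n]_v f (rV_cons (a, v)).
Proof.
move=> mf f0; rewrite ge0_integral_pushforward//=.
by rewrite fubini_tonelli1//; apply: measurableT_comp.
Qed.

(** By uniqueness on boxes, factorisation of the box probabilities suffices. Coordinatewise maps,
    selections of coordinates and concatenations are all instances. *)
Lemma iid_law_pushforward n d (T : measurableType d) (m : probability T R)
    (phi : T -> 'rV[R]_n) (f : 'rV[R]_n -> \bar R) :
  measurable_fun setT phi ->
  (forall A : 'I_n -> set R, (forall i, measurable (A i)) ->
    m [set x | forall i, A i (phi x ord0 i)] = \prod_(i < n) mu (A i)) ->
  measurable_fun setT f -> (forall y, 0 <= f y) ->
  \int[m]_x f (phi x) = \int[iid_law mu n]_y f y.
Proof.
move=> mphi E mf f0.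
pose Q := isMeasurableFun.Build _ _ _ _ _ mphi.
pose X : {RV m >-> 'rV[R]_n} := HB.pack phi Q.
apply: ge0_integral_map => // B mB.
apply: (@rV_measure_unique _ _ (distribution m X) (iid_law mu n)) => // A mA.
by rewrite /rV_box iid_law_box// -E.
Qed.

Lemma integral_iid_coordwise n (g : 'I_n -> R -> R) (f : 'rV[R]_n -> \bar R) :
  (forall i, measurable_fun setT (g i)) ->
  (forall i A, measurable A -> mu (g i @^-1` A) = mu A) ->
  measurable_fun setT f -> (forall y, 0 <= f y) ->
  \int[iid_law mu n]_x f (\row_i g i (x ord0 i))%R = \int[iid_law mu n]_y f y.
Proof.
move=> mg E mf f0; apply: iid_law_pushforward => //.
  apply: measurable_fun_rVP => i; under eq_fun do rewrite mxE.
  by apply: measurableT_comp => //; exact: measurable_rV_coord.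
move=> A mA; rewrite -(eq_bigr _ (fun i _ => E i _ (mA i))).
rewrite -iid_law_box; last by move=> i; rewrite -(setTI (_ @^-1` _)); exact: mg.
by congr (iid_law _ _ _); apply/seteqP; split => x h i; have := h i; rewrite /= mxE.
Qed.

Lemma integral_iid_reindex m n (h : 'I_m -> 'I_n) (f : 'rV[R]_m -> \bar R) :
  injective h -> measurable_fun setT f -> (forall y, 0 <= f y) ->
  \int[iid_law mu n]_x f (\row_i x ord0 (h i))%R = \int[iid_law mu m]_y f y.
Proof.
move=> hI mf f0; apply: iid_law_pushforward => //.
  apply: measurable_fun_rVP => i; under eq_fun do rewrite mxE.
  exact: measurable_rV_coord.
move=> A mA.
(* A constraint on the selected coordinates is a box on all of them, with full sides off the image
   of [h]; those sides contribute factors 1. *)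
pose B j := if [pick i | h i == j] is Some i then A i else setT.
have Bh i : B (h i) = A i.
  rewrite /B; case: pickP => [i' /eqP/hI -> //|/(_ i)].
  by rewrite eqxx.
have mB j : measurable (B j) by rewrite /B; case: pickP.
transitivity (iid_law mu n [set x | forall j, B j (x ord0 j)]).
  congr (iid_law _ _ _); apply/seteqP; split => x /= H i.
    by rewrite /B; case: pickP => // i' /eqP <-; have := H i'; rewrite mxE.
  by rewrite mxE -Bh.
rewrite iid_law_box// (bigID [pred j | j \in codom h])/= [X in _ * X]big1.
  rewrite mule1 -big_uniq/=; last by rewrite map_inj_uniq// enum_uniq.
  rewrite big_map big_enum/=.
  by apply: eq_bigr => i _; rewrite Bh.
move=> j jh; rewrite /B; case: pickP => [i /eqP ji|_].
  by move: jh; rewrite -ji codom_f.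
exact: probability_setT.
Qed.

Lemma integral_iid_split m n (f : 'rV[R]_(m + n) -> \bar R) :
  measurable_fun setT f -> (forall y, 0 <= f y) ->
  \int[iid_law mu (m + n)]_x f x =
  \int[iid_law mu m]_u \int[iid_law mu n]_v f (row_mx u v).
Proof.
move=> mf f0.
have mrow : measurable_fun setT
    (fun p : 'rV[R]_m * 'rV[R]_n => row_mx p.1 p.2).
  apply: measurable_fun_rVP => i; rewrite -(splitK i); case: (fintype.split i) => j /=.
    under eq_fun do rewrite row_mxEl.
    by apply: measurable_coord_comp; exact: measurable_fst.
  under eq_fun do rewrite row_mxEr.
  by apply: measurable_coord_comp; exact: measurable_snd.
rewrite -(fubini_tonelli1 (fun p => f (row_mx p.1 p.2)))//; last exact: measurableT_comp.
apply/esym/(@iid_law_pushforward _ _ _ (iid_law mu m \x iid_law mu n)%E) => // A mA.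
rewrite big_split_ord -!iid_law_box//= -product_measure1E//; last 2 first.
- exact: (measurable_rV_box (fun i => mA _)).
- exact: (measurable_rV_box (fun i => mA _)).
congr (_ _); apply/seteqP; split => x /=.
  by move=> H; split => i; [have := H (lshift n i)|have := H (rshift m i)];
    rewrite ?row_mxEl ?row_mxEr.
move=> [H1 H2] i; rewrite -(splitK i); case: (fintype.split i) => j /=.
  by rewrite row_mxEl.
by rewrite row_mxEr.
Qed.

End iid.

(** * Integration against a density *)

Section density.
Local Open Scope ereal_scope.
Import HBNNSimple.

(** On indicators this is the hypothesis on [m']. Linearity extends it to the simple approximations
    of [f], and monotone convergence on both sides to [f]. *)
Lemma ge0_integral_density d (T : measurableType d) (R : realType)
    (m m' : {measure set T -> \bar R}) (g : T -> R) (f : T -> \bar R) :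
  measurable_fun setT g -> (forall x, (0 <= g x)%R) ->
  (forall A, measurable A -> m' A = \int[m]_(x in A) (g x)%:E) ->
  measurable_fun setT f -> (forall x, 0 <= f x) ->
  \int[m']_x f x = \int[m]_x (f x * (g x)%:E).
Proof.
move=> mg g0 E mf f0; pose f_ := nnsfun_approx measurableT mf.
have g0' x : 0 <= (g x)%:E by rewrite lee_fin.
have mg' : measurable_fun setT (EFin \o g) by exact/measurable_EFinP.
have cvf x : (f_ n x)%:E @[n --> \oo] --> f x.
  by apply: cvg_nnsfun_approx => // y _; exact: f0.
transitivity (limn (fun n => \int[m']_x (f_ n x)%:E)).
  rewrite -monotone_convergence//=.
  - by apply: eq_integral => x _; apply/esym/cvg_lim => //; exact: cvf.
  - by move=> n; exact/measurable_EFinP/measurable_funTS.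
  - by move=> n ? _; rewrite lee_fin.
  - by move=> ? _ ? ? mn; rewrite lee_fin; exact/lefP/nd_nnsfun_approx.
transitivity (limn (fun n => \int[m]_x ((f_ n x)%:E * (g x)%:E))); last first.
  rewrite -monotone_convergence//=.
  - apply: eq_integral => x _; apply/cvg_lim => //.
    by apply: cvgeZr => //; exact: cvf.
  - by move=> n; apply: emeasurable_funM => //; exact/measurable_EFinP.
  - by move=> n ? _; rewrite mule_ge0// lee_fin.
  - move=> ? _ ? ? mn; apply: lee_wpmul2r => //.
    by rewrite lee_fin; exact/lefP/nd_nnsfun_approx.
apply: congr_lim; apply/funext => n.
have mfn r : measurable (f_ n @^-1` [set r]) by [].
under eq_integral do rewrite fimfunE -fsumEFin//.
rewrite ge0_integral_fsum//; last 2 first.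
- by move=> r; exact/measurable_EFinP/measurable_funM.
- by move=> r x _; rewrite EFinM nnfun_muleindic_ge0.
under [in RHS]eq_integral => x _.
  rewrite fimfunE -fsumEFin// ge0_mule_fsuml; last first.
    by move=> r; rewrite EFinM nnfun_muleindic_ge0.
  over.
rewrite ge0_integral_fsum//; last 2 first.
- move=> r; apply: emeasurable_funM => //.
  exact/measurable_EFinP/measurable_funM.
- by move=> r x _; rewrite mule_ge0// EFinM nnfun_muleindic_ge0.
apply: eq_fsbigr => r _.
(* The approximations are nonnegative, so a negative level has an empty preimage and contributes
   0. *)
have [r0|r0] := ltP r 0%R.
  rewrite preimage_nnfun0//; under eq_integral do rewrite indic0 mulr0.
  under [in RHS]eq_integral do rewrite indic0 mulr0 mul0e.
  by rewrite !integral0.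
under eq_integral do rewrite EFinM.
under [in RHS]eq_integral do rewrite EFinM -muleA.
rewrite !ge0_integralZl//.
- congr (_ * _); rewrite integral_indic// setIT E//.
  rewrite integral_mkcond; apply: eq_integral => x _.
  rewrite patchE indicE; case: ifP => _; first by rewrite mul1e.
  by rewrite mul0e.
- by apply: emeasurable_funM => //; exact/measurable_EFinP/measurable_indic.
- by move=> x _; rewrite mule_ge0// lee_fin.
- exact/measurable_EFinP/measurable_indic.
Qed.

End density.

(** * Gaussian vectors *)

Section normal1.
Local Open Scope ereal_scope.
Context (R : realType).

Lemma lebesgue_measureD (c : R) (A : set R) : measurable A ->
  (lebesgue_measure : set (measurableTypeR R) -> \bar R)
    ((fun x => x + c)%R @^-1` A) = lebesgue_measure A.
Proof.
move=> mA.
have mc : measurable_fun setT ((fun x => x + c)%R : measurableTypeR R -> measurableTypeR R).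
  exact: measurable_funD.
pose Q := isMeasurableFun.Build _ _ _ _ _ mc.
pose X : {mfun _ >-> _} := HB.pack ((fun x => x + c)%R : measurableTypeR R -> measurableTypeR R) Q.
apply/esym/(@lebesgue_measure_unique _ (pushforward lebesgue_measure X)) => //= _ [[a b]] _ <-.
rewrite /pushforward /= (_ : _ @^-1` _ = `](a - c)%R, (b - c)%R]%classic).
  rewrite !lebesgue_measure_itv/= !lte_fin ltrD2r.
  by case: ifP => // _; congr (_%:E); lra.
by apply/seteqP; split => x /=; rewrite !in_itv/= ltrBlDr lerBrDr.
Qed.

Lemma ge0_integral_translate (c : R) (f : R -> \bar R) :
  measurable_fun setT f -> (forall x, 0 <= f x) ->
  \int[lebesgue_measure]_x f (x + c)%R = \int[lebesgue_measure]_x f x.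
Proof.
move=> mf f0; apply: (@ge0_integral_map R _ _ (measurableTypeR R) (measurableTypeR R)
  lebesgue_measure lebesgue_measure (fun x => (x + c)%R)) => //.
  exact: measurable_funD.
by move=> A mA; exact: lebesgue_measureD.
Qed.

Lemma integral_normalE (s : R) (f : R -> \bar R) :
  measurable_fun setT f -> (forall x, 0 <= f x) ->
  \int[normal_prob 0 s]_x f x =
  \int[lebesgue_measure]_x (f x * (normal_pdf 0 s x)%:E).
Proof.
move=> mf f0; apply: ge0_integral_density => //.
- exact: measurable_normal_pdf.
- by move=> x; exact: normal_pdf_ge0.
Qed.

(** The likelihood ratio of N(x, s^2) to N(0, s'^2) is kept as one exponential, so that products
    over coordinates become sums of exponents. *)
Lemma normal_pdf_ratio (s s' x y : R) : s != 0%R -> s' != 0%R ->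
  (normal_pdf 0 s (y - x) = expR (ln (s' ^+ 2 / s ^+ 2) / 2 +
    y ^+ 2 / (2 * s' ^+ 2) - (y - x) ^+ 2 / (2 * s ^+ 2)) *
    normal_pdf 0 s' y)%R.
Proof.
move=> s0 s'0; rewrite !normal_pdfE// /normal_fun.
have s2 : (0 < s ^+ 2)%R by rewrite exprn_even_gt0.
have s'2 : (0 < s' ^+ 2)%R by rewrite exprn_even_gt0.
have p2 : (0 < 2 * pi :> R)%R by rewrite mulr_gt0// pi_gt0.
(* The normalising constants are turned into exponentials as well, and the factor in 2 pi
   cancels. *)
have pk (t : R) : (t != 0)%R -> normal_peak t = expR (- (ln (2 * pi) / 2) - ln (t ^+ 2) / 2).
  move=> t0; have t2 : (0 < t ^+ 2)%R by rewrite exprn_even_gt0.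
  rewrite /normal_peak -mulr_natr -mulrA (mulrC pi).
  have q : (t ^+ 2 * (2 * pi) \is Num.pos)%R by rewrite posrE mulr_gt0.
  rewrite -[in LHS](lnK q).
  have -> : (ln (t ^+ 2 * (2 * pi)) = ln (t ^+ 2 * (2 * pi)) / 2 + ln (t ^+ 2 * (2 * pi)) / 2)%R by lra.
  rewrite expRD -expr2 sqrtr_sqr ger0_norm ?expR_ge0// -expRN lnM ?posrE//.
  by congr expR; lra.
rewrite !pk// !subr0 mulrCA -!expRD; congr expR.
rewrite ln_div ?posrE//; field; by rewrite s0 s'0.
Qed.

Lemma integral_normal_shift (s s' x : R) (f : R -> \bar R) :
  s != 0%R -> s' != 0%R ->
  measurable_fun setT f -> (forall x, 0 <= f x) ->
  \int[normal_prob 0 s]_w f (x + w)%R =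
  \int[normal_prob 0 s']_y (f y *
    (expR (ln (s' ^+ 2 / s ^+ 2) / 2 +
      y ^+ 2 / (2 * s' ^+ 2) - (y - x) ^+ 2 / (2 * s ^+ 2)))%:E).
Proof.
move=> s0 s'0 mf f0.
have mr : measurable_fun setT (fun y : R => (expR (ln (s' ^+ 2 / s ^+ 2) / 2 +
      y ^+ 2 / (2 * s' ^+ 2) - (y - x) ^+ 2 / (2 * s ^+ 2))))%R.
  apply: measurableT_comp => //; apply: measurable_funB.
    by apply: measurable_funD => //; apply: measurable_funM.
  by apply: measurable_funM => //; apply: measurable_funX; exact: measurable_funB.
have mfx : measurable_fun setT (fun w => f (x + w)%R).
  by apply: measurableT_comp => //; exact: measurable_funD.
rewrite [LHS]integral_normalE//.
refine (etrans _ (esym (integral_normalE _ _ _))); last 2 first.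
- by apply: emeasurable_funM => //; exact/measurable_EFinP.
- by move=> y; rewrite mule_ge0// lee_fin expR_ge0.
rewrite -[LHS](ge0_integral_translate (- x)%R)/=.
- apply: eq_integral => y _.
  by rewrite (normal_pdf_ratio _ _ s0 s'0) EFinM muleA addrC subrK.
- apply: emeasurable_funM => //.
  by apply/measurable_EFinP; exact: measurable_normal_pdf.
- by move=> w; rewrite mule_ge0// lee_fin normal_pdf_ge0.
Qed.

End normal1.

(** * Gaussian vectors in dimension n: change of reference law, exponential moments, sums *)

Section gauss_vec.
Local Open Scope ereal_scope.
Context (R : realType).

Lemma measurable_gauss_ratio n (c v v' : R) (x : 'rV[R]_n) :
  measurable_fun setT (fun y : 'rV[R]_n =>
    (expR (c + sqnorm y / v - sqnorm (y - x) / v')%R)%:E).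
Proof.
apply/measurable_EFinP; apply: measurableT_comp => //.
apply: measurable_funB.
  apply: measurable_funD => //; apply: measurable_funM => //.
  exact: measurable_sqnorm.
apply: measurable_funM => //; apply: measurable_sqnorm.
exact: measurable_rVB.
Qed.

(** Change of reference law, the weight being the likelihood ratio at [y]. Induction peels off one
    coordinate at a time. Exponential moments, convolution and both converse bounds rest on it. *)
Lemma gauss_shift (s s' : R) n (x : 'rV[R]_n) (f : 'rV[R]_n -> \bar R) :
  s != 0%R -> s' != 0%R ->
  measurable_fun setT f -> (forall x, 0 <= f x) ->
  \int[gauss_vec s n]_w f (x + w)%R =
  \int[gauss_vec s' n]_y (f y *
    (expR (n%:R * (ln (s' ^+ 2 / s ^+ 2) / 2) +
      sqnorm y / (2 * s' ^+ 2) - sqnorm (y - x) / (2 * s ^+ 2)))%:E).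
Proof.
move=> s0 s'0; elim: n x f => [|n IH] x f mf f0.
  rewrite /gauss_vec !integral_iid0//; last 2 first.
  - by apply: emeasurable_funM => //; exact: measurable_gauss_ratio.
  - by apply: measurableT_comp => //; exact: measurable_rVD.
  rewrite (rV0_eq x 0%R) addr0 /sqnorm !big_ord0 !mul0r subr0 addr0 expR0.
  by rewrite mule1.
have [a [u ->]] := rV_consP x.
have mfx : measurable_fun setT (fun w => f (rV_cons (a, u) + w)%R).
  by apply: (measurableT_comp mf); exact: measurable_rVD.
refine (etrans (integral_iidS (normal_prob 0 s) mfx (fun=> f0 _)) _).
pose G y := f y * (expR (n.+1%:R * (ln (s' ^+ 2 / s ^+ 2) / 2) +
  sqnorm y / (2 * s' ^+ 2) - sqnorm (y - rV_cons (a, u)) / (2 * s ^+ 2)))%:E.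
have mG : measurable_fun setT G.
  by apply: emeasurable_funM => //; exact: measurable_gauss_ratio.
have G0 y : 0 <= G y by rewrite mule_ge0// lee_fin expR_ge0.
refine (etrans _ (esym (integral_iidS (normal_prob 0 s') mG G0))).
have mcons (b : R) : measurable_fun setT (fun v : 'rV[R]_n => rV_cons (b, v)).
  exact: (measurableT_comp (@measurable_rV_cons R n) (pair1_measurable (b : measurableTypeR R))).
have mF : measurable_fun setT (fun p : measurableTypeR R * 'rV[R]_n =>
    f (rV_cons p) * (expR (n%:R * (ln (s' ^+ 2 / s ^+ 2) / 2) +
      sqnorm p.2 / (2 * s' ^+ 2) - sqnorm (p.2 - u) / (2 * s ^+ 2)))%:E).
  apply: emeasurable_funM; first exact: measurableT_comp.
  apply: (measurableT_comp (f := fun v => (expR (_ + sqnorm v / _ - sqnorm (v - u) / _))%:E)).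
    exact: measurable_gauss_ratio.
  exact: measurable_snd.
have F0 p : 0 <= f (rV_cons p) * (expR (n%:R * (ln (s' ^+ 2 / s ^+ 2) / 2) +
      sqnorm p.2 / (2 * s' ^+ 2) - sqnorm (p.2 - u) / (2 * s ^+ 2)))%:E.
  by rewrite mule_ge0// lee_fin expR_ge0.
pose H b := \int[iid_law (normal_prob 0 s') n]_v
    (f (rV_cons (b, v)) * (expR (n%:R * (ln (s' ^+ 2 / s ^+ 2) / 2) +
      sqnorm v / (2 * s' ^+ 2) - sqnorm (v - u) / (2 * s ^+ 2)))%:E).
have mH : measurable_fun setT H by exact: (measurable_fun_fubini_tonelli_F _ mF F0).
have H0 b : 0 <= H b by apply: integral_ge0 => v _; exact: (F0 (b, v)).
transitivity (\int[normal_prob 0 s]_w H (a + w)%R).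
  apply: eq_integral => w _.
  under eq_integral do rewrite rV_consD.
  by rewrite (IH u (fun v => f (rV_cons ((a + w)%R, v))))//; exact: measurableT_comp.
refine (etrans (integral_normal_shift a s0 s'0 mH H0) _).
apply: eq_integral => b _.
rewrite -ge0_integralZrT; last 3 first.
- exact: (measurableT_comp mF (pair1_measurable b)).
- by move=> v; exact: (F0 (b, v)).
- by rewrite lee_fin expR_ge0.
apply: eq_integral => v _; rewrite -muleA -EFinM -expRD; congr (_ * (expR _)%:E).
rewrite rV_consB !sqnorm_cons -natr1.
by rewrite !mulrDl mul1r opprD; ring.
Qed.

(** Completing the square: up to a constant factor the integrand is the likelihood ratio of another
    Gaussian law to this one, and a likelihood ratio integrates to 1. *)
Lemma gauss_mgf (s b : R) n (x : 'rV[R]_n) :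
  s != 0%R -> (2 * b * s ^+ 2 < 1)%R ->
  \int[gauss_vec s n]_w (expR (dotr x w + b * sqnorm w))%:E =
  (expR (- (n%:R * (ln (1 - 2 * b * s ^+ 2) / 2)) +
    s ^+ 2 * sqnorm x / (2 * (1 - 2 * b * s ^+ 2))))%:E.
Proof.
move=> s0 b1; set u := (1 - 2 * b * s ^+ 2)%R.
have u0 : (0 < u)%R by rewrite subr_gt0.
have s2 : (0 < s ^+ 2)%R by rewrite exprn_even_gt0.
(* Variance of the exponentially tilted law, whose mean is [v *: x]. *)
pose v := (s ^+ 2 / u)%R.
have v0 : (0 < v)%R by rewrite divr_gt0.
pose t := Num.sqrt v.
have t2 : (t ^+ 2 = v)%R by rewrite sqr_sqrtr// ltW.
have t0 : t != 0%R by rewrite gt_eqF// sqrtr_gt0.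
have := @gauss_shift t s n (v *: x)%R (cst 1) t0 s0 (measurable_cst _) (fun=> lee01).
rewrite integral_probability_cst t2 => H.
rewrite -[RHS]mule1 H.
have mE := measurable_gauss_ratio (n%:R * (ln (s ^+ 2 / v) / 2))%R
  (2 * s ^+ 2)%R (2 * v)%R (v *: x)%R.
under [in RHS]eq_integral do rewrite mul1e.
rewrite -(ge0_integralZlT _ mE); last 2 first.
- by move=> y; rewrite lee_fin expR_ge0.
- by rewrite lee_fin expR_ge0.
apply: eq_integral => w _; rewrite -EFinM -expRD; congr ((expR _)%:E).
have -> : (s ^+ 2 / v = u)%R.
  by rewrite /v invfM invrK mulrA divff ?mul1r// gt_eqF.
rewrite sqnormB sqnormZ (dotrC w) dotrZl /v /u.
have uN : (1 - 2 * b * s ^+ 2 != 0)%R by rewrite gt_eqF.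
by field; rewrite ?s0 ?uN.
Qed.

(** Apply ln (1 + t) <= t at t = u / (1 - u), where 1 + t is the inverse of 1 - u. *)
Lemma ln1B_ge (u : R) : (u <= 1 / 2)%R -> (- ln (1 - u) <= u + 2 * u ^+ 2)%R.
Proof.
move=> u2; have u1 : (0 < 1 - u)%R by lra.
rewrite -lnV ?posrE//.
have := @le_ln1Dx R (u / (1 - u))%R.
have -> : (1 + u / (1 - u) = (1 - u)^-1)%R by field; rewrite gt_eqF.
move=> H; apply: (le_trans (H _)).
  by rewrite ltr_pdivlMr//; lra.
rewrite ler_pdivrMr//.
have : (0 <= u ^+ 2 * (1 - 2 * u))%R by rewrite mulr_ge0 ?sqr_ge0//; lra.
by rewrite [X in _ -> (_ <= X)%R](_ : _ = (u + u ^+ 2 * (1 - 2 * u))%R); [lra|ring].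
Qed.

(** Centring the squared norm cancels the first-order term of the logarithm in [gauss_mgf], leaving
    a quadratic cost. The sign of [b] is free: the noise tail uses a positive one, the converse a
    negative one. *)
Lemma gauss_chernoff (s b : R) n (x : 'rV[R]_n) :
  s != 0%R -> (2 * b * s ^+ 2 <= 1 / 2)%R ->
  \int[gauss_vec s n]_w
     (expR (dotr x w + b * (sqnorm w - n%:R * s ^+ 2)))%:E <=
  (expR (s ^+ 2 * sqnorm x + n%:R * (2 * b * s ^+ 2) ^+ 2))%:E.
Proof.
move=> s0 b2; have b1 : (2 * b * s ^+ 2 < 1)%R by lra.
under eq_integral => w _.
  rewrite mulrBr addrA expRD EFinM; over.
have mE : measurable_fun setT
    (fun w : 'rV[R]_n => (expR (dotr x w + b * sqnorm w))%:E).
  apply/measurable_EFinP; apply: measurableT_comp => //.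
  apply: measurable_funD; first exact: measurable_dotr.
  by apply: measurable_funM => //; exact: measurable_sqnorm.
rewrite (ge0_integralZrT _ mE); last 2 first.
- by move=> w; rewrite lee_fin expR_ge0.
- by rewrite lee_fin expR_ge0.
rewrite gauss_mgf// -EFinM -expRD lee_fin ler_expR.
set u := (2 * b * s ^+ 2)%R.
have u2 : (u <= 1 / 2)%R by [].
have un : (0 < 1 - u)%R by lra.
have : (n%:R * (- ln (1 - u)) <= n%:R * (u + 2 * u ^+ 2))%R.
  by rewrite ler_wpM2l// ln1B_ge.
have : (s ^+ 2 * sqnorm x / (2 * (1 - u)) <= s ^+ 2 * sqnorm x)%R.
  rewrite ler_pdivrMr; last by lra.
  have q0 : (0 <= s ^+ 2 * sqnorm x)%R by rewrite mulr_ge0 ?sqr_ge0 ?sqnorm_ge0.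
  by rewrite ler_peMr//; lra.
have -> : (- (b * (n%:R * s ^+ 2)) = - (n%:R * u / 2))%R by rewrite /u; field.
rewrite /u; lra.
Qed.

(** Refer the law of [g + z] to N(0, b^2) and exchange the integrals. The integral over [g] is then
    a Gaussian exponential moment, equal to the likelihood ratio of N(0, c^2) to N(0, b^2). *)
Lemma gauss_convolution (a b c : R) n (f : 'rV[R]_n -> \bar R) :
  a != 0%R -> b != 0%R -> (c ^+ 2 = a ^+ 2 + b ^+ 2)%R ->
  measurable_fun setT f -> (forall x, 0 <= f x) ->
  \int[gauss_vec a n]_g \int[gauss_vec b n]_z f (g + z)%R =
  \int[gauss_vec c n]_y f y.
Proof.
move=> a0 b0 cE mf f0.
have a2 : (0 < a ^+ 2)%R by rewrite exprn_even_gt0.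
have b2 : (0 < b ^+ 2)%R by rewrite exprn_even_gt0.
have c2 : (0 < c ^+ 2)%R by rewrite cE addr_gt0.
have c0 : c != 0%R by apply: contraTneq c2 => ->; rewrite expr0n ltxx.
under eq_integral => g _ do rewrite (gauss_shift _ b0 b0)//.
rewrite (fubini_tonelli (fun p : 'rV[R]_n * 'rV[R]_n => f p.2 *
    (expR (n%:R * (ln (b ^+ 2 / b ^+ 2) / 2) +
      sqnorm p.2 / (2 * b ^+ 2) - sqnorm (p.2 - p.1) / (2 * b ^+ 2)))%:E))/=; last 2 first.
- apply: emeasurable_funM.
    by apply: measurableT_comp => //; exact: measurable_snd.
  apply/measurable_EFinP; apply: measurableT_comp => //.
  apply: measurable_funB; last apply: measurable_funM => //.
    apply: measurable_funD => //; apply: measurable_funM => //.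
    by apply: measurable_sqnorm; exact: measurable_snd.
  apply: measurable_sqnorm; apply: measurable_rVB.
    exact: measurable_snd.
  exact: measurable_fst.
- by move=> p; rewrite mule_ge0// lee_fin expR_ge0.
transitivity (\int[gauss_vec c n]_w f (0 + w)%R); last first.
  by apply: eq_integral => w _; rewrite add0r.
refine (etrans _ (esym (gauss_shift 0%R c0 b0 mf f0))).
apply: eq_integral => y _.
have mE : measurable_fun setT (fun g : 'rV[R]_n =>
    (expR (n%:R * (ln (b ^+ 2 / b ^+ 2) / 2) + sqnorm y / (2 * b ^+ 2) -
      sqnorm (y - g) / (2 * b ^+ 2)))%:E).
  apply/measurable_EFinP; apply: measurableT_comp => //.
  apply: measurable_funB => //; apply: measurable_funM => //.
  by apply: measurable_sqnorm; exact: measurable_rVB.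
refine (etrans (ge0_integralZlT _ mE _ _) _) => //.
congr (_ * _).
transitivity (\int[gauss_vec a n]_g (expR (dotr ((b ^+ 2)^-1 *: y) g
    + (- (2 * b ^+ 2)^-1) * sqnorm g))%:E).
  apply: eq_integral => g _; congr ((expR _)%:E).
  rewrite divff ?gt_eqF// ln1 mul0r mulr0 add0r sqnormB dotrZl.
  by field; rewrite b0.
rewrite gauss_mgf//; last first.
  have : (0 <= (2 * b ^+ 2)^-1 * a ^+ 2)%R.
    by apply/ltW/mulr_gt0 => //; rewrite invr_gt0; lra.
  lra.
congr ((expR _)%:E).
have E : (1 - 2 * - (2 * b ^+ 2)^-1 * a ^+ 2 = c ^+ 2 / b ^+ 2)%R.
  by rewrite cE; field; rewrite b0.
rewrite E subr0 sqnormZ -[in LHS](invf_div (b ^+ 2)) lnV ?posrE ?divr_gt0//.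
rewrite invf_div.
have a2E : (a ^+ 2 = c ^+ 2 - b ^+ 2)%R by rewrite cE addrK.
rewrite a2E; field; by rewrite b0 c0.
Qed.

End gauss_vec.

(** * The cube as a torus *)

Section wrap1.
Context (R : realType).
Implicit Types x y v : R.

(* The representative of [x] modulo [1] in [-1/2, 1/2[. *)
Definition wrap1 x : R := x - (Num.floor (x + 1 / 2))%:~R.

Lemma wrap1_itv x : - (1 / 2) <= wrap1 x < 1 / 2.
Proof.
have := floor_itv (x + 1 / 2); rewrite /wrap1 intrD => /andP[h1 h2].
by apply/andP; split; lra.
Qed.

Lemma wrap1_eq x (k : int) : - (1 / 2) <= x - k%:~R < 1 / 2 -> wrap1 x = x - k%:~R.
Proof.
move=> /andP[h1 h2]; rewrite /wrap1 (@floor_def _ _ k)// intrD.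
by apply/andP; split; lra.
Qed.

Lemma wrap1_id x : - (1 / 2) <= x < 1 / 2 -> wrap1 x = x.
Proof. by move=> h; rewrite (@wrap1_eq _ 0) subr0. Qed.

(** Both sides represent the same class modulo 1, and the representative in the half-open interval
    is unique. *)
Lemma wrap1_wrap1D x y : wrap1 (wrap1 x + y) = wrap1 (x + y).
Proof.
set k := Num.floor (x + y + 1 / 2).
have h : - (1 / 2) <= x + y - k%:~R < 1 / 2 := wrap1_itv (x + y).
rewrite [RHS](@wrap1_eq _ k)// (@wrap1_eq _ (k - Num.floor (x + 1 / 2))).
  by rewrite /wrap1 intrB; ring.
by rewrite /wrap1 intrB; lra.
Qed.

(** A point outside the interval has absolute value at least 1/2, its representative at most 1/2.
    Hence the decoder loses nothing by working modulo 1. *)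
Lemma wrap1_sqr_le x : wrap1 x ^+ 2 <= x ^+ 2.
Proof.
have [h|h] := boolP (- (1 / 2) <= x < 1 / 2); first by rewrite wrap1_id.
have /andP[w1 w2] := wrap1_itv x.
apply: (@le_trans _ _ (1 / 4)).
  suff : 0 <= (1 / 2 - wrap1 x) * (1 / 2 + wrap1 x) by lra.
  by apply: mulr_ge0; lra.
move: h; rewrite negb_and -ltNge -leNgt => /orP[h|h].
  suff : 0 <= (- x - 1 / 2) * (1 / 2 - x) by lra.
  by apply: mulr_ge0; lra.
suff : 0 <= (x - 1 / 2) * (1 / 2 + x) by lra.
by apply: mulr_ge0; lra.
Qed.

Lemma measurable_wrap1 : measurable_fun setT wrap1.
Proof.
apply: measurable_funB => //.
apply: nondecreasing_measurable => // x y xy.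
by rewrite ler_int le_floor// lerD2r.
Qed.

Lemma half_ltr : - (1 / 2) < 1 / 2 :> R.
Proof. lra. Qed.

Definition unif : probability (measurableTypeR R) R := uniform_prob half_ltr.

Local Notation leb := (lebesgue_measure : set (measurableTypeR R) -> \bar R).

Lemma unif_cc (A : set R) : measurable A ->
  unif A = leb (A `&` `[- (1 / 2), 1 / 2]).
Proof.
move=> mA; rewrite /unif /= /uniform_prob integral_uniform_pdf.
rewrite (eq_integral (cst 1%E)).
  by rewrite integral_cst ?mul1e//; exact: measurableI.
move=> x; rewrite inE => -[_]; rewrite /= in_itv /= /uniform_pdf => ->.
by rewrite (_ : 1 / 2 - - (1 / 2) = 1) ?invr1//; lra.
Qed.

(** The half-open interval is the range of [wrap1]; the right endpoint is a null set. *)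
Lemma unif_co (A : set R) : measurable A ->
  unif A = leb (A `&` `[- (1 / 2), 1 / 2[).
Proof.
move=> mA; rewrite unif_cc//.
have m1 : measurable (A `&` `[- (1 / 2), 1 / 2[) by exact: measurableI.
have m2 : measurable (A `&` [set 1 / 2]) by exact: measurableI.
apply/eqP; rewrite eq_le; apply/andP; split; last first.
  apply: le_measure; rewrite ?inE//; first exact: measurableI.
  apply: setIS => x /=; rewrite !in_itv/= => /andP[-> /ltW ->//].
apply: (@le_trans _ _ (leb ((A `&` `[- (1 / 2), 1 / 2[) `|` (A `&` [set 1 / 2])))).
  apply: le_measure; rewrite ?inE//; [exact: measurableI|exact: measurableU|].
  rewrite -setIUr; apply: setIS => x /=; rewrite !in_itv/= => /andP[->].
  by rewrite le_eqVlt => /orP[/eqP|]; [right|left].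
apply: (le_trans (measureU2 _ _ _)) => //.
rewrite -[leRHS]adde0 leeD2l// -(lebesgue_measure_set1 (1 / 2 : R)).
by apply: le_measure; rewrite ?inE//; exact: subIsetr.
Qed.

(** Rotation invariance on the circle: the rotation cuts the interval into two pieces and translates
    each of them. *)
Lemma unif_wrap1D v (A : set R) : measurable A ->
  unif ((fun x => wrap1 (x + v)) @^-1` A) = unif A.
Proof.
(* Only the class of [v] modulo 1 matters, so [v] is replaced by its fractional part. *)
move=> mA; set c := v - (Num.floor v)%:~R.
have c0 : 0 <= c < 1.
  by have /andP[h1 h2] := floor_itv v; rewrite intrD in h2; rewrite /c; lra.
have /andP[c1 c2] := c0.
have wE x : wrap1 (x + v) = wrap1 (x + c).
  rewrite -wrap1_wrap1D -[in RHS]wrap1_wrap1D.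
  have h : - (1 / 2) <= wrap1 x + v - (Num.floor (wrap1 x + v + 1 / 2))%:~R < 1 / 2
    := wrap1_itv (wrap1 x + v).
  rewrite (@wrap1_eq (wrap1 x + c) (Num.floor (wrap1 x + v + 1 / 2) - Num.floor v)).
    by rewrite intrB /c /wrap1; ring.
  by rewrite intrB /c; lra.
have mpre : measurable ((fun x => wrap1 (x + v)) @^-1` A).
  rewrite -(setTI (_ @^-1` _)).
  have mw : measurable_fun setT (fun x : R => wrap1 (x + v)).
    by apply: (measurableT_comp measurable_wrap1); exact: measurable_funD.
  exact: mw.
rewrite !unif_co//.
(* [A1] is reached by the points translated by [c] without wrapping, [A2] by those that wrap and
   move by [c - 1]. *)
pose A1 := A `&` `[c - 1 / 2, 1 / 2[.
pose A2 := A `&` `[- (1 / 2), c - 1 / 2[.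
have mA1 : measurable A1 by exact: measurableI.
have mA2 : measurable A2 by exact: measurableI.
have mtr t (B : set R) : measurable B -> measurable ((fun x => x + t) @^-1` B).
  move=> mB; rewrite -(setTI (_ @^-1` _)).
  have mw : measurable_fun setT (fun x : R => x + t) by exact: measurable_funD.
  exact: mw.
rewrite (_ : _ `&` _ = ((fun x => x + c) @^-1` A1) `|` ((fun x => x + (c - 1)) @^-1` A2)).
  rewrite measureU; [|exact: mtr|exact: mtr|]; last first.
    apply/seteqP; split => // x [[_ /=]] + [_ /=]; rewrite !in_itv/=; lra.
  transitivity (leb A1 + leb A2)%E.
    by congr (_ + _)%E; exact: lebesgue_measureD.
  rewrite -measureU//; last first.
    apply/seteqP; split => // x [[_ /=]] + [_ /=]; rewrite !in_itv/=; lra.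
  congr (lebesgue_measure _); rewrite /A1 /A2 -setIUr; congr (_ `&` _).
  apply/seteqP; split => x /=; rewrite !in_itv/=; first by case; lra.
  by move=> h; have [xc|xc] := ltP x (c - 1 / 2); [right|left]; lra.
apply/seteqP; split => x /=.
  rewrite in_itv/= wE => -[Aw /andP[x1 x2]].
  have [xc|xc] := ltP x (1 / 2 - c).
    have e : wrap1 (x + c) = x + c by apply: wrap1_id; lra.
    by left; rewrite e in Aw; split => //=; rewrite in_itv/=; lra.
  right; have e : wrap1 (x + c) = x + (c - 1).
    by rewrite (@wrap1_eq _ 1) ?mulr1z; lra.
  by rewrite e in Aw; split => //=; rewrite in_itv/=; lra.
rewrite wE; case=> -[Aw] /=; rewrite in_itv/= => h.
  by rewrite wrap1_id ?in_itv; [split => //=; lra|lra].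
rewrite (@wrap1_eq _ 1); last by rewrite mulr1z; lra.
by rewrite mulr1z in_itv/=; split; [rewrite -addrA|lra].
Qed.

Lemma unifN (A : set R) : measurable A -> unif (-%R @^-1` A) = unif A.
Proof.
move=> mA.
have mN (B : set R) : measurable B -> measurable (-%R @^-1` B).
  move=> mB; rewrite -(setTI (_ @^-1` _)).
  have mw : measurable_fun setT (-%R : R -> R) by exact: measurable_funN.
  exact: mw.
rewrite !unif_cc//; last exact: mN.
rewrite -[RHS]lebesgue_measureN; last exact: measurableI.
rewrite /pushforward; congr (lebesgue_measure _); rewrite preimage_setI; congr (_ `&` _).
by apply/seteqP; split => x /=; rewrite !in_itv/=; lra.
Qed.

Lemma unif_sym_itv (t : R) : 0 <= t <= 1 / 2 -> unif `[- t, t]%classic = (2 * t)%:E.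
Proof.
move=> /andP[t0 t2]; rewrite unif_cc//.
rewrite (_ : _ `&` _ = `[- t, t]%classic).
  rewrite lebesgue_measure_itv/= lte_fin; case: ltP => [_|h]; congr (_%:E); lra.
by apply/seteqP; split => x /=; rewrite !in_itv/=; [case|]; lra.
Qed.

(** Scaling of Lebesgue measure; since [A] lies in the shrunk interval, neither [A] nor its dilation
    is cut off. *)
Lemma unif_scale (c : R) (A : set R) : 0 < c <= 1 -> measurable A ->
  A `<=` `[- (c / 2), c / 2]%classic ->
  unif A = (c%:E * unif ((fun x => (c * x)%R) @^-1` A))%E.
Proof.
move=> /andP[c0 c1] mA Ac.
have mc : measurable_fun setT ((fun x => c * x)%R : measurableTypeR R -> measurableTypeR R).
  exact: measurable_funM.
have mpre : measurable ((fun x => c * x) @^-1` A).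
  by rewrite -(setTI (_ @^-1` _)); exact: mc.
have E (B : set R) : measurable B -> leb B = (c%:E * leb ((fun x => (c * x)%R) @^-1` B))%E.
  move=> mB.
  pose Q := isMeasurableFun.Build _ _ _ _ _ mc.
  pose X : {mfun _ >-> _} := HB.pack ((fun x => c * x)%R : measurableTypeR R -> measurableTypeR R) Q.
  have c0' : 0 <= c by exact: ltW.
  have := @lebesgue_measure_unique R (mscale (NngNum c0') (pushforward lebesgue_measure X)).
  move=> /(_ _ _ _ mB); apply => // _ [[a b]] _ <-.
  transitivity (c%:E * leb `](a / c)%R, (b / c)%R]%classic)%E.
    rewrite !lebesgue_measure_itv/= !lte_fin ltr_pM2r ?invr_gt0//.
    case: ifP => _; rewrite ?mule0// -!EFinB -EFinM; congr (_%:E).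
    by field; rewrite gt_eqF.
  rewrite /mscale /pushforward; congr (_ * leb _)%E.
  apply/seteqP; split => x /=; rewrite !in_itv/= ltr_pdivrMr// ler_pdivlMr//;
    by rewrite (mulrC x).
rewrite !unif_cc//.
have -> : A `&` `[- (1 / 2), 1 / 2] = A.
  by apply/setIidPl => x /Ac /=; rewrite !in_itv/=; lra.
rewrite [LHS]E//; congr (_ * leb _)%E; apply/esym/setIidPl => x /= /Ac /=.
rewrite !in_itv/= => /andP[h1 h2]; apply/andP; split.
  rewrite -(ler_pM2l c0); lra.
rewrite -(ler_pM2l c0); lra.
Qed.

End wrap1.

(** * The cube in dimension n and the volume of its balls *)

Section cube.
Context (R : realType).
Local Open Scope ereal_scope.

Definition cube n : probability 'rV[R]_n R := iid_law (unif R) n.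

Definition sqball n (r : R) : set 'rV[R]_n := [set x | (sqnorm x <= r)%R].

Lemma measurable_sqball_comp d (T : measurableType d) n (f : T -> 'rV[R]_n) r :
  measurable_fun setT f -> measurable [set t | sqball r (f t)].
Proof.
move=> mf; apply: measurable_setle => //; exact: measurable_sqnorm.
Qed.

Lemma measurable_sqball n r : measurable (@sqball n r).
Proof. exact: (measurable_sqball_comp (f := id)). Qed.

Definition wrapv n (x : 'rV[R]_n) : 'rV[R]_n := \row_i wrap1 (x ord0 i).

Lemma measurable_wrapv d (T : measurableType d) n (f : T -> 'rV[R]_n) :
  measurable_fun setT f -> measurable_fun setT (fun t => wrapv (f t)).
Proof.
move=> mf; apply: measurable_fun_rVP => i; under eq_fun do rewrite mxE.
exact: (measurableT_comp (@measurable_wrap1 R) (measurable_coord_comp i mf)).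
Qed.

Lemma sqnorm_wrapv n (x : 'rV[R]_n) : (sqnorm (wrapv x) <= sqnorm x)%R.
Proof. by apply: ler_sum => i _; rewrite mxE wrap1_sqr_le. Qed.

Lemma wrapv_wrapvD n (x y : 'rV[R]_n) : wrapv (wrapv x + y) = wrapv (x + y).
Proof. by apply/rowP => i; rewrite !mxE wrap1_wrap1D. Qed.

Lemma cube_wrapvD n (v : 'rV[R]_n) (f : 'rV[R]_n -> \bar R) :
  measurable_fun setT f -> (forall x, 0 <= f x) ->
  \int[cube n]_x f (wrapv (x + v)%R) = \int[cube n]_x f x.
Proof.
move=> mf f0.
rewrite -[RHS](@integral_iid_coordwise R (unif R) n
  (fun i x => wrap1 (x + v ord0 i)%R) f)//.
- apply: eq_integral => x _; congr f; apply/rowP => i.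
  by rewrite !mxE.
- by move=> i; apply: (measurableT_comp (@measurable_wrap1 R)); exact: measurable_funD.
- by move=> i A mA; exact: unif_wrap1D.
Qed.

Lemma cube_flip n (i : 'I_n) (f : 'rV[R]_n -> \bar R) :
  measurable_fun setT f -> (forall x, 0 <= f x) ->
  \int[cube n]_x f (\row_j if j == i then - x ord0 j else x ord0 j)%R =
  \int[cube n]_x f x.
Proof.
move=> mf f0.
rewrite -[RHS](@integral_iid_coordwise R (unif R) n
  (fun j x => if j == i then - x else x)%R f)//.
- by move=> j; case: (j == i) => //; exact: measurable_funN.
- by move=> j A mA; case: (j == i) => //; exact: unifN.
Qed.

(** The law of [c * x] has density [c^-1] on the shrunk interval, and [f] vanishes off that
    interval. *)
Lemma integral_unif_scale (c : R) (f : R -> \bar R) :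
  (0 < c <= 1)%R -> measurable_fun setT f -> (forall x, 0 <= f x) ->
  (forall x, ~ (- (c / 2) <= x <= c / 2)%R -> f x = 0) ->
  \int[unif R]_x f x = c%:E * \int[unif R]_x f (c * x)%R.
Proof.
move=> c01 mf f0 fV; have /andP[c0 c1] := c01.
have mc : measurable_fun setT ((fun x => c * x)%R : measurableTypeR R -> measurableTypeR R).
  exact: measurable_funM.
have mpre (B : set R) : measurable B -> measurable ((fun x => c * x)%R @^-1` B).
  by move=> mB; rewrite -(setTI (_ @^-1` _)); exact: mc.
pose Q := isMeasurableFun.Build _ _ _ _ _ mc.
pose X : {RV (unif R) >-> measurableTypeR R} :=
  HB.pack ((fun x => c * x)%R : measurableTypeR R -> measurableTypeR R) Q.
pose nu := distribution (unif R) X.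
pose J := `[(- (c / 2))%R, (c / 2)%R]%classic : set R.
pose g x := (c^-1 * \1_J x)%R.
have mJ : measurable J by exact: measurable_itv.
have mg : measurable_fun setT g.
  by apply: measurable_funM => //; exact: measurable_indic.
have E (A : set R) : measurable A -> nu A = \int[unif R]_(x in A) (g x)%:E.
  move=> mA.
  have mAJ : measurable (A `&` J) by exact: measurableI.
  transitivity (c^-1%:E * unif R (A `&` J)).
    rewrite (unif_scale c01 mAJ); last exact: subIsetr.
    rewrite muleA -EFinM mulVf ?gt_eqF// mul1e /nu /distribution /pushforward.
    rewrite (unif_cc (mpre _ mA)) (unif_cc (mpre _ mAJ)).
    congr (lebesgue_measure _); apply/seteqP; split => x /=; last first.
      by case=> -[].
    rewrite !in_itv/= => -[Ax /andP[x1 x2]]; split; first split => //.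
      rewrite /J /= in_itv/=; have : (c * (- (1 / 2)) <= c * x)%R by rewrite ler_pM2l.
      by have : (c * x <= c * (1 / 2))%R by [rewrite ler_pM2l|]; lra.
    by rewrite x1.
  under eq_integral do rewrite EFinM.
  rewrite ge0_integralZl//; last 2 first.
  - exact/measurable_EFinP/measurable_indic.
  - by rewrite lee_fin invr_ge0 ltW.
  congr (_ * _); rewrite integral_indic// setIC//.
have g0 x : (0 <= g x)%R by rewrite mulr_ge0// invr_ge0 ltW.
transitivity (c%:E * \int[nu]_x f x).
  rewrite (@ge0_integral_density _ (measurableTypeR R) R (unif R) nu g f mg g0 E mf f0).
  rewrite -ge0_integralZlT; last 3 first.
  - by apply: emeasurable_funM => //; exact/measurable_EFinP.
  - by move=> x; rewrite mule_ge0// lee_fin.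
  - by rewrite lee_fin ltW.
  apply: eq_integral => x _; rewrite /g indicE.
  have [xJ|xJ] := boolP (x \in J).
    by rewrite mulr1 muleCA -EFinM divff ?gt_eqF// mule1.
  rewrite fV ?mul0e ?mule0// => h; move/negP: xJ; apply; rewrite inE /J/= in_itv/=.
  exact: h.
congr (_ * _); apply/esym.
by apply: (@ge0_integral_map R _ _ _ _ (unif R) nu (fun x => c * x)%R).
Qed.

Lemma integral_cube_scale (c : R) n (f : 'rV[R]_n -> \bar R) :
  (0 < c <= 1)%R -> measurable_fun setT f -> (forall x, 0 <= f x) ->
  (forall (x : 'rV[R]_n) i, ~ (- (c / 2) <= x ord0 i <= c / 2)%R -> f x = 0) ->
  \int[cube n]_x f x = (c ^+ n)%:E * \int[cube n]_x f (c *: x).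
Proof.
move=> c01; have c0 : (0 <= c)%R by case/andP: c01 => /ltW.
elim: n f => [|n IH] f mf f0 fV.
  have mfc : measurable_fun setT (fun x : 'rV[R]__ => f (c *: x)).
    by apply: measurableT_comp => //; exact: measurable_rVZ.
  by rewrite /cube !integral_iid0// mul1e; congr f; exact: rV0_eq.
have mfc : measurable_fun setT (fun x : 'rV[R]__ => f (c *: x)).
  by apply: measurableT_comp => //; exact: measurable_rVZ.
pose g (p : measurableTypeR R * 'rV[R]_n) := f (rV_cons (p.1, c *: p.2)).
have mg : measurable_fun setT g.
  apply: (measurableT_comp mf); apply: (measurableT_comp (@measurable_rV_cons R n)).
  apply/measurable_fun_pairP; split => /=; first exact: measurable_fst.
  by apply: measurable_rVZ; exact: measurable_snd.
have g0 p : 0 <= g p by exact: f0.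
pose h a := \int[cube n]_v g (a, v).
have mh : measurable_fun setT h by exact: (measurable_fun_fubini_tonelli_F g mg g0).
have h0 a : 0 <= h a by apply: integral_ge0 => v _.
transitivity (\int[unif R]_a ((c ^+ n)%:E * h a)).
  rewrite /cube integral_iidS//; apply: eq_integral => a _.
  have mfa : measurable_fun setT (fun v : 'rV[R]_n => f (rV_cons (a, v))).
    apply: (measurableT_comp mf).
    exact: (measurableT_comp (@measurable_rV_cons R n) (pair1_measurable (a : measurableTypeR R))).
  rewrite (IH _ mfa)// => v i vi; apply: (fV _ (lift ord0 i)).
  by rewrite (rV_consS (_, _)).
rewrite (ge0_integralZlT _ mh h0) ?lee_fin ?exprn_ge0//.
rewrite (integral_unif_scale c01 mh h0); last first.
  move=> a ac; rewrite /h /g integral0_eq// => v _; apply: (fV _ ord0).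
  by rewrite (rV_cons0 (_, _)).
rewrite muleA -EFinM -exprSr; congr (_ * _).
rewrite [RHS](integral_iidS (unif R) mfc (fun=> f0 _)).
apply: eq_integral => a _; apply: eq_integral => v _.
by rewrite /g rV_consZ.
Qed.

Lemma coord_le_sqnorm n (x : 'rV[R]_n) i : (x ord0 i ^+ 2 <= sqnorm x)%R.
Proof.
rewrite /sqnorm (bigD1 i)//= lerDl; apply: sumr_ge0 => j _; exact: sqr_ge0.
Qed.

(** With [r <= 1 / 4] both balls lie inside the cube, so their measures are true volumes. This ratio
    gives the probability that a wrong word is accepted. *)
Lemma cube_sqball_scale (c r : R) n : (0 < c <= 1)%R -> (0 <= r <= 1 / 4)%R ->
  cube n (sqball (c ^+ 2 * r)) = (c ^+ n)%:E * cube n (sqball r).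
Proof.
move=> c01 /andP[r0 r4]; have c0 : (0 < c)%R by case/andP: c01.
have mS := @measurable_sqball n.
have := @integral_cube_scale c n (EFin \o \1_(sqball (c ^+ 2 * r))) c01.
rewrite integral_indic// setIT => ->; first last.
- move=> x i xi /=; rewrite indicE memNset// /sqball/= => xb.
  apply: xi; have := le_trans (coord_le_sqnorm x i) xb.
  have : (c ^+ 2 * r <= (c / 2) ^+ 2)%R.
    by rewrite exprMn ler_pM2l ?exprn_gt0//; lra.
  move=> h1 /le_trans/(_ h1) h.
  by rewrite -ler_norml -ler_sqr ?nnegrE ?divr_ge0 ?(ltW c0)// real_normK ?num_real.
- by move=> x; rewrite lee_fin.
- exact/measurable_EFinP/measurable_indic.
congr (_ * _); rewrite -[sqball r in RHS]setIT -integral_indic//=.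
apply: eq_integral => x _; congr (_%:E); rewrite !indicE; congr (_%:R).
congr nat_of_bool; apply/idP/idP; rewrite !inE /sqball/= sqnormZ ler_pM2l ?exprn_gt0//.
Qed.

Lemma cube_sqball_gt0 (r : R) n : (0 < r)%R -> 0 < cube n (sqball r).
Proof.
(* Half side of a small cube inside the ball; 1/2 keeps it in the large cube, and [n.+1] avoids
   dividing by zero in dimension 0. *)
move=> r0; pose t := Num.min (1 / 2)%R (Num.sqrt (r / n.+1%:R)).
have t0 : (0 < t)%R.
  by rewrite lt_min divr_gt0//= sqrtr_gt0 divr_gt0.
have t2 : (t <= 1 / 2)%R by rewrite ge_min lexx.
have tr : (n%:R * t ^+ 2 <= r)%R.
  apply: (@le_trans _ _ (n%:R * (r / n.+1%:R))%R).
    rewrite ler_wpM2l//.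
    have rn : (0 <= r / n.+1%:R)%R by rewrite divr_ge0// ltW.
    rewrite -(sqr_sqrtr rn) ler_sqr ?nnegrE ?sqrtr_ge0 ?(ltW t0)//.
    by rewrite ge_min lexx orbT.
  by rewrite mulrCA ler_piMr ?(ltW r0)// ler_pdivrMr// mul1r ler_nat.
pose J := `[(- t)%R, t]%classic : set R.
apply: (@lt_le_trans _ _ (cube n (rV_box (fun=> J)))).
  have -> : cube n (rV_box (fun=> J)) = \prod_(i < n) unif R J.
    by apply: iid_law_box => _; exact: measurable_itv.
  apply: (big_ind (fun x => 0 < x)) => [|x y|i _].
  - exact: lte01.
  - exact: mule_gt0.
  - by rewrite unif_sym_itv ?lte_fin ?mulr_gt0// (ltW t0).
apply: le_measure; rewrite ?inE.
- by apply: measurable_rV_box => _; exact: measurable_itv.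
- exact: measurable_sqball.
- move=> x xJ; rewrite /sqball/=; apply: le_trans tr.
  rewrite /sqnorm; apply: (@le_trans _ _ (\sum_(i < n) t ^+ 2)%R).
    apply: ler_sum => i _; have := xJ i; rewrite /J/= in_itv/= -ler_norml => h.
    by rewrite -[leLHS]real_normK ?num_real// ler_sqr ?nnegrE// ltW.
  by rewrite sumr_const card_ord mulr_natl.
Qed.

End cube.

(** * Second moments of a uniform point of a ball *)

Section ball_moments.
Context (R : realType).
Local Open Scope ereal_scope.

(** Halving also works at infinite values, so the sign averaging below needs no integrability. *)
Lemma adde_self_inj (x y : \bar R) : x + x = y + y -> x = y.
Proof.
by case: x y => [x||] [y||] //= -[xy]; congr (_%:E); lra.
Qed.

Lemma measurable_sum_coord n (s : seq 'I_n) (w : 'rV[R]_n) :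
  measurable_fun setT (fun x : 'rV[R]_n => \sum_(i <- s) x ord0 i * w ord0 i)%R.
Proof.
apply: measurable_sum => i; apply: measurable_funM => //.
exact: measurable_rV_coord.
Qed.

(* Averaging over the sign of one coordinate removes the cross terms. *)
Lemma cube_sum_sqr n (s : seq 'I_n) (w : 'rV[R]_n) (G : 'rV[R]_n -> \bar R) :
  uniq s -> measurable_fun setT G -> (forall x, 0 <= G x) ->
  (forall i (x : 'rV[R]_n), G (\row_j if j == i then - x ord0 j else x ord0 j)%R = G x) ->
  \int[cube R n]_x (((\sum_(i <- s) x ord0 i * w ord0 i) ^+ 2)%:E * G x) =
  \sum_(i <- s) (w ord0 i ^+ 2)%:E * \int[cube R n]_x ((x ord0 i ^+ 2)%:E * G x).
Proof.
move=> + mG G0 Gflip; elim: s => [_|i s IH /= /andP[si us]].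
  rewrite big_nil integral0_eq// => x _.
  by rewrite big_nil expr0n mul0e.
rewrite big_cons -IH//.
pose r (x : 'rV[R]_n) := (\sum_(j <- s) x ord0 j * w ord0 j)%R.
pose F (x : 'rV[R]_n) := ((x ord0 i * w ord0 i + r x) ^+ 2)%:E * G x.
have mr : measurable_fun setT r by exact: measurable_sum_coord.
have mi : measurable_fun setT (fun x : 'rV[R]_n => x ord0 i).
  exact: measurable_rV_coord.
have mF : measurable_fun setT F.
  apply: emeasurable_funM => //; apply/measurable_EFinP/measurable_funX.
  by apply: measurable_funD => //; exact: measurable_funM.
have F0 x : 0 <= F x by rewrite mule_ge0// lee_fin sqr_ge0.
pose F' (x : 'rV[R]_n) := F (\row_j if j == i then - x ord0 j else x ord0 j)%R.
have F'E x : F' x = ((- (x ord0 i * w ord0 i) + r x) ^+ 2)%:E * G x.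
  rewrite /F' /F Gflip mxE eqxx mulNr; congr ((( _ + _) ^+ 2)%:E * _).
  rewrite /r !big_seq; apply: eq_bigr => j js; rewrite mxE.
  by case: eqP => // ji; move: si; rewrite -ji js.
have mF' : measurable_fun setT F'.
  rewrite (_ : F' = fun x => ((- (x ord0 i * w ord0 i) + r x) ^+ 2)%:E * G x); last exact/funext.
  apply: emeasurable_funM => //; apply/measurable_EFinP/measurable_funX.
  by apply: measurable_funD => //; apply: measurable_funN; exact: measurable_funM.
have F'0 x : 0 <= F' x by exact: F0.
pose A (x : 'rV[R]_n) := (w ord0 i ^+ 2)%:E * ((x ord0 i ^+ 2)%:E * G x).
pose B (x : 'rV[R]_n) := ((r x ^+ 2)%:E * G x).
have mx2 : measurable_fun setT (fun x : 'rV[R]_n => (x ord0 i ^+ 2)%:E * G x).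
  by apply: emeasurable_funM => //; exact/measurable_EFinP/measurable_funX.
have mA : measurable_fun setT A by exact: emeasurable_funM.
have mB : measurable_fun setT B.
  by apply: emeasurable_funM => //; exact/measurable_EFinP/measurable_funX.
have x20 (x : 'rV[R]_n) : 0 <= (x ord0 i ^+ 2)%:E * G x.
  by rewrite mule_ge0// lee_fin sqr_ge0.
have A0 x : 0 <= A x by rewrite /A mule_ge0// lee_fin sqr_ge0.
have B0 x : 0 <= B x by rewrite /B mule_ge0// lee_fin sqr_ge0.
have E : \int[cube R n]_x F x + \int[cube R n]_x F x =
  (\int[cube R n]_x A x + \int[cube R n]_x B x) +
  (\int[cube R n]_x A x + \int[cube R n]_x B x).
  rewrite -{2}(@cube_flip R n i F mF F0).
  rewrite -/(F' _) -ge0_integralD// -ge0_integralD//.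
  rewrite -ge0_integralD//; last 4 first.
  - by move=> x _; rewrite adde_ge0.
  - exact: emeasurable_funD.
  - by move=> x _; rewrite adde_ge0.
  - exact: emeasurable_funD.
  apply: eq_integral => x _; rewrite -/(F' x) F'E /F /A /B muleA -EFinM.
  have e (u v : R) : (0 <= u)%R -> (0 <= v)%R ->
      u%:E * G x + v%:E * G x = (u + v)%:E * G x.
    by move=> u0 v0; rewrite EFinD ge0_muleDl.
  have q (u : R) : (0 <= u ^+ 2)%R by exact: sqr_ge0.
  have q2 : (0 <= w ord0 i ^+ 2 * x ord0 i ^+ 2)%R by exact: mulr_ge0.
  have q3 := addr_ge0 q2 (q (r x)).
  rewrite (e _ _ (q _) (q _)) (e _ _ q2 (q _)) (e _ _ q3 q3).
  by congr (_%:E * _); ring.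
have E2 : \int[cube R n]_x F x = \int[cube R n]_x A x + \int[cube R n]_x B x.
  exact: adde_self_inj.
under eq_integral do rewrite big_cons.
by rewrite -/(F _) E2 /A ge0_integralZlT// lee_fin sqr_ge0.
Qed.

Lemma sqball_flip n r (i : 'I_n) (x : 'rV[R]_n) :
  (\1_(sqball r) (\row_j if j == i then - x ord0 j else x ord0 j) : R)%R =
  \1_(sqball r) x.
Proof.
rewrite !indicE; congr (_%:R)%R; congr nat_of_bool.
apply/idP/idP; rewrite !inE /sqball/=; apply: etrans; congr (_ <= _)%R;
  by apply: eq_bigr => j _; rewrite mxE; case: ifP => // _; rewrite sqrrN.
Qed.

(** By exchangeability the [n] coordinates have equal second moments on the ball, and their sum is
    the moment of [sqnorm], which is at most [r] there. *)
Lemma cube_coord_sqr n (r : R) (i : 'I_n) : (0 < n)%N ->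
  \int[cube R n]_x ((x ord0 i ^+ 2)%:E * (\1_(sqball r) x)%:E) <=
  (r / n%:R)%:E * cube R n (sqball r).
Proof.
move=> n0; pose I j := \int[cube R n]_x ((x ord0 j ^+ 2)%:E * (\1_(sqball r) x)%:E).
have mG : measurable_fun setT (fun x : 'rV[R]_n => (\1_(sqball r) x)%:E : \bar R).
  by apply/measurable_EFinP/measurable_indic; exact: measurable_sqball.
have mI (j : 'I_n) : measurable_fun setT
    (fun x : 'rV[R]_n => (x ord0 j ^+ 2)%:E * (\1_(sqball r) x)%:E).
  apply: emeasurable_funM => //; apply/measurable_EFinP/measurable_funX.
  exact: measurable_rV_coord.
have I0 (j : 'I_n) (x : 'rV[R]_n) : 0 <= (x ord0 j ^+ 2)%:E * (\1_(sqball r) x)%:E.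
  by rewrite mule_ge0// lee_fin ?sqr_ge0.
have Iij j : I j = I i.
  rewrite /I -(@integral_iid_reindex _ _ _ _ (tperm i j) _ perm_inj (mI i) (I0 i)).
  apply: eq_integral => x _; rewrite mxE tpermL; congr (_ * (_%:R)%:E).
  congr nat_of_bool; apply/idP/idP; rewrite !inE /sqball/=; apply: etrans;
    congr (_ <= _)%R; rewrite /sqnorm; [symmetry|];
    rewrite (reindex_inj (@perm_inj _ (tperm i j)))/=;
    by apply: eq_bigr => k _; rewrite mxE.
have nI : n%:R%:E * I i <= r%:E * cube R n (sqball r).
  have -> : n%:R%:E * I i = \sum_(j < n) I j.
    rewrite (eq_bigr (fun=> I i))//.
    by rewrite sumr_const card_ord mule_natl.
  rewrite /I -ge0_integral_sum//.
  rewrite -[sqball r in leRHS]setIT -integral_indic//; last exact: measurable_sqball.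
  under eq_integral => x _.
    rewrite -ge0_sume_distrl; last by move=> j _; rewrite lee_fin sqr_ge0.
    rewrite sumEFin; over.
  have r0E (x : 'rV[R]_n) : sqball r x -> (0 <= r)%R.
    exact: le_trans (sqnorm_ge0 x).
  (* For negative [r] the ball is empty and both sides vanish. *)
  have [r0|r0] := leP 0%R r.
    rewrite -ge0_integralZlT//; apply: ge0_le_integralT.
    - apply: emeasurable_funM => //; apply/measurable_EFinP.
      exact: (measurable_sqnorm (f := id)).
    - exact: emeasurable_funM.
    - by move=> x; rewrite mule_ge0// lee_fin ?sqnorm_ge0//; exact: sqnorm_ge0.
    - move=> x; rewrite indicE; have [/set_mem xr|_] := boolP (x \in _).
        by rewrite !mule1 lee_fin.
      by rewrite !mule0.
  have z (x : 'rV[R]_n) : \1_(sqball r) x = 0%R :> R.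
    by rewrite indicE memNset// => /r0E; rewrite leNgt r0.
  under eq_integral do rewrite z mule0.
  under [in leRHS]eq_integral do rewrite z.
  by rewrite !integral0 mule0.
rewrite -/(I i) -(@lee_pmul2l _ n%:R%:E)// ?lte_fin ?ltr0n//.
by rewrite muleA -EFinM mulrCA mulfV ?mulr1// pnatr_eq0 -lt0n.
Qed.

Lemma cube_dotr_sqr n (r : R) (w : 'rV[R]_n) : (0 < n)%N ->
  \int[cube R n]_x ((dotr x w ^+ 2)%:E * (\1_(sqball r) x)%:E) <=
  (sqnorm w * (r / n%:R))%:E * cube R n (sqball r).
Proof.
move=> n0; rewrite /dotr (@cube_sum_sqr n (index_enum _) w (fun x => (\1_(sqball r) x)%:E))//.
- apply: (@le_trans _ _ (\sum_(i < n) (w ord0 i ^+ 2)%:E * ((r / n%:R)%:E * cube R n (sqball r)))).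
    apply: lee_sum => i _; apply: lee_wpmul2l; first by rewrite lee_fin sqr_ge0.
    exact: cube_coord_sqr.
  rewrite -ge0_sume_distrl; last by move=> i _; rewrite lee_fin sqr_ge0.
  by rewrite sumEFin EFinM muleA.
- exact: index_enum_uniq.
- by apply/measurable_EFinP/measurable_indic; exact: measurable_sqball.
- by move=> i x; rewrite sqball_flip.
Qed.

(** Chebyshev's inequality. It expresses near orthogonality: the inner product with a fixed [w] is
    typically of order |w| sqrt (r / n), a factor sqrt n below the Cauchy-Schwarz bound. *)
Lemma cube_dotr_tail n (r tau : R) (w : 'rV[R]_n) : (0 < n)%N -> (0 < tau)%R ->
  cube R n [set x | sqball r x /\ (dotr x w <= - tau)%R] <=
  (sqnorm w * (r / n%:R) / tau ^+ 2)%:E * cube R n (sqball r).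
Proof.
move=> n0 t0; have t2 : (0 < tau ^+ 2)%R by rewrite exprn_gt0.
have mG : measurable_fun setT (fun x : 'rV[R]_n => (\1_(sqball r) x)%:E : \bar R).
  by apply/measurable_EFinP/measurable_indic; exact: measurable_sqball.
have md : measurable_fun setT (fun x : 'rV[R]_n => dotr x w).
  exact: (measurable_dotr (f := id)).
have mD : measurable_fun setT
    (fun x : 'rV[R]_n => (dotr x w ^+ 2)%:E * (\1_(sqball r) x)%:E).
  by apply: emeasurable_funM => //; exact/measurable_EFinP/measurable_funX.
have D0 (x : 'rV[R]_n) : 0 <= (dotr x w ^+ 2)%:E * (\1_(sqball r) x)%:E.
  by rewrite mule_ge0// lee_fin sqr_ge0.
apply: (@le_trans _ _ (\int[cube R n]_x ((tau ^+ 2)^-1%:E *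
    ((dotr x w ^+ 2)%:E * (\1_(sqball r) x)%:E)))).
  apply: markov_le.
  - apply: measurableI; first exact: measurable_sqball.
    exact: measurable_setle.
  - exact: emeasurable_funM.
  - by move=> x; rewrite mule_ge0// lee_fin invr_ge0 ltW.
  - move=> x [xr xt]; rewrite indicE mem_set// mule1 -EFinM lee_fin.
    rewrite mulrC ler_pdivlMr// mul1r -(sqrrN (dotr x w)).
    by rewrite ler_sqr ?nnegrE; lra.
rewrite ge0_integralZlT//; last by rewrite lee_fin invr_ge0 ltW.
rewrite [in leRHS]mulrC EFinM -muleA; apply: lee_wpmul2l.
  by rewrite lee_fin invr_ge0 ltW.
exact: cube_dotr_sqr.
Qed.

End ball_moments.

(** * The binning code *)

Section pairwise.
Local Open Scope ereal_scope.

(* Chebyshev's inequality for the number of the [A i] that occur. *)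
Lemma pairwise_none_le d (T : measurableType d) (R : realType)
    (mu : probability T R) N (A : 'I_N -> set T) (p : R) :
  (0 < N)%N -> (0 < p)%R ->
  (forall i, measurable (A i)) -> (forall i, mu (A i) = p%:E) ->
  (forall i j, i != j -> mu (A i `&` A j) = (p * p)%:E) ->
  mu [set x | forall i, ~ A i x] <= ((N%:R * p)^-1)%:E.
Proof.
move=> N0 p0 mA Ap Aij; set t := (N%:R * p)%R.
have t0 : (0 < t)%R by rewrite mulr_gt0// ltr0n.
pose I i x : R := \1_(A i) x.
pose X x : R := (\sum_(i < N) I i x)%R.
have mI i : measurable_fun setT (I i) by exact: measurable_indic.
have mX : measurable_fun setT X by apply: measurable_sum.
have X0 x : (0 <= X x)%R by apply: sumr_ge0.
have IA i : \int[mu]_x (\1_(A i) x)%:E = p%:E.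
  by rewrite integral_indic// setIT; exact: Ap.
have IAij i j : i != j -> \int[mu]_x (\1_(A i `&` A j) x)%:E = (p * p)%:E.
  move=> ij; have mij : measurable (A i `&` A j) by exact: measurableI.
  by rewrite integral_indic// setIT; exact: Aij.
have EX : \int[mu]_x (X x)%:E = t%:E.
  transitivity (\int[mu]_x \sum_(i < N) (I i x)%:E).
    by apply: eq_integral => x _; rewrite sumEFin.
  rewrite ge0_integral_sum//; last 2 first.
  - by move=> i; exact/measurable_EFinP.
  - by move=> i x _; rewrite lee_fin.
  rewrite (eq_bigr (fun=> p%:E)).
    by rewrite sumEFin sumr_const card_ord /t mulr_natl.
  by move=> i _; exact: IA.
(* The diagonal pairs contribute [t]; the others, by pairwise independence, at most [t ^+ 2]. *)
have EX2 : \int[mu]_x (X x ^+ 2)%:E <= (t + t ^+ 2)%:E.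
  have -> : \int[mu]_x (X x ^+ 2)%:E =
      \int[mu]_x \sum_(i < N) \sum_(j < N) (\1_(A i `&` A j) x)%:E.
    apply: eq_integral => x _.
    rewrite expr2 /X mulr_suml -sumEFin; apply: eq_bigr => i _.
    rewrite mulr_sumr -sumEFin; apply: eq_bigr => j _.
    by rewrite indicI.
  have mij i j : measurable (A i `&` A j) by exact: measurableI.
  have mIij i j : measurable_fun setT (fun x => (\1_(A i `&` A j) x)%:E : \bar R).
    exact/measurable_EFinP/measurable_indic.
  rewrite ge0_integral_sum//; last 2 first.
  - by move=> i; exact: emeasurable_sum.
  - by move=> i x _; apply: sume_ge0 => j _; rewrite lee_fin.
  apply: (@le_trans _ _ (\sum_(i < N) (p + t * p)%:E)).
    apply: lee_sum => i _.
    rewrite ge0_integral_sum//.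
    rewrite (bigD1 i)//= setIid IA EFinD leeD2l//.
    apply: (@le_trans _ _ (\sum_(j < N) (p * p)%:E)).
      rewrite [leRHS](bigD1 i)//= -[leLHS]add0e leeD//.
        by rewrite lee_fin mulr_ge0// ltW.
      by apply: lee_sum => j ji; rewrite IAij// eq_sym.
    by rewrite sumEFin sumr_const card_ord lee_fin /t -mulrA mulr_natl.
  rewrite sumEFin sumr_const card_ord lee_fin -[(_ *+ N)%R]mulr_natl /t.
  by rewrite le_eqVlt; apply/orP; left; apply/eqP; ring.
have mXt : measurable_fun setT (fun x => ((X x - t) ^+ 2)%:E).
  by apply/measurable_EFinP/measurable_funX; exact: measurable_funB.
have EXt : \int[mu]_x ((X x - t) ^+ 2)%:E <= t%:E.
  (* The cross term of the square is moved to the left, so that every integrand stays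
     nonnegative. *)
  have E : \int[mu]_x ((X x - t) ^+ 2)%:E + (2 * t * t)%:E =
      \int[mu]_x (X x ^+ 2)%:E + (t ^+ 2)%:E.
    have -> : (2 * t * t)%:E = \int[mu]_x ((2 * t)%:E * (X x)%:E).
      rewrite ge0_integralZlT ?EX -?EFinM//.
      - exact/measurable_EFinP.
      - by rewrite lee_fin mulr_ge0// ltW.
    have -> : (t ^+ 2)%:E = \int[mu]_x (t ^+ 2)%:E.
      by rewrite integral_probability_cst.
    rewrite -ge0_integralD//; last 3 first.
    - by move=> x _; rewrite lee_fin sqr_ge0.
    - by move=> x _; rewrite lee_fin !mulr_ge0// ltW.
    - by apply: emeasurable_funM => //; exact/measurable_EFinP.
    rewrite -ge0_integralD//; last 3 first.
    - by move=> x _; rewrite lee_fin sqr_ge0.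
    - exact/measurable_EFinP/measurable_funX.
    - by move=> x _; rewrite lee_fin sqr_ge0.
    by apply: eq_integral => x _; rewrite -EFinM -!EFinD; congr (_%:E); ring.
  have : \int[mu]_x ((X x - t) ^+ 2)%:E + (2 * t * t)%:E <= (t + t ^+ 2 + t ^+ 2)%:E.
    by rewrite E EFinD leeD2r.
  rewrite -leeBrDr// -EFinB => /le_trans; apply.
  by rewrite lee_fin; lra.
apply: (@le_trans _ _ (\int[mu]_x ((t ^+ 2)^-1%:E * ((X x - t) ^+ 2)%:E))).
  apply: markov_le.
  - rewrite (_ : [set x | _] = \bigcap_(i in [set: 'I_N]) ~` A i).
      by apply: fin_bigcap_measurable => // i _; exact: measurableC.
    by apply/seteqP; split => x h i; [move=> _; exact: h|exact: h].
  - exact: emeasurable_funM.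
  - by move=> x; rewrite mule_ge0// lee_fin ?invr_ge0 sqr_ge0.
  - move=> x Ax; have -> : X x = 0%R.
      by apply: big1 => i _; rewrite /I indicE memNset.
    by rewrite sub0r sqrrN -EFinM mulVf// gt_eqF// exprn_gt0.
rewrite ge0_integralZlT//; last 2 first.
- by move=> x; rewrite lee_fin sqr_ge0.
- by rewrite lee_fin invr_ge0 sqr_ge0.
apply: (@le_trans _ _ ((t ^+ 2)^-1%:E * t%:E)).
  by apply: lee_wpmul2l => //; rewrite lee_fin invr_ge0 sqr_ge0.
by rewrite -EFinM lee_fin expr2 invfM mulfVK// gt_eqF.
Qed.

End pairwise.

(** * Random codebooks *)

Section codebook.
Context (R : realType).
Variables (A : finType) (n : nat).
Local Open Scope ereal_scope.

Local Notation D := #|{: A * 'I_n}|.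

(** The whole codebook is one point of a large cube, with one coordinate for each pair of a word and
    a position, so that its law is again i.i.d. *)
Definition codeword (a : A) (theta : 'rV[R]_D) : 'rV[R]_n :=
  (\row_k theta ord0 (enum_rank (a, k)))%R.

Lemma measurable_codeword d (T : measurableType d) a (f : T -> 'rV[R]_D) :
  measurable_fun setT f -> measurable_fun setT (fun t => codeword a (f t)).
Proof.
move=> mf; apply: measurable_fun_rVP => i; under eq_fun do rewrite mxE.
exact: measurable_coord_comp.
Qed.

Lemma codeword_law a (f : 'rV[R]_n -> \bar R) :
  measurable_fun setT f -> (forall x, 0 <= f x) ->
  \int[cube R D]_theta f (codeword a theta) = \int[cube R n]_x f x.
Proof.
move=> mf f0.
apply: (@integral_iid_reindex _ _ _ _ (fun k => enum_rank (a, k))) => //.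
by move=> k l /enum_rank_inj[].
Qed.

(** Distinct words occupy disjoint coordinates of [theta], hence are independent. *)
Lemma codeword_pair_law a a' (f : 'rV[R]_n * 'rV[R]_n -> \bar R) :
  a != a' -> measurable_fun setT f -> (forall x, 0 <= f x) ->
  \int[cube R D]_theta f (codeword a theta, codeword a' theta) =
  \int[cube R n]_x \int[cube R n]_y f (x, y).
Proof.
move=> aa' mf f0.
(* The first [n] positions read word [a], the last [n] word [a']; injectivity is where [a != a']
   enters. *)
pose h (k : 'I_(n + n)) := enum_rank
  (match fintype.split k with inl i => (a, i) | inr i => (a', i) end).
have hI : injective h.
  move=> k l /enum_rank_inj; rewrite -(splitK k) -(splitK l).
  case: (fintype.split k) => i; case: (fintype.split l) => j /=;
    rewrite ?(unsplitK (inl _)) ?(unsplitK (inr _)).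
  - by case=> ->.
  - by case=> /eqP; rewrite (negbTE aa').
  - by case=> /eqP; rewrite eq_sym (negbTE aa').
  - by case=> ->.
have msub : measurable_fun setT (fun x : 'rV[R]_(n + n) => (lsubmx x, rsubmx x)).
  apply/measurable_fun_pairP; split; apply: measurable_fun_rVP => i /=;
    under eq_fun do rewrite mxE; exact: measurable_rV_coord.
pose g (x : 'rV[R]_(n + n)) := f (lsubmx x, rsubmx x).
have mg : measurable_fun setT g by exact: measurableT_comp.
have g0 x : 0 <= g x by exact: f0.
have := @integral_iid_reindex R (unif R) _ _ h g hI mg g0.
rewrite integral_iid_split// => H.
transitivity (\int[iid_law (unif R) D]_x g (\row_i x ord0 (h i))%R).
  apply: eq_integral => theta _; rewrite /g; congr (f (_, _));
    apply/rowP => k; rewrite !mxE /h.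
  - by rewrite (unsplitK (inl k)).
  - by rewrite (unsplitK (inr k)).
rewrite H; apply: eq_integral => x _; apply: eq_integral => y _.
by rewrite /g row_mxKl row_mxKr.
Qed.

End codebook.

Section union_bound.
Local Open Scope ereal_scope.
Context d (T : measurableType d) (R : realType) (mu : {measure set T -> \bar R}).

Lemma integral_indicT (S : set T) : measurable S ->
  \int[mu]_x (\1_S x : R)%:E = mu S.
Proof. by move=> mS; rewrite integral_indic// setIT. Qed.

Lemma measure_exists_le (I : finType) (Q : pred I) (F : I -> set T) :
  (forall i, measurable (F i)) ->
  mu [set x | exists2 i, Q i & F i x] <= \sum_(i | Q i) mu (F i).
Proof.
move=> mF; have mI i : measurable_fun setT (fun x => (\1_(F i) x : R)%:E).
  exact/measurable_EFinP/measurable_indic.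
have -> : \sum_(i | Q i) mu (F i) = \int[mu]_x \sum_(i | Q i) (\1_(F i) x : R)%:E.
  under eq_integral do rewrite -big_filter.
  rewrite ge0_integral_sum// -[LHS]big_filter.
  by apply: eq_bigr => i _; rewrite integral_indicT.
have s0 x (r : pred I) : 0 <= \sum_(i | r i) (\1_(F i) x : R)%:E.
  by apply: sume_ge0 => i _; rewrite lee_fin.
apply: markov_le => //.
- rewrite (_ : [set x | _] = \bigcup_(i in [set i | Q i]) F i).
    by apply: fin_bigcup_measurable.
  by apply/seteqP; split => x [i ? ?]; exists i.
- by under eq_fun do rewrite -big_filter; exact: emeasurable_sum.
- move=> x [i Qi Fi]; rewrite (bigD1 i)//= indicE mem_set// -[leLHS]adde0 leeD//.
Qed.

End union_bound.

Section codeword_measure.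
Context (R : realType) (A : finType) (n : nat).
Local Open Scope ereal_scope.
Local Notation D := #|{: A * 'I_n}|.

Lemma measurable_preim d d' (T : measurableType d) (T' : measurableType d')
    (f : T -> T') (S : set T') :
  measurable_fun setT f -> measurable S -> measurable [set t | S (f t)].
Proof. by move=> mf mS; rewrite -(setTI [set t | _]); exact: mf. Qed.

(** The crypto lemma: a uniform point of the torus stays uniform after any fixed shift. *)
Lemma codeword_measure a v (S : set 'rV[R]_n) : measurable S ->
  cube R D [set theta : 'rV[R]_D | S (wrapv (codeword a theta + v)%R)] =
  cube R n S.
Proof.
move=> mS; have mw : measurable_fun setT (fun x : 'rV[R]_n => wrapv (x + v)%R).
  by apply: measurable_wrapv; exact: measurable_rVD.
have mI : measurable_fun setT (fun x : 'rV[R]_n => (\1_S x : R)%:E).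
  exact/measurable_EFinP/measurable_indic.
rewrite -(integral_indicT (cube R n) mS).
rewrite -(cube_wrapvD v mI) => [|x]; last by rewrite lee_fin.
rewrite -(@codeword_law R A n a (fun x => (\1_S (wrapv (x + v)))%:E))//; last first.
  exact: (measurableT_comp mI).
rewrite -integral_indicT//.
apply: (measurable_preim (f := fun theta => wrapv (codeword a theta + v)%R)) => //.
by apply: (measurableT_comp mw); exact: (@measurable_codeword R A n _ _ a id).
Qed.

(** Given word [a], the shift of word [a'] is a constant, so the crypto lemma applies conditionally.
    Letting it depend on [a] accommodates a received vector built from word [a]. *)
Lemma codeword_pair_measure a a' v (h : 'rV[R]_n -> 'rV[R]_n)
    (S S' : set 'rV[R]_n) : a != a' -> measurable_fun setT h ->
  measurable S -> measurable S' ->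
  cube R D [set theta : 'rV[R]_D | S (wrapv (codeword a theta + v)%R) /\
    S' (wrapv (codeword a' theta + h (codeword a theta))%R)] =
  cube R n S * cube R n S'.
Proof.
move=> aa' mh mS mS'.
have mI (B : set 'rV[R]_n) : measurable B ->
    measurable_fun setT (fun x : 'rV[R]_n => (\1_B x : R)%:E).
  by move=> mB; exact/measurable_EFinP/measurable_indic.
pose f (p : 'rV[R]_n * 'rV[R]_n) : \bar R :=
  (\1_S (wrapv (p.1 + v)))%:E * (\1_S' (wrapv (p.2 + h p.1)))%:E.
have m1 : measurable_fun setT (fun p : 'rV[R]_n * 'rV[R]_n => wrapv (p.1 + v)%R).
  by apply: measurable_wrapv; apply: measurable_rVD => //; exact: measurable_fst.
have m2 : measurable_fun setT (fun p : 'rV[R]_n * 'rV[R]_n => wrapv (p.2 + h p.1)%R).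
  apply: measurable_wrapv; apply: measurable_rVD; first exact: measurable_snd.
  by apply: (measurableT_comp mh); exact: measurable_fst.
have mf : measurable_fun setT f.
  apply: emeasurable_funM; first exact: (measurableT_comp (mI _ mS)).
  exact: (measurableT_comp (mI _ mS')).
have f0 p : 0 <= f p by rewrite mule_ge0// lee_fin.
have mc a0 : measurable_fun setT (fun theta : 'rV[R]_D => codeword a0 theta).
  exact: (@measurable_codeword R A n _ _ a0 id).
have mE : measurable [set theta : 'rV[R]_D | S (wrapv (codeword a theta + v)%R) /\
    S' (wrapv (codeword a' theta + h (codeword a theta))%R)].
  apply: measurableI.
    apply: (measurable_preim (f := fun theta => wrapv (codeword a theta + v)%R)) => //.
    by apply: measurable_wrapv; exact: measurable_rVD.
  apply: (measurable_preim
    (f := fun theta => wrapv (codeword a' theta + h (codeword a theta))%R)) => //.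
  by apply: measurable_wrapv; apply: measurable_rVD => //; exact: measurableT_comp.
rewrite -(integral_indicT (cube R D) mE).
transitivity (\int[cube R D]_theta f (codeword a theta, codeword a' theta)).
  by apply: eq_integral => theta _; rewrite /f/= -EFinM !indicE -natrM mulnb;
    congr (_%:R%:E); congr nat_of_bool; apply/idP/andP; rewrite !inE.
rewrite codeword_pair_law// /f/=.
transitivity (\int[cube R n]_x ((\1_S (wrapv (x + v)))%:E * cube R n S')).
  apply: eq_integral => x _.
  rewrite ge0_integralZlT//; last first.
    apply: (measurableT_comp (mI _ mS')); apply: measurable_wrapv.
    exact: measurable_rVD.
  congr (_ * _).
  by rewrite (cube_wrapvD (h x) (mI _ mS'))// integral_indicT.
have mw : measurable_fun setT (fun x : 'rV[R]_n => wrapv (x + v)%R).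
  by apply: measurable_wrapv; exact: measurable_rVD.
rewrite ge0_integralZrT//; last exact: (measurableT_comp (mI _ mS)).
by rewrite (cube_wrapvD v (mI _ mS))// integral_indicT.
Qed.

End codeword_measure.

(** * The code and its three error events *)

Section binning_code.
Context (R : realType).
Variables (n K N : nat) (T be dr : R).

Local Notation A := ('I_K * 'I_N)%type.
Local Notation D := #|{: A * 'I_n}|.

(* [(m, i)] is the [i]-th word of the bin of [m], [T] maps the unit cube to the
   scale of the inputs, [be * T] is the MMSE coefficient, [dr] is the squared
   decoding radius, and [1 / 16] that of the shaping ball, which lies in the cube. *)
Definition resid (a : A) (theta : 'rV[R]_D) (y : 'rV[R]_n) : 'rV[R]_n :=
  wrapv (codeword a theta + (- be) *: y).

Definition short a theta s : bool := sqnorm (resid a theta s) <= 1 / 16.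

Definition hit m theta y : bool :=
  [exists i, sqnorm (resid (m, i) theta y) <= dr].

(** The first short word of the list is used, and 0 is sent if there is none. A fold over a list
    makes measurability a plain induction. *)
Definition encl l m theta s : 'rV[R]_n :=
  foldr (fun i x => if short (m, i) theta s then T *: resid (m, i) theta s
                    else x) 0 l.

Definition decl l theta y : option 'I_K :=
  foldr (fun m o => if hit m theta y then Some m else o) None l.

Lemma encl_cases l m theta s :
  ((forall i, i \in l -> ~~ short (m, i) theta s) /\ encl l m theta s = 0) \/
  (exists2 i, short (m, i) theta s & encl l m theta s = T *: resid (m, i) theta s).
Proof.
elim: l => [|i l [[IH1 IH2]|[j j1 j2]]] /=; first by left.
- case: ifPn => si; first by right; exists i.
  by left; split => // j; rewrite inE => /orP[/eqP -> //|/IH1].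
- by case: ifPn => si; right; [exists i|exists j].
Qed.

Lemma decl_eq l theta y m : m \in l -> hit m theta y ->
  (forall m', m' != m -> ~~ hit m' theta y) -> decl l theta y = Some m.
Proof.
move=> ml hm h; elim: l ml => // k l IH; rewrite inE /=.
case: eqVneq => [<- _|mk /= /IH ->]; first by rewrite hm.
by rewrite (negbTE (h _ _))// eq_sym.
Qed.

Section measurability.
Context d (O : measurableType d) (f : O -> 'rV[R]_D) (g : O -> 'rV[R]_n).
Hypothesis (mf : measurable_fun setT f) (mg : measurable_fun setT g).

Lemma measurable_resid a : measurable_fun setT (fun t => resid a (f t) (g t)).
Proof.
apply: measurable_wrapv; apply: measurable_rVD; last exact: measurable_rVZ.
exact: measurable_codeword.
Qed.

Lemma measurable_encl l m : measurable_fun setT (fun t => encl l m (f t) (g t)).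
Proof.
elim: l => [|i l IH] /=; first exact: measurable_cst.
apply: measurable_fun_ifT => //; last first.
  by apply: measurable_rVZ; exact: measurable_resid.
apply: measurable_fun_ler => //; apply: measurable_sqnorm.
exact: measurable_resid.
Qed.

Lemma measurable_hit m : measurable [set t | hit m (f t) (g t)].
Proof.
rewrite (_ : [set t | _] = \bigcup_(i in [set: 'I_N])
    [set t | sqball dr (resid (m, i) (f t) (g t))]).
  apply: fin_bigcup_measurable => // i _.
  by apply: measurable_sqball_comp; exact: measurable_resid.
apply/seteqP; split => t /=; first by move=> /existsP[i h]; exists i.
by move=> [i _ h]; apply/existsP; exists i.
Qed.

Lemma measurable_decl l o : measurable [set t | decl l (f t) (g t) = o].
Proof.
have mP (Q : Prop) : measurable [set t : O | Q].
  have [q|q] := pselect Q.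
    by rewrite (_ : [set _ | _] = setT)//; apply/seteqP; split.
  by rewrite (_ : [set _ | _] = set0)//; apply/seteqP; split.
elim: l => [|m l IH] /=; first exact: mP.
rewrite (_ : [set t | _] =
  ([set t | hit m (f t) (g t)] `&` [set t | Some m = o]) `|`
  (~` [set t | hit m (f t) (g t)] `&` [set t | decl l (f t) (g t) = o])).
  apply: measurableU; apply: measurableI => //.
    exact: measurable_hit.
  by apply: measurableC; exact: measurable_hit.
apply/seteqP; split => t /=.
  by case: ifPn => h e; [left|right]; split => //; exact/negP.
by case=> -[] h e; [rewrite h|move/negP: h => /negbTE ->].
Qed.

End measurability.

Variable P : R.
Hypothesis TP : T ^+ 2 * (1 / 16) <= n%:R * P.
Hypothesis P0 : 0 <= n%:R * P.

Local Notation encf := (encl (enum 'I_N)).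
Local Notation decf := (decl (enum 'I_K)).

Lemma encl_power m theta s : sqnorm (encf m theta s) <= n%:R * P.
Proof.
have [[_ ->]|[i si ->]] := encl_cases (enum 'I_N) m theta s.
  by rewrite sqnorm0.
by apply: le_trans TP; rewrite sqnormZ ler_wpM2l ?sqr_ge0.
Qed.

Lemma measurable_encl_theta theta m : measurable_fun setT (encf m theta).
Proof. exact: (measurable_encl (f := cst theta) (g := id)). Qed.

Lemma measurable_decl_theta theta o : measurable (decf theta @^-1` [set o]).
Proof. exact: (measurable_decl (f := cst theta) (g := id)). Qed.

Definition binning_det (theta : 'rV[R]_D) : det_code n K P :=
  @DetCode R n K P (fun m s => encf m theta s) (decf theta)
    (measurable_encl_theta theta) (measurable_decl_theta theta)
    (fun m s => encl_power m theta s).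

Definition binning_code : rand_code n K P :=
  @RandCode R n K P _ 'rV[R]_D (cube R D) binning_det
    (fun m => measurable_encl measurable_fst measurable_snd (enum 'I_N) m)
    (fun o => measurable_decl measurable_fst measurable_snd (enum 'I_K) o).

Local Open Scope ereal_scope.

Let p := cube R n (sqball (1 / 16)%R).

Lemma short_measure a s :
  cube R D [set theta | short a theta s] = p.
Proof.
exact: (codeword_measure a ((- be) *: s)%R (@measurable_sqball R n _)).
Qed.

Lemma no_short_measure m s : (0 < N)%N ->
  cube R D [set theta | forall i, ~ short (m, i) theta s] <=
  ((N%:R * fine p)^-1)%:E.
Proof.
move=> N0; have p0 : 0 < p by apply: cube_sqball_gt0.
have pfin : p \is a fin_num by rewrite fin_num_measure//; exact: measurable_sqball.
apply: pairwise_none_le => //.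
- by rewrite fine_gt0// p0 ltey_eq pfin.
- move=> i; apply: (measurable_sqball_comp (f := fun theta => resid (m, i) theta s)).
  exact: (measurable_resid (f := id) (g := cst s)).
- by move=> i; rewrite fineK//; exact: short_measure.
- move=> i j ij; rewrite EFinM fineK//.
  have aa : (m, i) != (m, j) by apply: contra ij => /eqP[->].
  exact: (codeword_pair_measure ((- be) *: s)%R aa
    (measurable_cst ((- be) *: s)%R) (@measurable_sqball R n _) (@measurable_sqball R n _)).
Qed.

(** The received vector depends on the codebook only through word [a], so relative to it word [a']
    is uniform modulo 1 and independent of the shortness of [a]. *)
Lemma false_hit_measure (a a' : A) s (v : 'rV[R]_n) : a != a' ->
  cube R D [set theta | short a theta s /\
    (sqnorm (resid a' theta (T *: resid a theta s + v)%R) <= dr)%R] =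
  p * cube R n (sqball dr).
Proof.
move=> aa'.
pose h x := ((- be) *: (T *: wrapv (x + (- be) *: s) + v))%R : 'rV[R]_n.
have mh : measurable_fun setT h.
  apply: measurable_rVZ; apply: measurable_rVD => //; apply: measurable_rVZ.
  by apply: measurable_wrapv; exact: measurable_rVD.
exact: (codeword_pair_measure ((- be) *: s)%R aa' mh
  (@measurable_sqball R n _) (@measurable_sqball R n _)).
Qed.

(* The wrapping commutes with the subtraction of [be *: s], so the decoder sees
   the shaped codeword scaled by [1 - be * T], plus noise, modulo one. *)
Lemma resid_resid a theta s w :
  resid a theta (T *: resid a theta s + s + w)%R =
  wrapv ((1 - be * T) *: resid a theta s + (- be) *: w)%R.
Proof.
set x := resid a theta s; rewrite /resid.
have E y : wrapv (x + y)%R = wrapv (codeword a theta + (- be) *: s + y)%R.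
  exact: wrapv_wrapvD.
clearbody x.
transitivity (wrapv (x + ((- (be * T)) *: x + (- be) *: w))%R).
  by rewrite E; congr wrapv; apply/rowP => i; rewrite !mxE; ring.
by congr wrapv; apply/rowP => i; rewrite !mxE; ring.
Qed.

(** By [resid_resid] the residual is the wrapping of a combination of [x] and [w] whose two squared
    terms total at most [rho0 / 16]. A miss therefore forces the cross term to exceed the margin,
    and [cube_dotr_tail] makes this unlikely. *)
Lemma true_miss_measure a s w (rho0 N' : R) :
  (0 < n)%N -> (0 < be)%R -> (be * T < 1)%R -> (rho0 * (1 / 16) < dr)%R ->
  ((1 - be * T) ^+ 2 * (1 / 16) + be ^+ 2 * (n%:R * N') <= rho0 * (1 / 16))%R ->
  (sqnorm w <= n%:R * N')%R ->
  cube R D [set theta | short a theta s /\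
    ~ (sqnorm (resid a theta (T *: resid a theta s + s + w)%R) <= dr)%R] <=
  (N' * (1 / 16) / ((dr - rho0 * (1 / 16)) / (2 * (1 - be * T) * be)) ^+ 2)%:E * p.
Proof.
move=> n0 be0 bT rhod rhoE wN.
set tau := ((dr - rho0 * (1 / 16)) / (2 * (1 - be * T) * be))%R.
have den0 : (0 < 2 * (1 - be * T) * be)%R by rewrite !mulr_gt0// subr_gt0.
have tau0 : (0 < tau)%R by rewrite divr_gt0// subr_gt0.
pose S := [set x : 'rV[R]_n | sqball (1 / 16)%R x /\
  ~ sqball dr (wrapv ((1 - be * T) *: x + (- be) *: w))%R].
have mS : measurable S.
  apply: measurableI; first exact: measurable_sqball.
  apply: measurableC; apply: measurable_sqball_comp; apply: measurable_wrapv.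
  by apply: measurable_rVD => //; exact: measurable_rVZ.
rewrite (_ : [set theta | _] = [set theta | S (resid a theta s)]); last first.
  by apply/seteqP; split => theta; rewrite /S /short /sqball/= resid_resid.
rewrite (codeword_measure a ((- be) *: s)%R mS).
apply: (@le_trans _ _ (cube R n [set x | sqball (1 / 16)%R x /\ (dotr x w <= - tau)%R])).
  apply: le_measure; rewrite ?inE//.
    apply: measurableI; first exact: measurable_sqball.
    by apply: measurable_setle => //; exact: (measurable_dotr (f := id)).
  move=> x [xb xd]; split => //; rewrite leNgt; apply/negP => dx; apply: xd.
  apply: (le_trans (sqnorm_wrapv _)); rewrite sqnormD !sqnormZ dotrZl.
  rewrite [dotr x _]dotrC dotrZl (dotrC w) sqrrN.
  have h1 : ((1 - be * T) ^+ 2 * sqnorm x <= (1 - be * T) ^+ 2 * (1 / 16))%R.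
    by rewrite ler_wpM2l ?sqr_ge0.
  have h2 : (be ^+ 2 * sqnorm w <= be ^+ 2 * (n%:R * N'))%R.
    by rewrite ler_wpM2l ?sqr_ge0.
  have h3 : (- dotr x w * (2 * (1 - be * T) * be) <= dr - rho0 * (1 / 16))%R.
    by rewrite -ler_pdivlMr//; apply: ltW; rewrite ltrNl.
  lra.
apply: (le_trans (cube_dotr_tail _ _ n0 tau0)).
apply: lee_wpmul2r => //.
rewrite lee_fin ler_wpM2r ?invr_ge0 ?sqr_ge0//.
have nR : (0 < n%:R :> R)%R by rewrite ltr0n.
apply: (@le_trans _ _ (n%:R * N' * (1 / 16 / n%:R))%R).
  by rewrite ler_wpM2r// divr_ge0//; lra.
by rewrite le_eqVlt; apply/orP; left; apply/eqP; field; rewrite gt_eqF.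
Qed.

(* [t] is the mean number of short words in a bin, and the three terms bound the
   probabilities that the bin has none, that a short word of the bin is missed,
   and that another word falls in the decoding ball. *)
Lemma binning_error m s w (rho0 N' c sg t : R) :
  (0 < n)%N -> (0 < N)%N -> (0 < be)%R -> (be * T < 1)%R ->
  (0 < sg <= 1)%R -> (dr = sg ^+ 2 * (1 / 16))%R -> (rho0 * (1 / 16) < dr)%R ->
  ((1 - be * T) ^+ 2 * (1 / 16) + be ^+ 2 * (n%:R * N') <= rho0 * (1 / 16))%R ->
  (sqnorm w <= n%:R * N')%R ->
  (N' * (1 / 16) / ((dr - rho0 * (1 / 16)) / (2 * (1 - be * T) * be)) ^+ 2 <= c)%R ->
  t = (N%:R * fine p)%R ->
  cube R D [set theta | decf theta (encf m theta s + s + w)%R <> Some m] <=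
  (t^-1 + t * c + K%:R * t ^+ 2 * sg ^+ n)%:E.
Proof.
move=> n0 N0 be0 bT sg01 drE rhod rhoE wN cE tE.
have pfin : p \is a fin_num by rewrite fin_num_measure//; exact: measurable_sqball.
have pE : p = (fine p)%:E by rewrite fineK.
have p0 : (0 <= fine p)%R by apply: fine_ge0; exact: measure_ge0.
have sg0 : (0 < sg)%R by case/andP: sg01.
have mid (a : A) : measurable_fun setT (fun theta => resid a theta s).
  exact: (measurable_resid (f := id) (g := cst s)).
have my (a : A) : measurable_fun setT
    (fun theta => T *: resid a theta s + s + w)%R.
  by do 2 (apply: measurable_rVD => //); exact: measurable_rVZ.
have mshort a : measurable [set theta | short a theta s].
  exact: (measurable_sqball_comp (f := fun theta => resid a theta s)).
have mhit (a a' : A) : measurable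
    [set theta | (sqnorm (resid a' theta (T *: resid a theta s + s + w)%R) <= dr)%R].
  apply: measurable_sqball_comp.
  exact: (@measurable_resid _ _ id _ (@measurable_id _ _ _) (my a) a').
have menc : measurable_fun setT (fun theta => encf m theta s).
  exact: (measurable_encl (f := id) (g := cst s)).
pose E1 := [set theta | forall i, ~ short (m, i) theta s].
pose F2 i := [set theta | short (m, i) theta s] `&` ~`
  [set theta | (sqnorm (resid (m, i) theta (T *: resid (m, i) theta s + s + w)%R) <= dr)%R].
pose E2 := [set theta | exists2 i, xpredT i & F2 i theta].
(* The index of the transmitted word depends on [theta]; the union bound therefore runs over all
   candidates in the bin, each restricted to its being short. *)
pose F3 (j : 'I_N * A) := [set theta | short (m, j.1) theta s] `&`
  [set theta | (sqnorm (resid j.2 theta (T *: resid (m, j.1) theta s + s + w)%R) <= dr)%R].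
pose Q := [pred j : 'I_N * A | j.2.1 != m].
pose E3 := [set theta | exists2 j, j \in Q & F3 j theta].
have mF2 i : measurable (F2 i) by apply: measurableI => //; exact: measurableC.
have mF3 j : measurable (F3 j) by exact: measurableI.
have mE1 : measurable E1.
  rewrite (_ : E1 = \bigcap_(i in [set: 'I_N]) ~` [set theta | short (m, i) theta s]).
    by apply: fin_bigcap_measurable => // i _; exact: measurableC.
  by apply/seteqP; split => x h i; [move=> _; exact: h|exact: h].
have mE2 : measurable E2.
  rewrite (_ : E2 = \bigcup_(i in [set: 'I_N]) F2 i).
    exact: fin_bigcup_measurable.
  by apply/seteqP; split => x [i]; exists i.
have mE3 : measurable E3.
  rewrite (_ : E3 = \bigcup_(j in [set j | j \in Q]) F3 j).
    exact: fin_bigcup_measurable.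
  by apply/seteqP; split => x [i]; exists i.
apply: (@le_trans _ _ (cube R D (E1 `|` (E2 `|` E3)))).
  apply: le_measure; rewrite ?inE.
  - rewrite (_ : [set theta | _] =
        ~` [set theta | decf theta (encf m theta s + s + w)%R = Some m])//.
    apply: measurableC; apply: (measurable_decl (f := id)) => //.
    by do 2 (apply: measurable_rVD => //).
  - by apply: measurableU => //; exact: measurableU.
  (* Either no word is short, or the transmitted word is missed, or [m] is hit and [decl_eq] fails
     only through a hit of another message. *)
  - move=> theta /= err; have [[h _]|[i si ei]] := encl_cases (enum 'I_N) m theta s.
      by left => i; apply/negP/h; rewrite mem_enum.
    right; rewrite ei in err.
    have [hi|hi] := boolP (hit m theta (T *: resid (m, i) theta s + s + w)%R); last first.
      left; exists i => //; split => //= hd; move/negP: hi; apply.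
      by apply/existsP; exists i.
    right; apply: contrapT => no; apply: err; apply: decl_eq => //.
      by rewrite mem_enum.
    move=> m' mm; apply/negP => /existsP[i' h']; apply: no.
    by exists (i, (m', i')).
apply: (le_trans (measureU2 _ _ _)) => //; first exact: measurableU.
rewrite -addrA EFinD; apply: leeD.
  by rewrite tE; exact: no_short_measure.
apply: (le_trans (measureU2 _ _ _)) => //.
rewrite EFinD; apply: leeD.
  apply: (le_trans (measure_exists_le _ _ mF2)).
  apply: (@le_trans _ _ (\sum_(i < N) (c * fine p)%:E)).
    apply: lee_sum => i _.
    apply: (le_trans (true_miss_measure _ _ n0 be0 bT rhod rhoE wN)).
    by rewrite pE -EFinM lee_fin ler_wpM2r.
  rewrite sumEFin sumr_const card_ord lee_fin tE -mulr_natl.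
  by rewrite le_eqVlt; apply/orP; left; apply/eqP; ring.
apply: (le_trans (measure_exists_le _ _ mF3)).
have F3E j : j \in Q -> cube R D (F3 j) = (fine p * (sg ^+ n * fine p))%:E.
  move=> jQ; have aa : (m, j.1) != j.2.
    by apply: contra jQ => /eqP <-.
  have := false_hit_measure s (s + w)%R aa; rewrite drE cube_sqball_scale//; last lra.
  rewrite -/p pE -!EFinM => <-; congr (cube R D _).
  by rewrite /F3 -drE; apply/seteqP; split => theta /=; rewrite addrA.
rewrite (eq_bigr (fun=> (fine p * (sg ^+ n * fine p))%:E))//.
rewrite sumEFin sumr_const lee_fin.
(* The pairs with a wrong message are counted crudely by all N * (K * N) pairs; with N * p = t this
   gives the factor K * t^2. *)
apply: (@le_trans _ _ ((fine p * (sg ^+ n * fine p)) *+ #|{: 'I_N * A}|)%R).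
  by rewrite ler_wpMn2l ?max_card// !mulr_ge0// exprn_ge0// ltW.
rewrite !card_prod !card_ord tE -mulr_natl !natrM.
by rewrite le_eqVlt; apply/orP; left; apply/eqP; ring.
Qed.

End binning_code.

(** * Achievability *)

Section error_prob.
Context (R : realType).
Local Open Scope ereal_scope.

Section code.
Context (n K : nat) (P : R) (C : rand_code n K P) (m : 'I_K).

Definition err_set (q : rand_space C * ('rV[R]_n * 'rV[R]_n)) : Prop :=
  dec (realization q.1) (enc (realization q.1) m q.2.1 + q.2.1 + q.2.2)%R <> Some m.

Lemma measurable_err_set : measurable [set q | err_set q].
Proof.
rewrite (_ : [set q | err_set q] = ~` [set q | dec (realization q.1)
    (enc (realization q.1) m q.2.1 + q.2.1 + q.2.2)%R = Some m])//.
apply: measurableC.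
have := measurable_preim (f := fun q : rand_space C * ('rV[R]_n * 'rV[R]_n) =>
  (q.1, enc (realization q.1) m q.2.1 + q.2.1 + q.2.2)%R) _
  (@measurable_rand_dec _ _ _ _ C (Some m)).
apply; apply/measurable_fun_pairP; split; first exact: measurable_fst.
have m21 : measurable_fun setT
    (fun q : rand_space C * ('rV[R]_n * 'rV[R]_n) => q.2.1).
  exact: (measurableT_comp measurable_fst measurable_snd).
have m22 : measurable_fun setT
    (fun q : rand_space C * ('rV[R]_n * 'rV[R]_n) => q.2.2).
  exact: (measurableT_comp measurable_snd measurable_snd).
apply: measurable_rVD => //; apply: measurable_rVD => //.
have menc := @measurable_rand_enc _ _ _ _ C m.
apply: (measurableT_comp (g := fun q : rand_space C * ('rV[R]_n * 'rV[R]_n) =>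
  (q.1, q.2.1)) menc).
by apply/measurable_fun_pairP; split => //; exact: measurable_fst.
Qed.

(** Jamming and noise act only through their sum [w], so all errors reduce to this function of the
    state and [w]. *)
Definition cond_error (s w : 'rV[R]_n) : \bar R :=
  rand_law C [set theta | err_set (theta, (s, w))].

Lemma cond_errorE s w : cond_error s w =
  \int[rand_law C]_theta (\1_[set q | err_set q] (theta, (s, w)))%:E.
Proof.
rewrite /cond_error -integral_indicT; first exact: eq_integral.
exact: (measurable_preim (pair2_measurable (s, w)) measurable_err_set).
Qed.

Lemma measurable_cond_error :
  measurable_fun setT (fun q : 'rV[R]_n * 'rV[R]_n => cond_error q.1 q.2).
Proof.
have mI : measurable_fun setT
    (fun q => (\1_[set q | err_set q] q)%:E : \bar R).
  by apply/measurable_EFinP/measurable_indic; exact: measurable_err_set.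
have := @measurable_fun_fubini_tonelli_G _ _ _ _ _ (rand_law C) _ mI
  (fun q => (_ : 0 <= (\1_[set q | err_set q] q)%:E)).
rewrite /fubini_G => H.
rewrite (_ : (fun q => _) = (fun q : 'rV[R]_n * 'rV[R]_n =>
  \int[rand_law C]_theta (\1_[set q | err_set q] (theta, q))%:E)).
  by apply: H => q; rewrite lee_fin.
by apply/funext => -[s w]; exact: cond_errorE.
Qed.

Lemma cond_error_ge0 s w : 0 <= cond_error s w.
Proof. exact: measure_ge0. Qed.

Lemma cond_error_le1 s w : cond_error s w <= 1.
Proof.
apply: probability_le1.
exact: (measurable_preim (pair2_measurable (s, w)) measurable_err_set).
Qed.

Lemma error_probE (sigma sigmaS : R) (Q : R.-pker 'rV[R]_n ~> 'rV[R]_n) :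
  error_prob sigma sigmaS C m Q =
  \int[gauss_vec sigmaS n]_s \int[Q s]_j \int[gauss_vec sigma n]_z
    cond_error s (j + z)%R.
Proof.
apply: eq_integral => s _; apply: eq_integral => j _; apply: eq_integral => z _.
rewrite /cond_error; congr (rand_law C _).
by apply/seteqP; split => theta; rewrite /err_set/= !addrA.
Qed.

Lemma measurable_cond_error_noise (sigma : R) : measurable_fun setT
  (fun q : 'rV[R]_n * 'rV[R]_n => \int[gauss_vec sigma n]_z cond_error q.1 (q.2 + z)%R).
Proof.
have mf : measurable_fun setT (fun q : ('rV[R]_n * 'rV[R]_n) * 'rV[R]_n =>
    cond_error q.1.1 (q.1.2 + q.2)%R).
  apply: (measurableT_comp (g := fun q : ('rV[R]_n * 'rV[R]_n) * 'rV[R]_n =>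
    (q.1.1, q.1.2 + q.2)%R) measurable_cond_error).
  apply/measurable_fun_pairP; split.
    exact: (measurableT_comp measurable_fst measurable_fst).
  apply: measurable_rVD; last exact: measurable_snd.
  exact: (measurableT_comp measurable_snd measurable_fst).
exact: (measurable_fun_fubini_tonelli_F _ mf (fun=> cond_error_ge0 _ _)).
Qed.

(** As [e1] is uniform in [s] and [w], an adversary that knows the state gains nothing: for each
    admissible [j] the error exceeds [e1] only when the total disturbance is too strong, an event of
    the noise alone. *)
Lemma error_prob_le (L sigma sigmaS N' e1 e2 : R)
    (Q : R.-pker 'rV[R]_n ~> 'rV[R]_n) :
  (forall s, Q s (power_ball L) = 1) ->
  (0 <= e1)%R -> (0 <= e2)%R ->
  (forall s w, (sqnorm w <= n%:R * N')%R -> cond_error s w <= e1%:E) ->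
  (forall j, power_ball L j ->
    gauss_vec sigma n [set z | (n%:R * N' < sqnorm (j + z)%R)%R] <= e2%:E) ->
  error_prob sigma sigmaS C m Q <= (e1 + e2)%:E.
Proof.
move=> Q1 e10 e20 H1 H2; rewrite error_probE.
have mnoise := measurable_cond_error_noise sigma.
have noise0 s j : 0 <= \int[gauss_vec sigma n]_z cond_error s (j + z)%R.
  by apply: integral_ge0 => z _; exact: cond_error_ge0.
have mnoise_s s : measurable_fun setT
    (fun j : 'rV[R]_n => \int[gauss_vec sigma n]_z cond_error s (j + z)%R).
  exact: (measurableT_comp mnoise (pair1_measurable s)).
have mce s j : measurable_fun setT (fun z : 'rV[R]_n => cond_error s (j + z)%R).
  have mD : measurable_fun setT (fun z : 'rV[R]_n => (s, j + z)%R).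
    by apply/measurable_fun_pairP; split => /=; [exact: measurable_cst|exact: measurable_rVD].
  exact: (measurableT_comp measurable_cond_error mD).
have mL : measurable (@power_ball R n L) by exact: measurable_sqball.
apply: integral_le_cst.
- exact: (measurable_fun_integral_finite_kernel _ Q
    (fun q : 'rV[R]_n * 'rV[R]_n => noise0 q.1 q.2) mnoise).
- by move=> s; apply: integral_ge0 => j _.
move=> s; pose B := ~` (@power_ball R n L).
have mB : measurable B by exact: measurableC.
(* Off the power ball the error is bounded by 1; the indicator pays for this and has integral 0
   under [Q s]. *)
apply: (@le_trans _ _ (\int[Q s]_j ((e1 + e2)%:E + (\1_B j)%:E))).
  apply: ge0_le_integralT => //.
  - by apply: emeasurable_funD => //; exact/measurable_EFinP/measurable_indic.
  - move=> j; have [jL|jL] := pselect (power_ball L j); last first.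
      rewrite indicE mem_set// -[leLHS]add0e; apply: leeD.
        by rewrite lee_fin addr_ge0.
      apply: (@integral_le_cst _ _ _ _ _ 1) => [|z|z].
      - exact: mce.
      - exact: cond_error_ge0.
      - exact: cond_error_le1.
    rewrite indicE memNset; last by move=> /(_ jL).
    rewrite adde0.
    pose S := [set z | (n%:R * N' < sqnorm (j + z)%R)%R].
    have mS : measurable S.
      rewrite (_ : S = ~` [set z | sqball (n%:R * N')%R (j + z)%R]).
        apply: measurableC; apply: measurable_sqball_comp; exact: measurable_rVD.
      by apply/seteqP; split => z; rewrite /S /sqball/= ltNge => /negP.
    apply: (@le_trans _ _ (\int[gauss_vec sigma n]_z (e1%:E + (\1_S z)%:E))).
      apply: ge0_le_integralT => //.
      + by apply: emeasurable_funD => //; exact/measurable_EFinP/measurable_indic.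
      + move=> z; rewrite indicE; have [/set_mem zS|zS] := boolP (z \in S).
          by rewrite -[leLHS]add0e; apply: leeD => //; exact: cond_error_le1.
        rewrite adde0; apply: H1; rewrite leNgt; apply/negP => h.
        by move/negP: zS; apply; rewrite inE.
    rewrite ge0_integralD//; last exact/measurable_EFinP/measurable_indic.
    by rewrite integral_probability_cst integral_indicT// EFinD leeD2l//; exact: H2.
rewrite ge0_integralD//; last 2 first.
- by move=> j _; rewrite lee_fin addr_ge0.
- exact/measurable_EFinP/measurable_indic.
have QT : Q s setT = 1 by exact: prob_kernel.
rewrite integral_cst//= QT mule1 integral_indicT//.
have QB : Q s B = 0.
  have QU : Q s (power_ball L `|` B) = Q s (power_ball L) + Q s B.
    by apply: measureU => //; exact: setICr.
  have QT' : Q s (power_ball L `|` B) = 1 by rewrite setUv; exact: QT.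
  move: QU; rewrite QT' Q1; case: (Q s B) => [x||] //= [h]; congr (_%:E).
  by move: h; lra.
have -> : (Q s : set _ -> \bar R) B = 0 by exact: QB.
by rewrite adde0.
Qed.

End code.

Lemma code_error_le c n K (P L sigma sigmaS e : R) (C : rand_code n K P) :
  (0 <= e)%R ->
  (forall m, worst_error_prob L sigma sigmaS C m <= e%:E) ->
  code_error c L sigma sigmaS C <= e%:E.
Proof.
move=> e0 H; case: c => /=.
  by apply: (big_ind (fun x => x <= e%:E)) => [|x y xe ye|m _];
    rewrite ?lee_fin// ge_max xe.
apply: (@le_trans _ _ ((K%:R^-1)%:E * \sum_(m < K) e%:E)).
  apply: lee_wpmul2l; first by rewrite lee_fin invr_ge0.
  by apply: lee_sum => m _; exact: H.
rewrite sumEFin sumr_const card_ord -EFinM lee_fin -[(e *+ K)%R]mulr_natl mulrA.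
have [->|K0] := posnP K; first by rewrite mulr0 mul0r.
by rewrite mulVf ?mul1r// pnatr_eq0 -lt0n.
Qed.

(** Chernoff's bound for |j|^2 + 2 j.z + |z|^2, with one rate for every [n] and every admissible
    [j]. The converse reuses it at [j = 0]. *)
Lemma gauss_tail (L N' sigma : R) :
  (0 <= L)%R -> sigma != 0%R -> (L + sigma ^+ 2 < N')%R ->
  exists2 a, (0 < a)%R & forall n (j : 'rV[R]_n), (sqnorm j <= n%:R * L)%R ->
    gauss_vec sigma n [set z | (n%:R * N' < sqnorm (j + z)%R)%R] <=
    (expR (- (n%:R * a)))%:E.
Proof.
move=> L0 s0 LN; have s2 : (0 < sigma ^+ 2)%R by rewrite exprn_even_gt0.
pose del := (N' - (L + sigma ^+ 2))%R.
have del0 : (0 < del)%R by rewrite subr_gt0.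
(* With [b = del / M], the second summand of [M] gives the range condition [b1] of [gauss_chernoff],
   and the first keeps the quadratic cost below half of the gain ([b2]). *)
pose M := (8 * sigma ^+ 2 * (L + sigma ^+ 2) + 4 * sigma ^+ 2 * del)%R.
have q1 : (0 <= sigma ^+ 2 * (L + sigma ^+ 2))%R by apply: mulr_ge0; lra.
have q2 : (0 <= sigma ^+ 2 * del)%R by apply: mulr_ge0; lra.
have M0 : (0 < M)%R.
  by rewrite /M addr_gt0// mulr_gt0//; lra.
pose b := (del / M)%R.
have b0 : (0 < b)%R by rewrite divr_gt0.
have b1 : (2 * b * sigma ^+ 2 <= 1 / 2)%R.
  rewrite /b; have : (4 * sigma ^+ 2 * del / M <= 1)%R.
    by rewrite ler_pdivrMr// mul1r /M; lra.
  lra.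
have b2 : (b * (4 * sigma ^+ 2 * (L + sigma ^+ 2)) <= del / 2)%R.
  have q3 : (0 <= del * (sigma ^+ 2 * del))%R by apply: mulr_ge0; lra.
  by rewrite /b mulrAC ler_pdivrMr// /M; lra.
exists (b * del / 2)%R; first by rewrite divr_gt0// mulr_gt0.
move=> n j jL; set S := [set z | _].
have mS : measurable S.
  rewrite (_ : S = ~` [set z | sqball (n%:R * N')%R (j + z)%R]).
    apply: measurableC; apply: measurable_sqball_comp; exact: measurable_rVD.
  by apply/seteqP; split => z; rewrite /S /sqball/= ltNge => /negP.
have mE : measurable_fun setT (fun z : 'rV[R]_n =>
    (expR (dotr ((2 * b) *: j) z + b * (sqnorm z - n%:R * sigma ^+ 2)))%:E).
  apply/measurable_EFinP; apply: measurableT_comp => //.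
  apply: measurable_funD; first exact: measurable_dotr.
  apply: measurable_funM => //; apply: measurable_funB => //.
  exact: (measurable_sqnorm (f := id)).
apply: (@le_trans _ _ (\int[gauss_vec sigma n]_z ((expR (- (b * (n%:R * del))))%:E *
    (expR (dotr ((2 * b) *: j) z + b * (sqnorm z - n%:R * sigma ^+ 2)))%:E))).
  apply: markov_le => //.
  - exact: emeasurable_funM.
  - move=> z; rewrite /S/= sqnormD => h.
    rewrite -EFinM -expRD lee_fin -[leLHS]expR0 ler_expR dotrZl.
    have -> : (- (b * (n%:R * del)) + (2 * b * dotr j z + b * (sqnorm z - n%:R * sigma ^+ 2)) =
      b * (2 * dotr j z + sqnorm z - n%:R * sigma ^+ 2 - n%:R * del))%R by ring.
    rewrite mulr_ge0 ?(ltW b0)// /del.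
    lra.
rewrite ge0_integralZlT//.
apply: (@le_trans _ _ ((expR (- (b * (n%:R * del))))%:E *
  (expR (sigma ^+ 2 * sqnorm ((2 * b) *: j) + n%:R * (2 * b * sigma ^+ 2) ^+ 2))%:E)).
  by apply: lee_wpmul2l => //; exact: gauss_chernoff.
rewrite -EFinM -expRD lee_fin ler_expR sqnormZ.
have h1 : (4 * b ^+ 2 * sigma ^+ 2 * sqnorm j <= 4 * b ^+ 2 * sigma ^+ 2 * (n%:R * L))%R.
  apply: ler_wpM2l => //; apply: mulr_ge0; last exact: sqr_ge0.
  by have := sqr_ge0 b; lra.
have h2 : (n%:R * b * (b * (4 * sigma ^+ 2 * (L + sigma ^+ 2))) <= n%:R * b * (del / 2))%R.
  by rewrite ler_wpM2l// mulr_ge0// ltW.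
lra.
Qed.

Lemma expRN_small (a e : R) : (0 < a)%R -> (0 < e)%R ->
  exists n0, forall n, (n0 <= n)%N -> (expR (- (n%:R * a)) < e)%R.
Proof.
move=> a0 e0; exists (Num.truncn (1 / (a * e))).+1 => n nn.
have ae : (0 < a * e)%R by rewrite mulr_gt0.
have h : (1 / (a * e) < n%:R)%R.
  apply: (lt_le_trans (truncnS_gt _)); by rewrite ler_nat.
rewrite expRN invf_plt ?posrE ?expR_gt0//.
apply: (lt_le_trans _ (expR_ge1Dx _)).
rewrite ltr_pdivrMr// in h; rewrite -(ltr_pM2r e0) mulVf ?gt_eqF// mulrDl mul1r.
by rewrite -mulrA; lra.
Qed.

End error_prob.

(** * Choice of the parameters *)

Section achievability.
Context (R : realType).

Lemma natmul_between (p l : R) : 0 < p <= 1 -> 0 <= l ->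
  exists N : nat, [/\ (0 < N)%N, l <= N%:R * p & N%:R * p <= l + 1].
Proof.
move=> /andP[p0 p1] l0; exists (Num.truncn (l / p)).+1; split => //.
  by rewrite -ler_pdivrMr//; apply/ltW/truncnS_gt.
rewrite -natr1 mulrDl mul1r; apply: lerD => //.
by rewrite -ler_pdivlMr// truncn_le divr_ge0// ltW.
Qed.

Lemma powR2E (x : R) : 2 `^ x = expR (x * ln 2).
Proof. by rewrite /powR pnatr_eq0. Qed.

(** For a rational rate a / q, blocklengths that are multiples of [q] make 2^(nr) an integer. The
    last hypothesis is r < 1/2 log (1 + P / (L + sigma^2)) in exponential form. *)
Lemma achievable_ratio c (P L sigma sigmaS : R) (a q : nat) :
  0 < P -> 0 < L -> sigma != 0 -> (0 < q)%N ->
  (2 `^ (2 * (a%:R / q%:R)) - 1) * (L + sigma ^+ 2) < P ->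
  achievable c P L sigma sigmaS (a%:R / q%:R).
Proof.
move=> P0 L0 s0 q0; set r := a%:R / q%:R; set X := 2 `^ (2 * r) => XP eps eps0.
have s2 : 0 < sigma ^+ 2 by rewrite exprn_even_gt0.
have X0 : 0 < X by rewrite /X powR2E expR_gt0.
(* Total disturbance power with some slack, small enough that the rate condition survives as
   [XN]. *)
pose N' := L + sigma ^+ 2 + (P - (X - 1) * (L + sigma ^+ 2)) / (2 * X).
have dN : 0 < (P - (X - 1) * (L + sigma ^+ 2)) / (2 * X).
  by rewrite divr_gt0 ?mulr_gt0// subr_gt0.
have LN : L + sigma ^+ 2 < N' by rewrite ltrDl.
have N'0 : 0 < N' by apply: lt_trans LN; rewrite addr_gt0.
have XN : X * N' < P + N'.
  have : X * ((P - (X - 1) * (L + sigma ^+ 2)) / (2 * X)) =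
      (P - (X - 1) * (L + sigma ^+ 2)) / 2 by field; rewrite gt_eqF.
  rewrite /N'; lra.
have PN0 : 0 < P + N' by rewrite addr_gt0.
pose rho0 := N' / (P + N').
(* Above the MMSE ratio [rho0], which leaves a margin for the cross term, and below [X^-1], which
   makes wrong words rare. *)
pose rho := (rho0 + X^-1) / 2.
have rho00 : 0 < rho0 by rewrite divr_gt0.
have rho0X : rho0 < X^-1 by rewrite ltr_pdivrMr// mulrC ltr_pdivlMr// mulrC.
have rho0rho : rho0 < rho by rewrite /rho; lra.
have rhoX : X * rho < 1.
  by rewrite mulrC -ltr_pdivlMr// div1r /rho; lra.
have X1 : 1 <= X.
  by rewrite /X powR2E -[leLHS]expR0 ler_expR !mulr_ge0 ?divr_ge0// ln_ge0// ler1n.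
have rho1 : rho <= 1.
  have : X^-1 <= 1 by rewrite invf_le1.
  by rewrite /rho; lra.
have rhogt0 : 0 < rho by lra.
pose sg := Num.sqrt rho.
have sg2 : sg ^+ 2 = rho by rewrite sqr_sqrtr// ltW.
have sg0 : 0 < sg by rewrite sqrtr_gt0.
have sg01 : 0 < sg <= 1 by rewrite sg0 -sqrtr1 ler_sqrt.
(* The exponent in K * sg^n = exp (- n a0), positive because [X * rho < 1]. *)
pose a0 := - (r * ln 2 + ln sg).
have a00 : 0 < a0.
  have : ln (X * rho) < 0 by rewrite ln_lt0// mulr_gt0.
  rewrite lnM ?posrE// -sg2 expr2 lnM ?posrE// /X powR2E expRK /a0; lra.
pose al := P / (P + N').
have al0 : 0 < al by rewrite divr_gt0.
have al1 : al < 1 by rewrite ltr_pdivrMr// mul1r ltrDl.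
(* The bound of [true_miss_measure] equals [c0 / n] once [be] is substituted, with [be ^+ 2] of
   order 1 / n. *)
pose c0 := 4 * N' * (1 - al) ^+ 2 * al ^+ 2 / (P * (rho - rho0) ^+ 2).
have rr0 : 0 < rho - rho0 by rewrite subr_gt0.
have c00 : 0 < c0.
  have al1' : 0 < 1 - al by rewrite subr_gt0.
  apply: divr_gt0; apply: mulr_gt0; rewrite ?exprn_gt0//.
  by apply: mulr_gt0; [lra|exact: exprn_gt0].
(* Lower bound for the mean number of short words, chosen so that its inverse is [eps / 8]. *)
pose l := 8 / eps.
have l0 : 0 < l by rewrite divr_gt0.
have [a1 a10 tail] := gauss_tail (ltW L0) s0 LN.
have l1 : 0 < 8 * (l + 1) ^+ 2 by rewrite mulr_gt0// exprn_gt0// addr_gt0.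
have [n2 Hn2] := expRN_small a00 (divr_gt0 eps0 l1).
have e8 : 0 < eps / 8 by rewrite divr_gt0.
have [n3 Hn3] := expRN_small a10 e8.
pose n1 := (Num.truncn ((l + 1) * c0 / (eps / 8))).+1.
pose j := (n1 + n2 + n3).+1.
pose n := (q * j)%N; pose K := (2 ^ (a * j))%N.
have n0 : (0 < n)%N by rewrite muln_gt0 q0.
have jn : (j <= n)%N by rewrite leq_pmull.
have nR : 0 < n%:R :> R by rewrite ltr0n.
have KE : K%:R = 2 `^ (n%:R * r).
  rewrite /K natrX -powR_mulrn ?ler0n//; congr (_ `^ _).
  rewrite /r /n !natrM; field; by rewrite pnatr_eq0 -lt0n.
(* Maps the shaping ball of squared radius 1/16 onto the ball of squared radius [n%:R * P]. *)
pose T := Num.sqrt (16 * (n%:R * P)).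
have nP0 : 0 < n%:R * P by rewrite mulr_gt0.
have T2 : T ^+ 2 = 16 * (n%:R * P) by rewrite sqr_sqrtr// mulr_ge0// ltW.
have T0 : 0 < T by rewrite sqrtr_gt0 mulr_gt0.
pose be := al / T.
have be0 : 0 < be by rewrite divr_gt0.
have beT : be * T = al by rewrite divfK// gt_eqF.
have be2 : be ^+ 2 = al ^+ 2 / (16 * (n%:R * P)) by rewrite exprMn exprVn T2.
have pgt0 : (0 < cube R n (sqball (1 / 16)))%E by apply: cube_sqball_gt0; rewrite divr_gt0.
have pfin : cube R n (sqball (1 / 16)) \is a fin_num.
  by rewrite fin_num_measure//; exact: measurable_sqball.
have p01 : 0 < fine (cube R n (sqball (1 / 16))) <= 1.
  rewrite fine_gt0 ?pgt0 ?ltey_eq ?pfin//= -lee_fin fineK//.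
  by apply: probability_le1; exact: measurable_sqball.
(* The bin size is chosen after [n], because the measure of the shaping ball depends on [n]; the
   mean [t] stays between [l] and [l + 1]. *)
have [N [N0 Nl Nl1]] := natmul_between p01 (ltW l0).
set t := N%:R * _ in Nl Nl1.
have TP : T ^+ 2 * (1 / 16) <= n%:R * P by rewrite T2; clear; lra.
exists n, K, (binning_code K N be (rho * (1 / 16)) TP (ltW nP0)); split => //.
have e1 : forall s w, sqnorm w <= n%:R * N' -> forall m,
    (cond_error (binning_code K N be (rho * (1 / 16)) TP (ltW nP0)) m s w <=
    (t^-1 + t * (c0 / n%:R) + K%:R * t ^+ 2 * sg ^+ n)%:E)%E.
  move=> s w wN m.
  apply: (@binning_error R n K N T be (rho * (1 / 16)) m s w rho0 N' (c0 / n%:R) sg t) => //.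
  - by rewrite beT.
  - by rewrite sg2.
  - by rewrite ltr_pM2r//; lra.
  - rewrite beT be2 le_eqVlt; apply/orP; left; apply/eqP; rewrite /al /rho0.
    field; by rewrite !gt_eqF.
  - rewrite beT le_eqVlt; apply/orP; left; apply/eqP.
    transitivity (N' * 64 * (1 - al) ^+ 2 * be ^+ 2 / (rho - rho0) ^+ 2).
      field; rewrite ?gt_eqF//; lra.
    by rewrite be2 /c0; field; rewrite ?gt_eqF//; lra.
have t0 : 0 < t by exact: lt_le_trans Nl.
have b1 : t^-1 <= eps / 8.
  by rewrite -[leRHS]invrK lef_pV2 ?posrE ?invr_gt0// invf_div.
have b2 : t * (c0 / n%:R) <= eps / 8.
  apply: (@le_trans _ _ ((l + 1) * (c0 / n%:R))).
    by rewrite ler_wpM2r// divr_ge0// ltW.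
  rewrite mulrA ler_pdivrMr// -ler_pdivrMl// mulrC.
  apply: ltW; apply: (lt_le_trans (truncnS_gt _)); rewrite ler_nat.
  by apply: leq_trans jn; rewrite /j /n1 -!addnS -addnA leq_addr.
have b3 : K%:R * t ^+ 2 * sg ^+ n <= eps / 8.
  have -> : K%:R * t ^+ 2 * sg ^+ n = expR (- (n%:R * a0)) * t ^+ 2.
    rewrite KE powR2E mulrAC; congr (_ * _).
    rewrite -[sg in LHS](lnK (x := sg)) ?posrE// -expRM_natl -expRD /a0.
    by congr expR; ring.
  have n2n : (n2 <= n)%N by apply: leq_trans jn; rewrite /j addnAC leqW// leq_addl.
  have h := ltW (Hn2 n n2n).
  apply: (@le_trans _ _ (eps / (8 * (l + 1) ^+ 2) * (l + 1) ^+ 2)).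
    apply: ler_pM; rewrite ?expR_ge0 ?sqr_ge0//.
    by rewrite ler_sqr ?nnegrE ?(ltW t0)// addr_ge0// ltW.
  rewrite le_eqVlt; apply/orP; left; apply/eqP; field.
  by rewrite gt_eqF// addr_gt0.
have b4 : expR (- (n%:R * a1)) <= eps / 8.
  by apply/ltW/Hn3; apply: leq_trans jn; rewrite /j leqW// leq_addl.
apply: (@le_lt_trans _ _ (eps / 8 + eps / 8 + eps / 8 + eps / 8)%:E); last first.
  by rewrite lte_fin; clear -eps0; lra.
apply: code_error_le; first by clear -e8; lra.
move=> m; apply: ge_ereal_sup => _ [Q HQ <-].
refine (@error_prob_le R n K P _ m L sigma sigmaS N' (eps / 8 + eps / 8 + eps / 8)
  (eps / 8) Q HQ _ (ltW e8) _ _).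
- by clear -e8; lra.
- move=> s w wN; apply: (le_trans (e1 s w wN m)).
  by rewrite lee_fin !lerD.
- by move=> y Ly; apply: (le_trans (tail n y Ly)); rewrite lee_fin.
Qed.

End achievability.

(** * Converse *)

Section converse_reduction.
Context (R : realType).
Local Open Scope ereal_scope.

Lemma measurable_fun_rV_sum n (x : 'rV[R]_n) : measurable_fun setT
  (fun p : 'rV[R]_n * 'rV[R]_n => (x + (p.1 + p.2))%R).
Proof.
apply: measurable_rVD => //; apply: measurable_rVD.
  exact: measurable_fst.
exact: measurable_snd.
Qed.

Section noise.
Context (n K : nat) (P : R) (C : rand_code n K P).
Variable nu : probability ('rV[R]_n * 'rV[R]_n)%type R.

Let madd : measurable_fun setT (fun p : 'rV[R]_n * 'rV[R]_n => (p.1 + p.2)%R).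
Proof. by apply: measurable_rVD; [exact: measurable_fst|exact: measurable_snd]. Qed.

Let mce m : measurable_fun setT (fun q : 'rV[R]_n * ('rV[R]_n * 'rV[R]_n) =>
  cond_error C m q.1 (q.2.1 + q.2.2)%R).
Proof.
apply: (measurableT_comp (g := fun q : 'rV[R]_n * ('rV[R]_n * 'rV[R]_n) =>
  (q.1, q.2.1 + q.2.2)%R) (measurable_cond_error C m)).
apply/measurable_fun_pairP; split; first exact: measurable_fst.
exact: (measurableT_comp madd measurable_snd).
Qed.

Definition noise_error m s := \int[nu]_p cond_error C m s (p.1 + p.2)%R.

Lemma measurable_noise_error m : measurable_fun setT (noise_error m).
Proof.
exact: (@measurable_fun_fubini_tonelli_F _ _ _ _ R nu
  (fun q => cond_error C m q.1 (q.2.1 + q.2.2)%R) (mce m)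
  (fun=> cond_error_ge0 _ _ _ _)).
Qed.

Lemma noise_error_ge0 m s : 0 <= noise_error m s.
Proof. by apply: integral_ge0 => p _; exact: cond_error_ge0. Qed.

(** Integrating over [theta] last leaves, for each [theta] and [s], a fixed family of points in the
    power ball and disjoint sets. A bound valid for all such families survives averaging over the
    shared randomness. *)
Lemma sum_noise_error_ge (e : R) s :
  (0 <= e)%R ->
  (forall (x : 'I_K -> 'rV[R]_n) (D : 'I_K -> set 'rV[R]_n),
    (forall m, (sqnorm (x m) <= n%:R * P)%R) -> (forall m, measurable (D m)) ->
    (forall m m' y, D m y -> D m' y -> m = m') ->
    e%:E <= \sum_(m < K) nu [set p | ~ D m (x m + (p.1 + p.2))%R]) ->
  e%:E <= \sum_(m < K) noise_error m s.
Proof.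
move=> e0 H.
pose I m (q : ('rV[R]_n * 'rV[R]_n) * rand_space C) : \bar R :=
  (\1_[set q | err_set m q] (q.2, (s, (q.1.1 + q.1.2)%R)))%:E.
have mI m : measurable_fun setT (I m).
  have mq : measurable_fun setT (fun q : ('rV[R]_n * 'rV[R]_n) * rand_space C =>
      (q.2, (s, (q.1.1 + q.1.2)%R))).
    apply/measurable_fun_pairP; split; first exact: measurable_snd.
    apply/measurable_fun_pairP; split; first exact: measurable_cst.
    exact: (measurableT_comp madd measurable_fst).
  have m1 : measurable_fun setT
      (fun q => (\1_[set q : rand_space C * ('rV[R]_n * 'rV[R]_n) | err_set m q] q)%:E : \bar R).
    by apply/measurable_EFinP/measurable_indic; exact: measurable_err_set.
  exact: (measurableT_comp m1 mq).
have I0 m q : 0 <= I m q by rewrite lee_fin.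
pose F m theta := \int[nu]_p I m (p, theta).
have mF m : measurable_fun setT (F m).
  exact: (@measurable_fun_fubini_tonelli_G _ _ _ _ R nu (I m) (mI m) (I0 m)).
have F0 m theta : 0 <= F m theta by apply: integral_ge0 => p _; exact: I0.
have EF m : noise_error m s = \int[rand_law C]_theta F m theta.
  rewrite /noise_error; under eq_integral do rewrite cond_errorE.
  exact: (@fubini_tonelli _ _ _ _ R nu (rand_law C) (I m) (mI m) (I0 m)).
rewrite (eq_bigr (fun m => \int[rand_law C]_theta F m theta))//.
rewrite -ge0_integral_sum//.
rewrite -(@integral_probability_cst R _ _ (rand_law C) e%:E).
apply: ge0_le_integralT => //; first exact: emeasurable_sum.
move=> theta.
pose x m := enc (realization theta) m s.
(* A given state is a translation, absorbed into the decoding sets. *)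
pose D m := [set y | dec (realization theta) (y + s)%R = Some m].
have mD m : measurable (D m).
  have ms : measurable_fun setT (fun y : 'rV[R]_n => (y + s)%R).
    exact: measurable_rVD.
  exact: (measurable_preim ms (@measurable_dec _ _ _ _ (realization theta) (Some m))).
apply: (le_trans (H x D _ mD _)).
- by move=> m; exact: enc_power.
- by move=> m m' y; rewrite /D/= => -> [].
apply: lee_sum => m _; rewrite /F -integral_indicT; last first.
  rewrite (_ : [set p | _] = ~` [set p | D m (x m + (p.1 + p.2))%R])//.
  apply: measurableC.
  exact: (measurable_preim (measurable_fun_rV_sum (x m)) (mD m)).
rewrite le_eqVlt; apply/orP; left; apply/eqP; apply: eq_integral => p _.
congr (_%:E); rewrite !indicE; congr (_%:R); congr nat_of_bool.
by apply/idP/idP; rewrite !inE /err_set /D /x/= (addrAC _ (p.1 + p.2)%R s).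
Qed.

End noise.

Definition cst_kernel n (J : probability 'rV[R]_n R) : R.-pker 'rV[R]_n ~> 'rV[R]_n :=
  kprobability (measurable_cst (J : pprobability 'rV[R]_n R)).

Definition product_law n (J J' : probability 'rV[R]_n R) :
  probability ('rV[R]_n * 'rV[R]_n)%type R := (J \x J')%E.

Lemma error_prob_cst n K (P sigma sigmaS : R) (C : rand_code n K P)
    (J : probability 'rV[R]_n R) m :
  error_prob sigma sigmaS C m (cst_kernel J) =
  \int[gauss_vec sigmaS n]_s noise_error C (product_law J (gauss_vec sigma n)) m s.
Proof.
rewrite error_probE; apply: eq_integral => s _.
pose f (p : 'rV[R]_n * 'rV[R]_n) := cond_error C m s (p.1 + p.2)%R.
have mf : measurable_fun setT f.
  have mp : measurable_fun setT (fun p : 'rV[R]_n * 'rV[R]_n => (s, p.1 + p.2)%R).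
    apply/measurable_fun_pairP; split => /=; first exact: measurable_cst.
    by apply: measurable_rVD; [exact: measurable_fst|exact: measurable_snd].
  exact: (measurableT_comp (measurable_cond_error C m) mp).
exact: (esym (@fubini_tonelli1 _ _ _ _ R J (gauss_vec sigma n) f mf
  (fun=> cond_error_ge0 _ _ _ _))).
Qed.

(* The jammer ignores the message and the state. *)
Lemma avg_code_error_ge n K (P L sigma sigmaS e : R) (C : rand_code n K P)
    (J : probability 'rV[R]_n R) :
  (0 < K)%N -> (0 <= e)%R -> J (power_ball L) = 1 ->
  (forall (x : 'I_K -> 'rV[R]_n) (D : 'I_K -> set 'rV[R]_n),
    (forall m, (sqnorm (x m) <= n%:R * P)%R) -> (forall m, measurable (D m)) ->
    (forall m m' y, D m y -> D m' y -> m = m') ->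
    (K%:R * e)%:E <= \sum_(m < K) product_law J (gauss_vec sigma n)
      [set p | ~ D m (x m + (p.1 + p.2))%R]) ->
  e%:E <= code_error AvgError L sigma sigmaS C.
Proof.
move=> K0 e0 JL H; rewrite /code_error.
have KR : (0 < K%:R :> R)%R by rewrite ltr0n.
have Ke : (0 <= K%:R * e)%R by rewrite mulr_ge0.
have -> : e%:E = (K%:R^-1)%:E * (K%:R * e)%:E.
  by rewrite -EFinM mulKf// gt_eqF.
apply: lee_wpmul2l; first by rewrite lee_fin invr_ge0.
apply: (@le_trans _ _ (\sum_(m < K) error_prob sigma sigmaS C m (cst_kernel J))).
  pose nu := product_law J (gauss_vec sigma n).
  rewrite (eq_bigr (fun m => \int[gauss_vec sigmaS n]_s noise_error C nu m s)); last first.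
    by move=> m _; exact: error_prob_cst.
  have mN m := measurable_noise_error C nu m.
  have N0 m s := noise_error_ge0 C nu m s.
  rewrite -ge0_integral_sum//.
  rewrite -(@integral_probability_cst R _ _ (gauss_vec sigmaS n) (K%:R * e)%:E).
  apply: ge0_le_integralT => //; first exact: emeasurable_sum.
  by move=> s; exact: sum_noise_error_ge.
apply: lee_sum => m _.
by apply: ereal_sup_ubound; exists (cst_kernel J).
Qed.

End converse_reduction.

(** * Comparison of output laws with a single Gaussian law *)

Section converse_bounds.
Context (R : realType).
Local Open Scope ereal_scope.

Lemma sum_indic_disjoint n K (D : 'I_K -> set 'rV[R]_n) (y : 'rV[R]_n) :
  (forall m m', D m y -> D m' y -> m = m') ->
  (\sum_(m < K) (\1_(D m) y : R) <= 1)%R.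
Proof.
move=> Dd; have [[m Dm]|no] := pselect (exists m, D m y).
  rewrite (bigD1 m)//= indicE mem_set// big1 ?addr0// => m' mm.
  rewrite indicE memNset// => Dm'; move/eqP: mm; apply; exact: Dd.
rewrite big1 ?ler01// => m _; rewrite indicE memNset// => Dm.
by apply: no; exists m.
Qed.

Lemma product_lawE n (J J' : probability 'rV[R]_n R) (x : 'rV[R]_n) (D : set 'rV[R]_n) :
  measurable D ->
  product_law J J' [set p | D (x + (p.1 + p.2))%R] =
  \int[J]_j \int[J']_z (\1_D (x + (j + z))%R)%:E.
Proof.
move=> mD; have ms := measurable_fun_rV_sum x.
have mI : measurable_fun setT (fun y => (\1_D y)%:E : \bar R).
  exact/measurable_EFinP/measurable_indic.
have mS := measurable_preim ms mD.
rewrite -(integral_indicT (product_law J J') mS).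
exact: (@fubini_tonelli1 _ _ _ _ R J J' (fun p => (\1_D (x + (p.1 + p.2))%R)%:E)
  (measurableT_comp mI ms) (fun=> (_ : 0 <= _%:E))).
Qed.

Lemma sqnormB_le n (x y : 'rV[R]_n) :
  (sqnorm (y - x) <= 2 * sqnorm y + 2 * sqnorm x)%R.
Proof. by have := sqnorm_ge0 (y + x); rewrite sqnormB sqnormD; lra. Qed.

(* Without jamming, all output laws dominate a common multiple of a fixed law. *)
Lemma overlap_error n K (P sigma : R) (x : 'I_K -> 'rV[R]_n) (D : 'I_K -> set 'rV[R]_n) :
  (0 < K)%N -> sigma != 0%R ->
  (forall m, (sqnorm (x m) <= n%:R * P)%R) -> (forall m, measurable (D m)) ->
  (forall m m' y, D m y -> D m' y -> m = m') ->
  ((K%:R - 1) * expR (- (n%:R * (P / sigma ^+ 2 + ln 2 / 2))))%:E <=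
  \sum_(m < K) product_law (dirac (0 : 'rV[R]_n)%R) (gauss_vec sigma n)
    [set p | ~ D m (x m + (p.1 + p.2))%R].
Proof.
move=> K0 s0 xP mD Dd; have s2 : (0 < sigma ^+ 2)%R by rewrite exprn_even_gt0.
pose b := (- (2 * sigma ^+ 2)^-1)%R.
have bE : (2 * b * sigma ^+ 2 = - 1)%R by rewrite /b; field.
(* Lower bound, common to all [x m], for the likelihood ratio of N(x m, sigma^2) to N(0, sigma^2);
   it follows from [sqnormB_le] and the power constraint. *)
pose g (y : 'rV[R]_n) : \bar R :=
  (expR (- (n%:R * (P / sigma ^+ 2)) + (dotr 0 y + b * sqnorm y)))%:E.
have mg' : measurable_fun setT
    (fun y : 'rV[R]_n => (expR (dotr 0 y + b * sqnorm y))%:E).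
  apply/measurable_EFinP; apply: measurableT_comp => //.
  apply: measurable_funD; first exact: measurable_dotr.
  by apply: measurable_funM => //; exact: (measurable_sqnorm (f := id)).
have gE y : g y = (expR (- (n%:R * (P / sigma ^+ 2))))%:E *
    (expR (dotr 0 y + b * sqnorm y))%:E by rewrite /g -EFinM -expRD.
have mg : measurable_fun setT g.
  rewrite (_ : g = fun y => (expR (- (n%:R * (P / sigma ^+ 2))))%:E *
    (expR (dotr 0 y + b * sqnorm y))%:E); last exact/funext.
  exact: emeasurable_funM.
have g0 y : 0 <= g y by rewrite lee_fin expR_ge0.
have Ig : \int[gauss_vec sigma n]_y g y =
    (expR (- (n%:R * (P / sigma ^+ 2 + ln 2 / 2))))%:E.
  under eq_integral do rewrite gE.
  rewrite ge0_integralZlT// gauss_mgf//; last by rewrite bE; lra.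
  rewrite -EFinM -expRD bE sqnorm0.
  by congr (expR _)%:E; rewrite (_ : 1 - -1 = 2)%R; [ring|lra].
have mDC m : measurable (~` D m) by exact: measurableC.
have mI m : measurable_fun setT (fun y => (\1_(~` D m) y)%:E : \bar R).
  exact/measurable_EFinP/measurable_indic.
apply: (@le_trans _ _ (\sum_(m < K) \int[gauss_vec sigma n]_y ((\1_(~` D m) y)%:E * g y))).
  have mIg m : measurable_fun setT (fun y => (\1_(~` D m) y)%:E * g y).
    exact: emeasurable_funM.
  have Ig0 m y : 0 <= (\1_(~` D m) y : R)%:E * g y by rewrite mule_ge0// lee_fin.
  rewrite -ge0_integral_sum// EFinM -Ig -ge0_integralZlT//; last first.
    by rewrite lee_fin subr_ge0 ler1n.
  apply: ge0_le_integralT.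
  - exact: emeasurable_funM.
  - exact: emeasurable_sum.
  - by move=> y; rewrite mule_ge0// lee_fin subr_ge0 ler1n.
  move=> y; rewrite -ge0_sume_distrl; last by move=> m _; rewrite lee_fin.
  (* Each [y] lies in at most one decoding set, hence outside at least [K - 1] of them. *)
  apply: lee_wpmul2r => //; rewrite sumEFin lee_fin.
  rewrite (eq_bigr (fun m => 1 - \1_(D m) y)%R); last first.
    by move=> m _; rewrite !indicE in_setC; case: (y \in D m); rewrite /= ?subrr ?subr0.
  rewrite sumrB sumr_const card_ord lerD2l lerN2.
  by apply: sum_indic_disjoint => m m'; exact: Dd.
apply: lee_sum => m _.
rewrite (@product_lawE n _ _ (x m) (~` D m))//.
have I0 m' y : 0 <= (\1_(~` D m') y : R)%:E by rewrite lee_fin.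
have mJ : measurable_fun setT (fun j : 'rV[R]_n =>
    \int[gauss_vec sigma n]_z (\1_(~` D m) (x m + (j + z))%R : R)%:E).
  pose h (p : 'rV[R]_n * 'rV[R]_n) : \bar R :=
    (\1_(~` D m) (x m + (p.1 + p.2))%R)%:E.
  have mh : measurable_fun setT h.
    exact: (measurableT_comp (mI m) (measurable_fun_rV_sum (x m))).
  have h0 p : 0 <= h p by exact: I0.
  exact: (measurable_fun_fubini_tonelli_F h mh h0).
rewrite integral_dirac// diracT mul1e.
under [leRHS]eq_integral do rewrite add0r.
rewrite (gauss_shift (x m) s0 s0 (mI m) (I0 m)).
apply: ge0_le_integralT.
- exact: emeasurable_funM.
- by apply: emeasurable_funM => //; exact: measurable_gauss_ratio.
- by move=> y; rewrite mule_ge0// lee_fin.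
move=> y; apply: lee_wpmul2l; first by rewrite lee_fin.
rewrite lee_fin ler_expR divff ?gt_eqF// ln1 mul0r mulr0 add0r.
have -> : dotr 0 y = 0%R by apply: big1 => i _; rewrite mxE mul0r.
have h1 := sqnormB_le (x m) y; have h2 := xP m.
have sN : (sigma ^+ 2 != 0)%R by rewrite gt_eqF.
have -> : (- (n%:R * (P / sigma ^+ 2)) + (0 + b * sqnorm y) =
    (- (2 * (n%:R * P)) - sqnorm y) / (2 * sigma ^+ 2))%R.
  by rewrite /b; field.
have q : (0 < (2 * sigma ^+ 2)^-1)%R by rewrite invr_gt0 pmulr_rgt0.
rewrite -mulrBl (ler_pM2r q).
lra.
Qed.

(* The law of [x + w] is compared with [N(0, P + s ^+ 2)]: the density ratio is at
   most [expR (n * (c + del))] outside an event bounded by a Chernoff estimate. *)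
Lemma gauss_hit_le (s s' P del : R) n (x : 'rV[R]_n) (D : set 'rV[R]_n) :
  s != 0%R -> (0 < P)%R -> (s' ^+ 2 = P + s ^+ 2)%R -> (0 < del)%R ->
  (sqnorm x <= n%:R * P)%R -> measurable D ->
  gauss_vec s n [set w | D (x + w)%R] <=
  (expR (n%:R * (ln (s' ^+ 2 / s ^+ 2) / 2 + del)))%:E * gauss_vec s' n D +
  (expR (- (n%:R * (s' ^+ 2 * del ^+ 2 / (4 * P)))))%:E.
Proof.
move=> s0 P0 s'E del0 xP mD.
have s2 : (0 < s ^+ 2)%R by rewrite exprn_even_gt0.
have s'2 : (0 < s' ^+ 2)%R by rewrite s'E addr_gt0.
have s'0 : s' != 0%R by apply: contraTneq s'2 => ->; rewrite expr0n ltxx.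
pose c := (ln (s' ^+ 2 / s ^+ 2) / 2)%R.
pose rho y := (n%:R * c + sqnorm y / (2 * s' ^+ 2) - sqnorm (y - x) / (2 * s ^+ 2))%R.
have mrho : measurable_fun setT rho.
  apply: measurable_funB.
    apply: measurable_funD => //; apply: measurable_funM => //.
    exact: (measurable_sqnorm (f := id)).
  apply: measurable_funM => //; apply: measurable_sqnorm; exact: measurable_rVB.
pose A := [set y | (rho y <= n%:R * (c + del))%R].
have mA : measurable A by exact: measurable_setle.
pose S := D `&` A.
have mS : measurable S by exact: measurableI.
have mxw : measurable_fun setT (fun w : 'rV[R]_n => (x + w)%R) by exact: measurable_rVD.
pose B := [set w | ~ A (x + w)%R].
have mB : measurable B by exact: (measurable_preim mxw (measurableC mA)).
have mSx := measurable_preim mxw mS.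
have mI (E : set 'rV[R]_n) : measurable E ->
    measurable_fun setT (fun y => (\1_E y)%:E : \bar R).
  by move=> mE; exact/measurable_EFinP/measurable_indic.
have hS : gauss_vec s n [set w | S (x + w)%R] <=
    (expR (n%:R * (c + del)))%:E * gauss_vec s' n D.
  rewrite -(integral_indicT (gauss_vec s n) mSx).
  rewrite (gauss_shift x s0 s'0 (mI _ mS)); last by move=> y; rewrite lee_fin.
  rewrite -(integral_indicT (gauss_vec s' n) mD) -ge0_integralZlT//; last first.
    exact: mI.
  apply: ge0_le_integralT.
  - by apply: emeasurable_funM; [exact: mI|exact: measurable_gauss_ratio].
  - by apply: emeasurable_funM => //; exact: mI.
  - by move=> y; rewrite mule_ge0// lee_fin.
  move=> y; rewrite /S -!EFinM lee_fin !indicE.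
  have [/set_mem [Dy Ay]|_] := boolP (y \in D `&` A); last by rewrite mul0r mulr_ge0.
  by rewrite (mem_set Dy) mul1r mulr1 ler_expR.
suff hB : gauss_vec s n B <= (expR (- (n%:R * (s' ^+ 2 * del ^+ 2 / (4 * P)))))%:E.
  apply: (@le_trans _ _ (gauss_vec s n ([set w | S (x + w)%R] `|` B))).
    apply: le_measure; rewrite ?inE.
    - exact: (measurable_preim mxw mD).
    - exact: measurableU.
    - move=> w /= Dw; have [Aw|Aw] := pselect (A (x + w)%R); last by right.
      by left; split.
  apply: (le_trans (measureU2 _ _ _)) => //.
  by apply: leeD; [exact: hS|exact: hB].
(* The minimiser of - 2 b del s'^2 + 4 b^2 P s'^2, the exponent per coordinate reached at the
   end. *)
pose b := (del / (4 * P))%R.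
have b0 : (0 < b)%R by rewrite divr_gt0// mulr_gt0.
have mg : measurable_fun setT (fun w : 'rV[R]_n =>
    (expR (dotr ((2 * b) *: x) w + (- (b * P / s ^+ 2)) * (sqnorm w - n%:R * s ^+ 2)))%:E).
  apply/measurable_EFinP; apply: measurableT_comp => //.
  apply: measurable_funD; first exact: measurable_dotr.
  apply: measurable_funM => //; apply: measurable_funB => //.
  exact: (measurable_sqnorm (f := id)).
have sN : (s ^+ 2 != 0)%R by rewrite gt_eqF.
apply: (@le_trans _ _ (\int[gauss_vec s n]_w ((expR (- (2 * b * n%:R * del * s' ^+ 2)))%:E *
    (expR (dotr ((2 * b) *: x) w + (- (b * P / s ^+ 2)) * (sqnorm w - n%:R * s ^+ 2)))%:E))).
  apply: markov_le => //.
  - exact: emeasurable_funM.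
  move=> w /negP; rewrite -ltNge /rho => h.
  rewrite -EFinM -expRD lee_fin -[leLHS]expR0 ler_expR dotrZl.
  have xwx : (x + w - x = w)%R by rewrite addrAC subrr add0r.
  rewrite xwx in h.
  have h' : (n%:R * del < sqnorm (x + w) / (2 * s' ^+ 2) - sqnorm w / (2 * s ^+ 2))%R by lra.
  have h2 : (n%:R * del * (2 * s' ^+ 2) <
      sqnorm (x + w) - sqnorm w * s' ^+ 2 / s ^+ 2)%R.
    have q : (0 < 2 * s' ^+ 2)%R by rewrite mulr_gt0.
    rewrite -(ltr_pdivlMr _ _ q); move: h'; congr (_ < _)%R.
    by field; rewrite s0 s'0.
  have h3 : (sqnorm w * s' ^+ 2 / s ^+ 2 = sqnorm w + sqnorm w * P / s ^+ 2)%R.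
    by rewrite s'E; field.
  rewrite h3 sqnormD in h2.
  have h4 : (0 <= b * (2 * dotr x w + n%:R * P - sqnorm w * P / s ^+ 2 -
      n%:R * del * (2 * s' ^+ 2)))%R.
    by apply: mulr_ge0; [exact: ltW|lra].
  apply: (le_trans h4); rewrite le_eqVlt; apply/orP; left; apply/eqP.
  by field.
rewrite ge0_integralZlT//.
have b1 : (2 * (- (b * P / s ^+ 2)) * s ^+ 2 = - (2 * b * P))%R by field.
apply: (@le_trans _ _ ((expR (- (2 * b * n%:R * del * s' ^+ 2)))%:E *
    (expR (s ^+ 2 * sqnorm ((2 * b) *: x) + n%:R * (- (2 * b * P)) ^+ 2))%:E)).
  apply: lee_wpmul2l; first by rewrite lee_fin.
  rewrite -b1; apply: gauss_chernoff => //; rewrite b1.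
  have : (0 < b * P)%R by exact: mulr_gt0.
  lra.
rewrite -EFinM -expRD lee_fin ler_expR sqnormZ.
have h1 : (4 * b ^+ 2 * s ^+ 2 * sqnorm x <= 4 * b ^+ 2 * s ^+ 2 * (n%:R * P))%R.
  apply: ler_wpM2l => //; apply: mulr_ge0; last exact: ltW.
  by have := sqr_ge0 b; lra.
apply: (@le_trans _ _ (- (2 * b * n%:R * del * s' ^+ 2) + n%:R * (4 * b ^+ 2 * P * s' ^+ 2))%R).
  by rewrite s'E; lra.
rewrite le_eqVlt; apply/orP; left; apply/eqP; rewrite /b; field.
by rewrite gt_eqF.
Qed.

End converse_bounds.

(** * Truncated Gaussian jamming *)

Section converse.
Context (R : realType).
Local Open Scope ereal_scope.

(** An overflowing vector is replaced by 0, which is admissible for [0 <= L]; truncated and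
    untruncated jammers then coincide off the overflow event. *)
Definition truncate L n (g : 'rV[R]_n) : 'rV[R]_n :=
  if (sqnorm g <= n%:R * L)%R then g else 0%R.

Lemma measurable_truncate L n : measurable_fun setT (@truncate L n).
Proof.
apply: measurable_fun_ifT => //; apply: measurable_fun_ler => //.
exact: (measurable_sqnorm (f := id)).
Qed.

HB.instance Definition _ L n :=
  isMeasurableFun.Build _ _ _ _ (@truncate L n) (@measurable_truncate L n).

Definition jam_law a L n : probability 'rV[R]_n R :=
  distribution (gauss_vec a n) (@truncate L n).

Lemma jam_law_ball a L n : (0 <= L)%R -> jam_law a L n (power_ball L) = 1.
Proof.
move=> L0; rewrite -(@probability_setT _ _ _ (gauss_vec a n)).
congr (gauss_vec a n _); apply/seteqP; split => // g _.
rewrite /preimage /power_ball /= /truncate; case: ifP => // _.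
by rewrite sqnorm0 mulr_ge0.
Qed.

(** Coupling of the two jammers through the same [g]: without truncation jamming plus noise is
    Gaussian by [gauss_convolution], and the difference is paid by the overflow event, written with
    [0 + g] to match [gauss_tail] at [j = 0]. *)
Lemma jam_hit_le (a b c L : R) n (x : 'rV[R]_n) (D : set 'rV[R]_n) :
  a != 0%R -> b != 0%R -> (c ^+ 2 = a ^+ 2 + b ^+ 2)%R -> measurable D ->
  product_law (jam_law a L n) (gauss_vec b n) [set p | D (x + (p.1 + p.2))%R] <=
  gauss_vec c n [set w | D (x + w)%R] +
  gauss_vec a n [set g | (n%:R * L < sqnorm (0 + g)%R)%R].
Proof.
move=> a0 b0 cE mD; rewrite product_lawE//.
pose f (y : 'rV[R]_n) : \bar R := (\1_D (x + y)%R)%:E.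
have f0 y : 0 <= f y by rewrite lee_fin.
have mxw : measurable_fun setT (fun w : 'rV[R]_n => (x + w)%R) by exact: measurable_rVD.
have mI (E : set 'rV[R]_n) : measurable E ->
    measurable_fun setT (fun y => (\1_E y)%:E : \bar R).
  by move=> mE; exact/measurable_EFinP/measurable_indic.
have mf : measurable_fun setT f by exact: (measurableT_comp (mI _ mD) mxw).
pose h (p : 'rV[R]_n * 'rV[R]_n) := f (p.1 + p.2)%R.
have mh : measurable_fun setT h.
  apply: (measurableT_comp mf); apply: measurable_rVD.
    exact: measurable_fst.
  exact: measurable_snd.
have h0 p : 0 <= h p by exact: f0.
pose H j := \int[gauss_vec b n]_z h (j, z).
have mH : measurable_fun setT H by exact: (measurable_fun_fubini_tonelli_F h mh h0).
have H0 j : 0 <= H j by apply: integral_ge0.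
pose B := [set g : 'rV[R]_n | (n%:R * L < sqnorm (0 + g)%R)%R].
have mB : measurable B.
  rewrite (_ : B = ~` [set z | sqball (n%:R * L)%R (0 + z)%R]).
    apply: measurableC; apply: measurable_sqball_comp; exact: measurable_rVD.
  by apply/seteqP; split => z; rewrite /B /sqball/= ltNge => /negP.
have -> : \int[jam_law a L n]_j \int[gauss_vec b n]_z (\1_D (x + (j + z))%R : R)%:E =
    \int[gauss_vec a n]_g H (truncate L g).
  apply/esym.
  exact: (@ge0_integral_map R _ _ _ _ (gauss_vec a n) (jam_law a L n)
    (@truncate L n) H (@measurable_truncate L n)).
have -> : gauss_vec c n [set w | D (x + w)%R] = \int[gauss_vec a n]_g H g.
  rewrite /H /h/= (gauss_convolution a0 b0 cE mf f0).
  rewrite -(integral_indicT (gauss_vec c n) (measurable_preim mxw mD)).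
  exact: eq_integral.
rewrite -(integral_indicT (gauss_vec a n) mB) -ge0_integralD//; last exact: mI.
apply: ge0_le_integralT.
- exact: (measurableT_comp mH (@measurable_truncate L n)).
- by apply: emeasurable_funD => //; exact: mI.
- by move=> g; exact: H0.
move=> g; rewrite /truncate; case: ifPn => gL.
  by rewrite -[leLHS]adde0 leeD// lee_fin.
rewrite indicE mem_set; last by rewrite /B/= add0r ltNge.
rewrite -[leLHS]add0e leeD//.
apply: (@integral_le_cst _ _ _ _ _ 1).
- exact: (measurableT_comp mh (pair1_measurable (0%R : 'rV[R]_n))).
- by move=> z; exact: h0.
- by move=> z; rewrite lee_fin indicE; case: (_ \in _).
Qed.

Lemma sum_prob_disjoint n K (Q : probability 'rV[R]_n R) (D : 'I_K -> set 'rV[R]_n) :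
  (forall m, measurable (D m)) ->
  (forall m m' y, D m y -> D m' y -> m = m') ->
  \sum_(m < K) Q (D m) <= 1.
Proof.
move=> mD Dd.
have mI m : measurable_fun setT (fun y => (\1_(D m) y)%:E : \bar R).
  exact/measurable_EFinP/measurable_indic.
rewrite (eq_bigr (fun m => \int[Q]_y (\1_(D m) y)%:E)); last first.
  by move=> m _; rewrite integral_indicT.
rewrite -ge0_integral_sum//.
apply: (@integral_le_cst _ _ _ _ _ 1).
- exact: emeasurable_sum.
- by move=> y; apply: sume_ge0 => m _; rewrite lee_fin.
- move=> y; rewrite sumEFin lee_fin; apply: sum_indic_disjoint => m m'.
  exact: Dd.
Qed.

(** The disjoint sets have total [Q]-mass at most 1, so the hit probabilities of all [K] messages
    sum to at most [G + K e]; this is far from [K] when [G] is small compared with [K]. *)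
Lemma miss_ge n K (nu : probability ('rV[R]_n * 'rV[R]_n)%type R)
    (Q : probability 'rV[R]_n R) (G e : R) (x : 'I_K -> 'rV[R]_n)
    (D : 'I_K -> set 'rV[R]_n) :
  (0 <= G)%R ->
  (forall m, measurable (D m)) ->
  (forall m m' y, D m y -> D m' y -> m = m') ->
  (forall m, nu [set p | D m (x m + (p.1 + p.2))%R] <= G%:E * Q (D m) + e%:E) ->
  (K%:R * (1 - e) - G)%:E <=
    \sum_(m < K) nu [set p | ~ D m (x m + (p.1 + p.2))%R].
Proof.
move=> G0 mD Dd H; pose q m := fine (Q (D m)).
have qE m : Q (D m) = (q m)%:E by rewrite /q fineK// fin_num_measure.
have sq : (\sum_(m < K) q m <= 1)%R.
  rewrite -lee_fin -sumEFin (eq_bigr (fun m => Q (D m))); last by move=> m _; rewrite qE.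
  exact: sum_prob_disjoint.
apply: (@le_trans _ _ (\sum_(m < K) (1 - (G * q m + e))%:E)).
  rewrite sumEFin lee_fin sumrB big_split/= -mulr_sumr !sumr_const card_ord.
  rewrite -[(1 *+ K)%R]/(K%:R)%R -[(e *+ K)%R]mulr_natl.
  have : (G * \sum_(m < K) q m <= G * 1)%R by rewrite ler_wpM2l.
  by lra.
apply: lee_sum => m _.
pose S := [set p : 'rV[R]_n * 'rV[R]_n | D m (x m + (p.1 + p.2))%R].
have mS : measurable S by exact: (measurable_preim (measurable_fun_rV_sum (x m)) (mD m)).
have := H m; rewrite -/S qE -EFinM -EFinD => HS.
have -> : [set p | ~ D m (x m + (p.1 + p.2))%R] = ~` S by [].
rewrite probability_setC// EFinB leeB//.
Qed.

(** One [eps] must defeat every blocklength. From [n0] on the Gaussian jammer forces error 1/2; for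
    the finitely many smaller ones the overlap of the unjammed output laws suffices, there being at
    least two messages because [r > 0]. *)
Lemma not_achievable_avg (P L sigma sigmaS r : R) :
  (0 < P)%R -> (0 < L)%R -> sigma != 0%R ->
  (P < (2 `^ (2 * r) - 1) * (L + sigma ^+ 2))%R ->
  ~ achievable AvgError P L sigma sigmaS r.
Proof.
move=> P0 L0 s0; set X := (2 `^ (2 * r))%R => XP.
have s2 : (0 < sigma ^+ 2)%R by rewrite exprn_even_gt0.
have LS : (0 < L + sigma ^+ 2)%R by exact: addr_gt0.
have X1 : (0 < X - 1)%R by rewrite -(pmulr_lgt0 _ LS); exact: lt_trans XP.
have ln2 : (0 < ln 2 :> R)%R by rewrite ln_gt0// ltr1n.
have r0 : (0 < r)%R.
  rewrite ltNge; apply/negP => r0; have : (X <= 1)%R; last by lra.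
  rewrite /X powR2E -[leRHS]expR0 ler_expR -mulrA pmulr_rle0// mulr_le0_ge0//.
  exact: ltW.
pose gap := ((X - 1) * (L + sigma ^+ 2) - P)%R.
have gap0 : (0 < gap)%R by rewrite subr_gt0.
(* Back-off of the jamming power: the first bound keeps it positive, the second preserves the strict
   rate inequality. *)
pose eta := (Num.min (L / 2) (gap / (2 * (X - 1))))%R.
have eta0 : (0 < eta)%R by rewrite lt_min !divr_gt0// mulr_gt0.
have etaL : (eta <= L / 2)%R by rewrite ge_min lexx.
have etag : ((X - 1) * eta <= gap / 2)%R.
  apply: (@le_trans _ _ ((X - 1) * (gap / (2 * (X - 1))))%R).
    by rewrite ler_pM2l// ge_min lexx orbT.
  by rewrite le_eqVlt; apply/orP; left; apply/eqP; field; rewrite gt_eqF.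
pose L' := (L - eta)%R.
have L'0 : (0 < L')%R by rewrite /L'; lra.
have XP' : (P < (X - 1) * (L' + sigma ^+ 2))%R.
  by have := gap0; rewrite /L' /gap in etag *; lra.
pose a := Num.sqrt L'; have a2 : (a ^+ 2 = L')%R by rewrite sqr_sqrtr// ltW.
have a0 : a != 0%R by rewrite gt_eqF// sqrtr_gt0.
have N0 : (0 < L' + sigma ^+ 2)%R by exact: addr_gt0.
pose s := (Num.sqrt (L' + sigma ^+ 2))%R.
have sE : (s ^+ 2 = a ^+ 2 + sigma ^+ 2)%R by rewrite a2 sqr_sqrtr// ltW.
have sn0 : s != 0%R by rewrite gt_eqF// sqrtr_gt0.
pose s' := (Num.sqrt (P + (L' + sigma ^+ 2)))%R.
have s'E : (s' ^+ 2 = P + s ^+ 2)%R by rewrite sE a2 sqr_sqrtr// ltW// addr_gt0.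
pose c := (ln (s' ^+ 2 / s ^+ 2) / 2)%R.
have cr : (c < r * ln 2)%R.
  have : (ln (s' ^+ 2 / s ^+ 2) < ln X)%R.
    have X0 : (0 < X)%R by rewrite -[X](subrK 1%R) addr_gt0.
    have q0 : (0 < s' ^+ 2 / s ^+ 2)%R.
      by rewrite s'E sE a2; apply: divr_gt0 => //; exact: addr_gt0.
    rewrite ltr_ln// s'E sE a2 ltr_pdivrMr//.
    by move: XP'; clear; lra.
  by rewrite /X powR2E expRK /c; lra.
(* Half of the excess rate in nats, so that exp (n (c + del)) = K exp (- n del). *)
pose del := ((r * ln 2 - c) / 2)%R.
have del0 : (0 < del)%R by rewrite divr_gt0// subr_gt0.
pose kap := (s' ^+ 2 * del ^+ 2 / (4 * P))%R.
have kap0 : (0 < kap)%R.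
  apply: divr_gt0; last by rewrite mulr_gt0.
  by apply: mulr_gt0; [rewrite s'E sE a2 addr_gt0|rewrite exprn_gt0].
have a2L : (0 + a ^+ 2 < L)%R by rewrite add0r a2 /L'; lra.
have [a1 a10 tail] := gauss_tail (lexx 0%R) a0 a2L.
have six : (0 < 1 / 6 :> R)%R by [].
have [n1 Hn1] := expRN_small del0 six.
have [n2 Hn2] := expRN_small kap0 six.
have [n3 Hn3] := expRN_small a10 six.
pose n0 := (n1 + n2 + n3)%N.
pose c' := (P / sigma ^+ 2 + ln 2 / 2)%R.
have c'0 : (0 < c')%R by rewrite addr_gt0// divr_gt0.
pose eps := (Num.min (1 / 2) (expR (- (n0%:R * c')) / 2))%R.
have eps0 : (0 < eps)%R by rewrite lt_min divr_gt0//= divr_gt0// expR_gt0.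
move=> /(_ eps eps0)[n [K [C [n_gt0 KE]]]].
have nR : (0 < n%:R :> R)%R by rewrite ltr0n.
have KR : (1 < K%:R :> R)%R.
  by rewrite KE powR2E -[ltLHS]expR0 ltr_expR; apply: mulr_gt0 => //; exact: mulr_gt0.
have K1 : (1 < K)%N by rewrite -(ltr_nat R).
have K0 : (0 < K)%N by exact: ltnW.
apply/negP; rewrite -leNgt.
have [nn|nn] := leqP n0 n.
  apply: (@le_trans _ _ (1 / 2)%:E); first by rewrite lee_fin ge_min lexx.
  apply: (@avg_code_error_ge _ _ _ _ _ _ _ _ C (jam_law a L n)) => //.
    by apply: jam_law_ball; exact: ltW.
  move=> x D xP mD Dd.
  (* Three losses of 1/6 each leave 1/2: the Chernoff exception, the overflow of the jammer and the
     density factor [G = K / 6]. *)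
  apply: (@le_trans _ _ (K%:R * (1 - (1 / 6 + 1 / 6)) - K%:R * (1 / 6))%:E).
    by rewrite lee_fin; clear -KR; lra.
  apply: (@miss_ge n K _ (gauss_vec s' n)) => //.
  move=> m; apply: (le_trans (jam_hit_le L (x m) a0 s0 sE (mD m))).
  rewrite [(1 / 6 + 1 / 6)%:E]EFinD addeA; apply: leeD; last first.
    have z0 : (sqnorm (0 : 'rV[R]_n)%R <= n%:R * 0)%R.
      by rewrite mulr0 sqnorm0.
    apply: (le_trans (tail n 0%R z0)); rewrite lee_fin; apply/ltW/Hn3.
    by apply: leq_trans nn; rewrite /n0 leq_addl.
  apply: (le_trans (gauss_hit_le sn0 P0 s'E del0 (xP m) (mD m))).
  apply: leeD.
    apply: lee_wpmul2r => //; rewrite lee_fin -/c.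
    have -> : expR (n%:R * (c + del)) = (K%:R * expR (- (n%:R * del)))%R.
      rewrite KE powR2E -expRD; congr expR; rewrite /del; lra.
    rewrite ler_wpM2l//; apply/ltW/Hn1.
    by apply: leq_trans nn; rewrite /n0 -addnA leq_addr.
  rewrite lee_fin; apply/ltW/Hn2.
  by apply: leq_trans nn; rewrite /n0 addnAC leq_addl.
apply: (@le_trans _ _ (expR (- (n%:R * c')) / 2)%:E).
  rewrite lee_fin ge_min; apply/orP; right.
  rewrite ler_pM2r// ler_expR lerN2 ler_pM2r// ler_nat.
  exact: ltnW.
have d0 : (dirac (0 : 'rV[R]_n)%R : probability _ R) (power_ball L) = 1.
  rewrite /= diracE mem_set// /power_ball/= sqnorm0.
  by apply: mulr_ge0 => //; exact: ltW.
apply: (@avg_code_error_ge _ _ _ _ _ _ _ _ C (dirac (0 : 'rV[R]_n)%R)) => //.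
move=> x D xP mD Dd; apply: le_trans (overlap_error K0 s0 xP mD Dd).
rewrite lee_fin -/c'.
(* With at least two messages [K - 1] is at least [K / 2], whence the factor 1/2 in [eps]. *)
have K2 : (2 <= K%:R :> R)%R by rewrite (ler_nat R 2).
have := expR_ge0 (- (n%:R * c'))%R; move: (expR _) => E E0.
have : (0 <= (K%:R - 2) * E)%R by apply: mulr_ge0 => //; lra.
clear; lra.
Qed.

End converse.

(** * The two bounds on the capacity *)

Section capacity_bounds.
Context (R : realType).
Local Open Scope ereal_scope.

Lemma achievable_MaxAvg (P L sigma sigmaS r : R) :
  achievable MaxError P L sigma sigmaS r -> achievable AvgError P L sigma sigmaS r.
Proof.
move=> H eps eps0; have [n [K [C [n0 KE Ce]]]] := H eps eps0.
exists n, K, C; split=> //; apply: le_lt_trans Ce => /=.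
set M := \big[maxe/0]_(m < K) _.
have M0 : 0 <= M by exact: bigmax_ge_id.
have [Moo|Mfin] := eqVneq M +oo; first by rewrite Moo leey.
have ME : M = (fine M)%:E by rewrite fineK// ge0_fin_numE// ltey.
have K0 : (0 < K%:R :> R)%R by rewrite KE powR_gt0.
apply: (@le_trans _ _ ((K%:R^-1)%:E * \sum_(m < K) M)).
  apply: lee_wpmul2l; first by rewrite lee_fin invr_ge0.
  by apply: lee_sum => m _; exact: le_bigmax.
rewrite ME sumEFin sumr_const card_ord -EFinM lee_fin.
by rewrite -[(fine M *+ K)%R]mulr_natl mulKf// gt_eqF.
Qed.

Lemma capacity_le (c : criterion) (P L sigma sigmaS : R) :
  (0 < P)%R -> (0 < L)%R -> sigma != 0%R ->
  capacity c P L sigma sigmaS <= (1 / 2 * log2 (1 + P / (L + sigma ^+ 2)))%:E.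
Proof.
move=> P0 L0 s0; apply: ge_ereal_sup => _ [r Hr <-].
have {}Hr : achievable AvgError P L sigma sigmaS r.
  by case: c Hr => //; exact: achievable_MaxAvg.
have ln2 : (0 < ln 2 :> R)%R by rewrite ln_gt0// ltr1n.
have N0 : (0 < L + sigma ^+ 2)%R by rewrite addr_gt0// exprn_even_gt0.
have Y0 : (0 < 1 + P / (L + sigma ^+ 2))%R by rewrite addr_gt0// divr_gt0.
rewrite lee_fin leNgt; apply/negP => rC.
apply: (not_achievable_avg P0 L0 s0 _ Hr).
rewrite -ltr_pdivrMr// ltrBrDl powR2E -[ltLHS]lnK ?posrE// ltr_expR.
rewrite -ltr_pdivrMr//.
by move: rC; rewrite /log2; clear; lra.
Qed.

(** Rational rates below the limit are achievable by [achievable_ratio], and they come within any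
    [e] of it. *)
Lemma capacity_ge (c : criterion) (P L sigma sigmaS : R) :
  (0 < P)%R -> (0 < L)%R -> sigma != 0%R ->
  (1 / 2 * log2 (1 + P / (L + sigma ^+ 2)))%:E <= capacity c P L sigma sigmaS.
Proof.
move=> P0 L0 s0.
have ln2 : (0 < ln 2 :> R)%R by rewrite ln_gt0// ltr1n.
have N0 : (0 < L + sigma ^+ 2)%R by rewrite addr_gt0// exprn_even_gt0.
have Y1 : (1 < 1 + P / (L + sigma ^+ 2))%R by rewrite ltrDl divr_gt0.
have Y0 : (0 < 1 + P / (L + sigma ^+ 2))%R by exact: lt_trans Y1.
set C := (1 / 2 * _)%R.
have C0 : (0 < C)%R by rewrite /C /log2 mulr_gt0// divr_gt0// ln_gt0.
have ach (a q : nat) : (0 < q)%N -> (a%:R / q%:R < C)%R ->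
    (a%:R / q%:R)%:E <= capacity c P L sigma sigmaS.
  move=> q0 aC; apply: ereal_sup_ubound; exists (a%:R / q%:R)%R => //.
  apply: achievable_ratio => //.
  rewrite -ltr_pdivlMr// ltrBlDl powR2E -[ltRHS]lnK ?posrE// ltr_expR.
  rewrite -ltr_pdivlMr//.
  by move: aC; rewrite /C /log2; clear; lra.
apply/lee_addgt0Pr => e e0; rewrite -leeBlDr// -EFinB.
(* When the limit is at most [e], the rate 0 = 0 / 1 is already close enough. *)
have [Ce|Ce] := leP C e.
  apply: le_trans (ach 0%N 1%N _ _) => //; last by rewrite mul0r.
  by rewrite lee_fin mul0r subr_le0.
(* The grid of step 1 / q is finer than [e], so its first point beyond [C - e], namely (a + 1) / q,
   is still below [C]. *)
pose q := (Num.truncn (e^-1)).+1.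
have q0 : (0 < q%:R :> R)%R by rewrite ltr0n.
have qe : (1 < e * q%:R)%R.
  by rewrite -ltr_pdivrMl// mulr1 truncnS_gt.
pose a := Num.truncn ((C - e) * q%:R)%R.
have x0 : (0 <= (C - e) * q%:R)%R by rewrite mulr_ge0// subr_ge0 ltW.
have /andP[a1 a2] := truncn_itv x0.
apply: le_trans (ach a.+1 q _ _) => //.
  by rewrite lee_fin ler_pdivlMr// ltW.
rewrite ltr_pdivrMr// -natr1; move: a1 qe; rewrite -/a.
by clear; lra.
Qed.

End capacity_bounds.

Theorem mainTheorem4 (R : realType) (P L sigma sigmaS : R)
    (P_gt0 : 0 < P) (L_gt0 : 0 < L)
    (sigma2_gt0 : 0 < sigma ^+ 2) (sigmaS2_gt0 : 0 < sigmaS ^+ 2) :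
  capacity MaxError P L sigma sigmaS = capacity AvgError P L sigma sigmaS /\
  capacity MaxError P L sigma sigmaS =
    (1 / 2 * log2 (1 + P / (L + sigma ^+ 2)))%:E /\
  capacity AvgError P L sigma sigmaS =
    (1 / 2 * log2 (1 + P / (L + sigma ^+ 2)))%:E.
Proof.
have s0 : sigma != 0 by apply: contraTneq sigma2_gt0 => ->; rewrite expr0n ltxx.
have capE c : capacity c P L sigma sigmaS =
    (1 / 2 * log2 (1 + P / (L + sigma ^+ 2)))%:E.
  by apply/le_anti; rewrite capacity_le// capacity_ge.
by rewrite !capE.
Qed.
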